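(* Let $\alpha\in(0,1)$ be a constant, and for each $n$ (through which $n\to\infty$, with $\alpha n$ an integer) let $G=G_n$ be an $\alpha n$-regular graph with vertex set $[n]$. Let $m=m(n)$ satisfy $n^2/\log n\ll m\ll n^2$, let $G(m)$ be obtained from $G$ by adding $m$ random edges, and let the edges of $G(m)$ be given independent exponential mean one random lengths. Let $d_{i,j}$ denote the shortest distance between vertex $i$ and vertex $j$. Then w.h.p. $$d_{1,2}\approx \frac{\log n}{\alpha n},\qquad \max_{j\in[n]}d_{1,j}\approx\frac{2\log n}{\alpha n},\qquad \max_{i,j\in[n]}d_{i,j}\approx\frac{3\log n}{\alpha n}.$$ In addition, if $\alpha>1/2$ then the same three estimates hold w.h.p. without the use of random edges, i.e. when $d_{i,j}$ denotes the shortest distance in $G$ itself with independent exponential mean one edge lengths.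
   Context: $G(m)$ is obtained from $G$ by adding a uniformly random set of $m$ edges (pairs of distinct vertices) not in $G$. The distance $d_{i,j}$ is the minimum over paths from $i$ to $j$ of the sum of the edge lengths along the path. ''W.h.p.'' means with probability tending to $1$ as $n\to\infty$, over the choice of added edges (if any) and the edge lengths. $A_n\approx B_n$ means $A_n=(1+o(1))B_n$ as $n\to\infty$ (so $X_n\approx b_n$ w.h.p. for random $X_n$ means that for every fixed $\delta>0$, $|X_n/b_n-1|\le\delta$ with probability tending to $1$); $A_n\gg B_n$ (equivalently $B_n\ll A_n$) means $A_n/B_n\to\infty$. *)

(* Defs.v *)
From HB Require Import structures.
From mathcomp Require Export all_boot all_order all_algebra.
From mathcomp Require Export all_classical all_reals all_analysis.

Set Implicit Arguments.
Unset Strict Implicit.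
Unset Printing Implicit Defensive.
Export Order.TTheory GRing.Theory Num.Theory.
Export numFieldNormedType.Exports.

Local Open Scope classical_set_scope.
Local Open Scope ring_scope.

(* A simple graph on a finite vertex set is its set of edges, an edge being an
   unordered pair [set u; v] of distinct vertices. *)
Definition vertex_pairs (V : finType) : {set {set V}} :=
  [set e : {set V} | #|e| == 2%N].

Definition is_graph (V : finType) (E : {set {set V}}) : Prop :=
  E \subset vertex_pairs V.

Definition neighbours (V : finType) (E : {set {set V}}) (v : V) : {set V} :=
  [set w | [set v; w]%SET \in E].

(* The degree r is a scalar so that it can be alpha * n; it is then forced to
   be a natural number. *)
Definition regular_of_degree (R : realType) (V : finType) (r : R)
    (E : {set {set V}}) : Prop :=
  forall v : V, #|neighbours E v|%:R = r.

(* The path i, p_1, ..., p_l is given by its tail p = [:: p_1; ...; p_l];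
   p = [::] is the path of length 0 from i to i. *)
Definition paths (V : finType) (E : {set {set V}}) (i j : V) : set (seq V) :=
  [set p | [/\ path [rel u v | [set u; v]%SET \in E] i p, uniq (i :: p)
             & last i p = j]].

Fixpoint path_length (R : realType) (V : finType) (len : {set V} -> R)
    (i : V) (p : seq V) : R :=
  if p is v :: q then len [set i; v]%SET + path_length len v q else 0.

(* The set of paths is finite, so the infimum is a minimum, or +oo when i and j
   are in different components. *)
Definition dist (R : realType) (V : finType) (E : {set {set V}})
    (len : {set V} -> R) (i j : V) : \bar R :=
  ereal_inf [set (path_length len i p)%:E | p in paths E i j].

Definition max_dist_from (R : realType) (V : finType) (E : {set {set V}})
    (len : {set V} -> R) (i : V) : \bar R :=
  (\big[maxe/-oo]_(j : V) dist E len i j)%E.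

Definition max_dist (R : realType) (V : finType) (E : {set {set V}})
    (len : {set V} -> R) : \bar R :=
  (\big[maxe/-oo]_(i : V) \big[maxe/-oo]_(j : V) dist E len i j)%E.

(* For an event C of positive probability this says that, conditionally on C,
   the X e with e \in F are independent exponential variables with mean one:
   choosing B e = setT for some of the e gives the product rule for every
   subfamily of F, and for one-element subfamilies the marginal laws. C = setT is
   the unconditional notion. Nothing is said about X e for e \notin F. *)
Definition iid_exp1_given (R : realType) (d : measure_display)
    (T : measurableType d) (P : probability T R) (C : set T)
    (I : finType) (F : {set I}) (X : I -> {RV P >-> R}) : Prop :=
  forall B : I -> set R, (forall e, measurable (B e)) ->
    P (C `&` \bigcap_(e in [set` F]) (X e @^-1` B e)) =
    (P C * \prod_(e in F) exponential_prob (1 : R) (B e))%E.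

(* The random set A of added edges is uniform among the m-element sets of
   non-edges of E. If E has fewer than m non-edges there is no such set, and
   the law of A is then unconstrained. *)
Definition uniform_added_edges (R : realType) (d : measure_display)
    (T : measurableType d) (P : probability T R) (V : finType)
    (E : {set {set V}}) (m : nat) (A : T -> {set {set V}}) : Prop :=
  (forall s : {set {set V}}, measurable (A @^-1` [set s])) /\
  (forall s : {set {set V}},
     s \subset (vertex_pairs V :\: E)%SET -> #|s| = m ->
     P (A @^-1` [set s]) = (('C(#|(vertex_pairs V :\: E)%SET|, m))%:R^-1)%:E).

(* Whatever the added edges are, the edges of the resulting graph get
   independent exponential lengths. *)
Definition iid_exp1_lengths (R : realType) (d : measure_display)
    (T : measurableType d) (P : probability T R) (V : finType)
    (E : {set {set V}}) (A : T -> {set {set V}})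
    (X : {set V} -> {RV P >-> R}) : Prop :=
  forall s : {set {set V}},
    iid_exp1_given (A @^-1` [set s]) (E :|: s)%SET X.

Definition much_larger (R : realType) (a b : nat -> R) : Prop :=
  a k / b k @[k --> \oo] --> +oo.

Definition whp_approx (R : realType) (d : nat -> measure_display)
    (T : forall k, measurableType (d k)) (P : forall k, probability (T k) R)
    (Y : forall k, T k -> \bar R) (b : nat -> R) : Prop :=
  forall delta : R, 0 < delta ->
    P k [set w | (`|Y k w * ((b k)^-1)%:E - 1| <= delta%:E)%E] @[k --> \oo]
      --> 1%E.

(* Main.v *)
Require Import Defs.
From mathcomp Require Import measurable_realfun ring lra zify.

(** Write T for ln n / (alpha n). A vertex has about alpha n edges, so its
    shortest one is of order 1 / (alpha n), and the ball around a vertex grows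
    like a branching process of rate alpha n: it covers most of the graph at time
    about T, which is the typical distance. What makes the maxima larger is that
    among n vertices some have all their edges longer than T (each vertex does so
    with probability about 1 / n): such a vertex is delayed by T, so the farthest
    vertex from a given one is at 2 T and the farthest pair at 3 T.

    Upper bounds. Explore the graph from [i] and let S be the set of vertices
    reached. By memorylessness, S gains a vertex at rate the number of edges
    leaving S, which is at least |S| (alpha n - |S|) for small S, and at least a
    large multiple of n ^ 2 / ln n as long as S and its complement both have
    linear size. Hence d(i, j) has Laplace transform at most n ^ (1 + o(1)) up to
    the parameter (1 - o(1)) alpha n, and P(d(i, j) > c T (1 + delta)) is smaller
    than n ^ (1 - c), by a power of n: a union bound over one pair, over n pairs
    and over n ^ 2 pairs gives the cases c = 1, 2 and 3
    ([ball_supermartingale], [first_passage_tail], [not_reached]). Edges leaving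
    linear sets are the only place where more than regularity is used. If
    alpha > 1 / 2 the degrees alone provide them ([dense_wide_cuts]); otherwise
    the random edges do: m is much larger than n ^ 2 / ln n, hence than n, so an
    exponential moment bound for uniform subsets beats the 2 ^ n possible cuts
    ([lower_tail], [most_graphs_good]).

    Lower bounds. The expected number of walks from [i] to [j] of length at most
    t is at most about exp (alpha n t) / n, which settles c = 1. Conditioning on
    all edges at [i] or at [j] being longer than T only shifts by T the length of
    every path that leaves [i] or enters [j] ([pr_slow_short]). A second moment
    computation shows that there are many such slow vertices, while only few of
    them, or few pairs of them, can be closer than 2 T, or 3 T
    ([pr_far_from], [pr_far_pair]).

    To stay with finite sums, lengths are rounded to a mesh that may depend on
    the graph. The rounded exponential variables are geometric, hence still
    memoryless, and rounding up or down gives the upper or the lower bounds for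
    the true lengths ([discretize]). *)

Set Implicit Arguments.
Unset Strict Implicit.
Unset Printing Implicit Defensive.

Local Open Scope ring_scope.

(** * Product weights on finite functions *)

Section ProductWeight.
Variables (R : realType) (I K : finType) (mu : I -> K -> R).
Implicit Types (g : {ffun I -> K}) (e : I) (k : K).

Definition wt g : R := \prod_e mu e (g e).

Definition upd g e k : {ffun I -> K} := [ffun x => if x == e then k else g x].

Lemma updE g e k : upd g e k e = k.
Proof. by rewrite ffunE eqxx. Qed.

Lemma upd_neq g e k x : x != e -> upd g e k x = g x.
Proof. by rewrite ffunE => /negbTE ->. Qed.

Lemma upd_id g e : upd g e (g e) = g.
Proof. by apply/ffunP => x; rewrite ffunE; case: eqP => [->|]. Qed.

Lemma upd_upd g e k k' : upd (upd g e k) e k' = upd g e k'.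
Proof. by apply/ffunP => x; rewrite !ffunE; case: eqP. Qed.

Lemma wt_prod (f : I -> K -> R) :
  \sum_g wt g * \prod_e f e (g e) = \prod_e \sum_k mu e k * f e k.
Proof.
rewrite bigA_distr_bigA; apply: eq_bigr => g _.
by rewrite /wt -big_split.
Qed.

(** Separates the value at [e] from the rest, the rest being represented by its
    extension that takes the value [k0] at [e]. *)
Lemma sum_coordinate (k0 : K) e (F : {ffun I -> K} -> R) :
  \sum_g F g = \sum_(g : {ffun I -> K} | g e == k0) \sum_k F (upd g e k).
Proof.
rewrite (partition_big (fun g => upd g e k0) (fun g => g e == k0)) /=; last first.
  by move=> g _; rewrite updE.
apply: eq_bigr => g0 /eqP g0e.
rewrite (reindex_onto (fun k => upd g0 e k) (fun g => g e)) /=; last first.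
  move=> g /eqP <-; by rewrite upd_upd upd_id.
by apply: eq_bigl => k; rewrite updE eqxx upd_upd -g0e upd_id eqxx.
Qed.

Lemma wt_upd g e k : wt (upd g e k) = mu e k * \prod_(x | x != e) mu x (g x).
Proof.
rewrite /wt (bigD1 e) //= updE; congr (_ * _).
by apply: eq_bigr => x xe; rewrite upd_neq.
Qed.

Hypothesis mu_ge0 : forall e k, 0 <= mu e k.

Lemma wt_ge0 g : 0 <= wt g.
Proof. by apply: prodr_ge0 => e _; exact: mu_ge0. Qed.

Hypothesis mu_sum1 : forall e, \sum_k mu e k = 1.

Lemma wt_sum1 : \sum_g wt g = 1.
Proof.
have -> : \sum_g wt g = \sum_g wt g * \prod_e (fun _ _ => 1) e (g e).
  by apply: eq_bigr => g _; rewrite [X in _ * X]big1 // mulr1.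
by rewrite (wt_prod (fun _ _ => 1)); apply: big1 => e _; rewrite -[RHS](mu_sum1 e); apply: eq_bigr => k _; rewrite mulr1.
Qed.

End ProductWeight.

Section Geometric.
Variables (R : realType) (q : R) (N : nat).
Hypothesis q01 : 0 <= q <= 1.

(** The law of min(G, N) when P(G >= k) = q ^ k: truncation keeps the sums finite
    and is harmless since only lengths below [N] matter. *)
Definition geo (k : 'I_N.+1) : R := if (k < N)%N then (1 - q) * q ^+ k else q ^+ N.

Lemma geo_ge0 k : 0 <= geo k.
Proof.
case/andP: q01 => q0 q1; rewrite /geo; case: ifP => _; last exact: exprn_ge0.
by rewrite mulr_ge0 ?exprn_ge0 // subr_ge0.
Qed.

Lemma geo_tail (a : nat) : (a <= N)%N ->
  \sum_(k : 'I_N.+1 | (a <= k)%N) geo k = q ^+ a.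
Proof.
move=> aN.
have -> : \sum_(k : 'I_N.+1 | (a <= k)%N) geo k =
    \sum_(a <= k < N.+1) (if (k < N)%N then (1 - q) * q ^+ k else q ^+ N).
  by rewrite big_geq_mkord.
rewrite big_nat_recr //= ltnn.
have -> : \sum_(a <= k < N) (if (k < N)%N then (1 - q) * q ^+ k else q ^+ N)
  = q ^+ a - q ^+ N.
  rewrite -[RHS]opprB -(telescope_sumr _ aN) -sumrN.
  apply: eq_big_nat => k /andP[_ ->]; rewrite exprS; ring.
by rewrite subrK.
Qed.

Lemma geo_sum1 : \sum_k geo k = 1.
Proof. by have := geo_tail (leq0n N); rewrite expr0 => <-; apply: eq_bigl. Qed.

Lemma geo_laplace rho (a : nat) : 0 <= rho <= 1 -> q * rho < 1 ->
  \sum_(k : 'I_N.+1 | (a <= k < N)%N) geo k * rho ^+ k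
    <= q ^+ a * (rho ^+ a * ((1 - q) / (1 - q * rho))).
Proof.
case/andP: q01 => q0 q1 /andP[r0 r1] qr1.
have d0 : 0 < 1 - q * rho by rewrite subr_gt0.
case: (leqP a N) => aN; last first.
  rewrite big_pred0; last by move=> k; apply/negbTE; lia.
  by rewrite !mulr_ge0 ?exprn_ge0 ?invr_ge0 ?subr_ge0 // ltW.
have -> : \sum_(k : 'I_N.+1 | (a <= k < N)%N) geo k * rho ^+ k =
   \sum_(a <= k < N) (1 - q) * (q * rho) ^+ k.
  rewrite [RHS](big_nat_widen _ _ N.+1) // big_geq_mkord /=.
  rewrite [RHS](eq_bigl (fun k : 'I_N.+1 => (a <= k < N)%N)) => [|k]; last exact: andbC.
  by apply: eq_bigr => k /andP[_ kN]; rewrite /geo kN exprMn mulrA.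
rewrite -mulr_sumr.
have -> : \sum_(a <= i < N) (q * rho) ^+ i = ((q * rho) ^+ a - (q * rho) ^+ N) / (1 - q * rho).
  apply: (canRL (mulfK (lt0r_neq0 d0))).
  rewrite mulr_suml -[RHS]opprB -(telescope_sumr _ aN) -sumrN.
  apply: eq_bigr => k _; rewrite exprS; ring.
rewrite [X in X <= _](_ : _ = ((q * rho) ^+ a - (q * rho) ^+ N) * ((1 - q) / (1 - q * rho))); last by ring.
rewrite [leRHS]mulrA -exprMn ler_wpM2r //; first by rewrite divr_ge0 ?subr_ge0 // ltW.
by rewrite gerBl exprn_ge0 // mulr_ge0.
Qed.

End Geometric.

(** * Independent truncated geometric lengths *)

Section GeometricLaw.
Variables (R : realType) (I : finType) (F : {set I}) (q : R) (N : nat).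
Hypothesis q01 : 0 <= q <= 1.
Implicit Types (g : {ffun I -> 'I_N.+1}) (e : I) (B : {set I}) (P Q : pred {ffun I -> 'I_N.+1}).

(** Coordinates outside [F] are pinned to zero, so that functions on the whole of
    [I] can be used without counting anything twice. *)
Definition edge_law e (k : 'I_N.+1) : R :=
  if e \in F then geo q k else (k == ord0)%:R.

Lemma edge_law_ge0 e k : 0 <= edge_law e k.
Proof. by rewrite /edge_law; case: ifP => _; [exact: geo_ge0|exact: ler0n]. Qed.

Lemma edge_law_sum1 e : \sum_k edge_law e k = 1.
Proof.
rewrite /edge_law; case: (e \in F); first exact: geo_sum1.
by rewrite (bigD1 ord0) //= big1 ?addr0 // => k /negbTE ->.
Qed.

Definition pr (P : pred {ffun I -> 'I_N.+1}) : R := \sum_(g | P g) wt edge_law g.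

Lemma pr_ge0 P : 0 <= pr P.
Proof. by apply: sumr_ge0 => g _; exact/wt_ge0/edge_law_ge0. Qed.

Lemma pr_le P Q : (forall g, P g -> Q g) -> pr P <= pr Q.
Proof.
move=> PQ; rewrite /pr big_mkcond [leRHS]big_mkcond; apply: ler_sum => g _ /=.
have w0 : 0 <= wt edge_law g by exact/wt_ge0/edge_law_ge0.
by case: ifP => [/PQ ->|_] //; case: ifP.
Qed.

Lemma prT : pr predT = 1.
Proof. exact/wt_sum1/edge_law_sum1. Qed.

Lemma pr_le1 P : pr P <= 1.
Proof. by rewrite -prT; apply: pr_le. Qed.

Lemma eq_pr P Q : P =1 Q -> pr P = pr Q.
Proof. by move=> PQ; apply: eq_bigl. Qed.

Lemma pr_split P Q : pr P = pr (fun g => P g && Q g) + pr (fun g => P g && ~~ Q g).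
Proof. exact: bigID. Qed.

Lemma prC P : pr (fun g => ~~ P g) = 1 - pr P.
Proof. by rewrite -prT (pr_split predT P) /= addrAC subrr add0r. Qed.

Lemma pr_union (J : Type) (s : seq J) (P : J -> pred {ffun I -> 'I_N.+1}) Q :
  (forall g, Q g -> has (fun j => P j g) s) ->
  pr Q <= \sum_(j <- s) pr (P j).
Proof.
move=> h; rewrite /pr; under [leRHS]eq_bigr do rewrite big_mkcond.
rewrite exchange_big /= big_mkcond; apply: ler_sum => g _.
have w0 : 0 <= wt edge_law g by exact/wt_ge0/edge_law_ge0.
case: ifP => Qg; last by apply: sumr_ge0 => j _; case: ifP.
elim: s {h Qg}(h g Qg) => //= j s IH; rewrite big_cons.
case: (P j g) => /= [_|/IH le]; last by rewrite add0r.
by rewrite lerDl; apply: sumr_ge0 => i _; case: ifP.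
Qed.

(** Memorylessness: if [a <= g e] is all that an event says about [g e], then
    [g e] exceeds [a] with conditional probability [q], because
    P(G > a) = q * P(G >= a). *)
Lemma pr_age1 e (a : nat) (E : pred {ffun I -> 'I_N.+1}) :
  e \in F -> (a < N)%N ->
  (forall g, E g -> (a <= g e)%N) ->
  (forall g (k : 'I_N.+1), E g -> (a <= k)%N -> E (upd g e k)) ->
  pr (fun g => E g && (a < g e)%N) = q * pr E.
Proof.
move=> eF aN Ea Eu; rewrite /pr big_mkcond [in RHS]big_mkcond.
rewrite (sum_coordinate ord0 e) [in RHS](sum_coordinate ord0 e) mulr_sumr.
apply: eq_bigr => g _.
set rest := \prod_(x | x != e) edge_law x (g x).
have [/existsP[k0 Ek0]|/existsPn noE] := boolP [exists k, E (upd g e k)]; last first.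
  rewrite !big1 ?mulr0 // => k _; by rewrite (negbTE (noE k)).
have EE (k : 'I_N.+1) : E (upd g e k) = (a <= k)%N.
  apply/idP/idP => [/Ea|ak]; first by rewrite updE.
  by rewrite -(upd_upd g e k0 k); exact: Eu.
have tail b : (b <= N)%N ->
    \sum_(k : 'I_N.+1) (if (b <= k)%N then wt edge_law (upd g e k) else 0) = q ^+ b * rest.
  move=> bN; rewrite -big_mkcond -(geo_tail q bN) mulr_suml; apply: eq_bigr => k _.
  by rewrite wt_upd /edge_law eF.
transitivity (q ^+ a.+1 * rest).
  rewrite -tail //; apply: eq_bigr => k _; rewrite EE updE.
  by congr (if _ then _ else _); apply/andP/idP => [[]//|?]; split=> //; exact: ltnW.
rewrite exprS -mulrA; congr (_ * _); rewrite -tail 1?ltnW //.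
by apply: eq_bigr => k _; rewrite EE.
Qed.

(** The coordinates in [B] are aged one after the other; each step leaves the
    hypotheses on the remaining ones untouched. *)
Lemma pr_age B (a : I -> nat) (E : pred {ffun I -> 'I_N.+1}) :
  B \subset F -> (forall e, e \in B -> (a e < N)%N) ->
  (forall g e, e \in B -> E g -> (a e <= g e)%N) ->
  (forall g e (k : 'I_N.+1), e \in B -> E g -> (a e <= k)%N -> E (upd g e k)) ->
  pr (fun g => E g && [forall e in B, (a e < g e)%N]) = q ^+ #|B| * pr E.
Proof.
move=> BF aN Ea Eu.
have -> : pr (fun g => E g && [forall e in B, (a e < g e)%N]) =
          pr (fun g => E g && all (fun e => (a e < g e)%N) (enum B)).
  apply: eq_pr => g; congr andb; apply/forall_inP/allP => h e.
    by rewrite mem_enum; exact: h.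
  by move=> eB; apply: h; rewrite mem_enum.
rewrite cardE; have: {subset enum B <= B} by move=> e; rewrite mem_enum.
have := enum_uniq B; elim: (enum B) => [_ _|e s IH /= /andP[es us] sB].
  by rewrite expr0 mul1r; apply: eq_pr => g; rewrite andbT.
have eB : e \in B by apply: sB; rewrite inE eqxx.
rewrite exprS -mulrA -IH //; last by move=> x xs; apply: sB; rewrite inE xs orbT.
rewrite -(@pr_age1 e (a e) (fun g => E g && all (fun e => (a e < g e)%N) s)).
- by apply: eq_pr => g; rewrite -andbA; congr andb; rewrite andbC.
- exact: (fintype.subsetP BF _ eB).
- exact: aN.
- by move=> g /andP[/Ea->].
- move=> g k /andP[Eg /allP h] ak; rewrite Eu //=; apply/allP => x xs.
  rewrite upd_neq; first exact: h.
  by apply: contraNneq es => <-.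
Qed.

End GeometricLaw.

Arguments eq_pr {R I F q N P Q}.

(** * Exploration of a graph in integer time *)

Section Boundary.
Variables (V : finType) (H : {set {set V}}).
Implicit Types (S : {set V}) (u v : V).

Definition boundary S : {set {set V}} := [set e in H | #|e :&: S| == 1%N].

Lemma boundaryP S e : is_graph H -> e \in boundary S ->
  exists u v, [/\ e = [set u; v]%SET, u \in S, v \notin S & [set u; v]%SET \in H].
Proof.
move=> gH; rewrite inE => /andP[eH /cards1P[u eSu]].
have /[!inE] /cards2P[x [y [xy exy]]] := fintype.subsetP gH e eH.
have uin : u \in e :&: S by rewrite eSu inE.
move: uin; rewrite !inE => /andP[ue uS].
have key v : v \in e -> v != u -> v \notin S.
  move=> ve; apply: contraNN => vS.
  by have : v \in e :&: S; [rewrite inE ve|rewrite eSu inE].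
have : u \in [set x; y]%SET by rewrite -exy.
rewrite !inE => /orP[/eqP ux|/eqP uy].
  exists u, y; rewrite ux -exy; split=> //; first by rewrite -ux.
  by apply: key; rewrite ?exy ?inE ?eqxx ?orbT // ux eq_sym.
exists u, x; rewrite uy finset.setUC -exy; split=> //; first by rewrite -uy.
by apply: key; rewrite ?exy ?inE ?eqxx ?orbT // uy.
Qed.

Lemma mem_boundary S u v : u \in S -> v \notin S -> [set u; v]%SET \in H ->
  [set u; v]%SET \in boundary S.
Proof.
move=> uS vS uvH; rewrite inE uvH /=; apply/cards1P; exists u.
apply/setP => x; rewrite !inE.
by case: (eqVneq x u) => [->|xu] //=; case: eqP => // ->; rewrite (negbTE vS).
Qed.

End Boundary.

Section Exploration.
Variables (V : finType) (H : {set {set V}}) (N : nat) (src : V).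
Implicit Types (g : {ffun {set V} -> 'I_N.+1}) (sg : {ffun V -> 'I_N.+2}).
Implicit Types (t s : nat) (u v w : V).

(** A state records the infection times up to now, [ord_max] standing for not
    yet infected; crossing an edge [e] takes [(g e).+1] steps. *)
Definition start : {ffun V -> 'I_N.+2} :=
  [ffun v => if v == src then ord0 else ord_max].

Definition fires g t sg v : bool :=
  [exists u, [&& [set u; v]%SET \in H, (sg u <= t)%N & sg u + g [set u; v]%SET == t]%N].

Definition step g t sg : {ffun V -> 'I_N.+2} :=
  [ffun v => if (sg v <= t)%N then sg v
             else if fires g t sg v then inord t.+1 else ord_max].

Fixpoint explore g t : {ffun V -> 'I_N.+2} :=
  if t is t'.+1 then step g t' (explore g t') else start.

Definition infected t sg : {set V} := [set v | sg v <= t]%N.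

Definition ball g t : {set V} := infected t (explore g t).

Lemma in_ball g t v : (v \in ball g t) = (explore g t v <= t)%N.
Proof. by rewrite inE. Qed.

Lemma inord_step t : (t < N)%N -> (inord t.+1 : 'I_N.+2) = t.+1 :> nat.
Proof. by move=> tN; rewrite inordK // !ltnS ltnW. Qed.

Lemma explore_stable g s t v : (s <= t)%N ->
  (explore g s v <= s)%N -> explore g t v = explore g s v.
Proof.
elim: t => [|t IH]; first by rewrite leqn0 => /eqP ->.
rewrite leq_eqVlt => /orP[/eqP -> //|]; rewrite ltnS => st h.
by rewrite /= ffunE IH // (leq_trans h st).
Qed.

(** The state at time [t] determines all earlier states: infection times are
    never revised. *)
Lemma explore_back g s t v : (t <= N)%N -> (s <= t)%N ->
  (explore g t v <= s)%N -> explore g s v = explore g t v.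
Proof.
elim: t => [|t IH] tN; first by rewrite leqn0 => /eqP ->.
rewrite leq_eqVlt => /orP[/eqP -> //|]; rewrite ltnS => st.
rewrite /= ffunE; case: ifP => h; first by move=> h2; apply: IH => //; exact: ltnW.
case: ifP => _; first by rewrite inord_step //; lia.
by rewrite /=; lia.
Qed.

Lemma ball_sub g s t : (s <= t)%N -> ball g s \subset ball g t.
Proof.
move=> st; apply/fintype.subsetP => v; rewrite !in_ball => h.
by rewrite (explore_stable st h) (leq_trans h st).
Qed.

Lemma src_ball g t : src \in ball g t.
Proof.
have : src \in ball g 0 by rewrite in_ball ffunE eqxx.
exact/(fintype.subsetP (ball_sub _ _)).
Qed.

Lemma fires_ball g t u v : (t < N)%N -> u \in ball g t ->
  [set u; v]%SET \in H -> (explore g t u + g [set u; v]%SET = t)%N -> v \in ball g t.+1.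
Proof.
rewrite !in_ball => tN ut uvH e; rewrite /= ffunE.
case: ifP => [h|_]; first exact: leqW.
have -> : fires g t (explore g t) v.
  by apply/existsP; exists u; rewrite uvH ut e eqxx.
by rewrite inord_step.
Qed.

(** An edge that had been shorter would already have transmitted. *)
Lemma boundary_age g t u v : (t <= N)%N -> u \in ball g t -> v \notin ball g t ->
  [set u; v]%SET \in H -> (t - explore g t u <= g [set u; v]%SET)%N.
Proof.
move=> tN uB vB uvH; rewrite leqNgt; apply: contraNN vB => lt.
move: (uB); rewrite in_ball => ut.
set s := (explore g t u + g [set u; v]%SET)%N.
have st : (s < t)%N by rewrite /s; lia.
have us : (explore g t u <= s)%N by rewrite /s leq_addr.
have eu := explore_back tN (ltnW st) us.
apply: (fintype.subsetP (ball_sub g st)); apply: (@fires_ball g s u v) => //; first by lia.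
  by rewrite in_ball eu.
by rewrite eu.
Qed.

(** The history up to time [t] reveals nothing about a boundary edge except its
    age; together with [boundary_age] this is what memorylessness needs. *)
Lemma explore_upd g t u v (k : 'I_N.+1) : (t <= N)%N ->
  u \in ball g t -> v \notin ball g t -> [set u; v]%SET \in H ->
  (t - explore g t u <= k)%N ->
  explore (upd g [set u; v]%SET k) t = explore g t.
Proof.
move=> tN uB vB uvH ak.
have ag := boundary_age tN uB vB uvH.
suff : forall s, (s <= t)%N -> explore (upd g [set u; v]%SET k) s = explore g s by exact.
elim=> [//|s IH] st; rewrite /= IH ?(ltnW st) //.
apply/ffunP => w; rewrite !ffunE; case: ifP => // /negbT ws.
suff -> : fires (upd g [set u; v]%SET k) s (explore g s) w = fires g s (explore g s) w by [].
apply: eq_existsb => x; congr andb.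
have [xs|] := boolP (explore g s x <= s)%N; rewrite // !andTb.
have [exw|/eqP nexw] := eqVneq [set x; w]%SET [set u; v]%SET; last first.
  by rewrite upd_neq //; exact/eqP.
have xt := explore_stable (ltnW st) xs.
have xB : x \in ball g t by rewrite in_ball xt; lia.
have xu : x = u.
  have : x \in [set u; v]%SET by rewrite -exw !inE eqxx.
  by rewrite !inE => /orP[/eqP//|/eqP xv]; rewrite -xv xB in vB.
rewrite exw updE -xt xu.
rewrite in_ball in uB.
by apply/eqP/eqP; lia.
Qed.

End Exploration.

(** * Supermartingales along the exploration *)

Section BallPaths.
Variables (R : realType) (V : finType) (H : {set {set V}}) (N : nat) (src : V).

Lemma path_length_rcons (len : {set V} -> R) (u v : V) (p : seq V) :
  path_length len u (rcons p v) = path_length len u p + len [set last u p; v]%SET.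
Proof.
by elim: p u => [|x p IH] u /=; rewrite ?addr0 ?add0r // IH addrA.
Qed.

(** Infection times strictly increase along the edges that transmit, so
    following an infection back to its source never repeats a vertex. *)
Lemma ball_path (g : {ffun {set V} -> 'I_N.+1}) (len : {set V} -> R) (h : R) t v :
  (forall e, e \in H -> (g e < N)%N -> len e <= h * (g e).+1%:R) ->
  (t <= N)%N -> v \in ball H src g t ->
  exists2 p, paths H src v p & path_length len src p <= h * (explore H src g t v)%:R
    /\ {in src :: p, forall x, (explore H src g t x <= explore H src g t v)%N}.
Proof.
move=> hlen; elim: t v => [|t IH] v tN.
  rewrite in_ball !ffunE; case: eqP => [->|] //= _.
  exists [::]; first by [].
  by split=> [|x]; rewrite ?mulr0 // inE => /eqP ->; rewrite ffunE eqxx.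
have [vt|vt] := boolP (v \in ball H src g t).
  move=> _; have [p pP [lp xp]] := IH v (ltnW tN) vt.
  have st x : (explore H src g t x <= t)%N -> explore H src g t.+1 x = explore H src g t x.
    by apply: explore_stable.
  have vt' : (explore H src g t v <= t)%N by rewrite -in_ball.
  exists p => //; rewrite st //; split=> // x /xp xv.
  by rewrite st // (leq_trans xv).
move: (vt); rewrite !in_ball => /negbTE nvt.
rewrite [explore _ _ _ _]/= ffunE nvt.
case: ifP => [/existsP[u /and3P[uvH ut /eqP e]] _|_]; last first.
  by rewrite /= => h'; exfalso; lia.
have [|p [pH pu pl] [lp xp]] := IH u (ltnW tN); first by rewrite in_ball.
have xt x : x \in src :: p -> (explore H src g t x <= t)%N.
  by move/xp => h1; rewrite (leq_trans h1).
exists (rcons p v); first split.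
- by rewrite rcons_path pH /= pl.
- rewrite -rcons_cons rcons_uniq pu andbT; apply/negP => /xt.
  by rewrite nvt.
- by rewrite last_rcons.
rewrite inord_step //; split.
  rewrite path_length_rcons pl.
  have gN : (g [set u; v]%SET < N)%N by lia.
  apply: (le_trans (lerD lp (hlen _ uvH gN))).
  by rewrite -mulrDr -natrD addnS e.
move=> x; rewrite -rcons_cons mem_rcons inE => /orP[/eqP ->|/xt h1].
  rewrite [explore _ _ _ _]/= ffunE nvt; case: ifP; rewrite ?inord_step //.
  by move=> /negbT /existsPn/(_ u); rewrite uvH ut e eqxx.
have := @explore_stable _ H _ src g t t.+1 x (leqnSn t) h1; move=> /= ->.
by rewrite (leq_trans h1).
Qed.

(** Rounding lengths up makes the exploration an upper bound for the true
    distances. *)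
Lemma dist_ball (g : {ffun {set V} -> 'I_N.+1}) (len : {set V} -> R) (h : R) t v :
  0 <= h ->
  (forall e, e \in H -> (g e < N)%N -> len e <= h * (g e).+1%:R) ->
  (t <= N)%N -> v \in ball H src g t -> (dist H len src v <= (h * t%:R)%:E)%E.
Proof.
move=> h0 hlen tN vt; have [p pP [lp _]] := ball_path hlen tN vt.
apply: (@le_trans _ _ (path_length len src p)%:E).
  by apply: ereal_inf_lbound; exists p.
rewrite lee_fin (le_trans lp) // ler_wpM2l // ler_nat.
by rewrite -in_ball.
Qed.

End BallPaths.

Section Supermartingale.
Variables (R : realType) (V : finType) (H : {set {set V}}) (q : R) (N : nat) (src : V).
Hypotheses (gH : is_graph H) (q01 : 0 <= q <= 1).
Implicit Types (S : {set V}) (g : {ffun {set V} -> 'I_N.+1}).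
Variables (W : {set V} -> R) (rho : R).
Hypothesis W_anti : forall S S', src \in S -> S \subset S' -> W S' <= W S.
(** [B] is a set of edges whose first transmission lowers the potential to at
    most [c]. *)
Hypothesis W_drift : forall S, src \in S -> exists (B : {set {set V}}) (c : R),
  [/\ B \subset boundary H S,
      forall S' (e : {set V}), S \subset S' -> e \in B -> e \subset S' -> W S' <= c
    & q ^+ #|B| * W S + (1 - q ^+ #|B|) * c <= rho * W S].

Let wt' := wt (edge_law H q (N := N)).

Let wt'_ge0 g : 0 <= wt' g.
Proof. exact/wt_ge0/edge_law_ge0. Qed.

(** Given the history up to time [t], the boundary edges have forgotten their
    age, so each fails to transmit during the next step with probability [q]. *)
Lemma ball_drift t : (t < N)%N ->
  \sum_g wt' g * W (ball H src g t.+1) <= rho * \sum_g wt' g * W (ball H src g t).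
Proof.
move=> tN; rewrite (partition_big (fun g => explore H src g t) predT) //=.
rewrite [in leRHS](partition_big (fun g => explore H src g t) predT) //= mulr_sumr.
apply: ler_sum => sg _; set S := infected t sg.
have bS g : explore H src g t = sg -> ball H src g t = S by rewrite /ball => ->.
have [sS|sS] := boolP (src \in S); last first.
  rewrite !big_pred0 ?mulr0 // => g; apply/negbTE; apply: contraNN sS => /eqP/bS <-;
  exact: src_ball.
have [B [c [BS Bc drift]]] := W_drift sS.
(* The age of a boundary edge; the maximum is over its only endpoint in S. *)
pose a e := \max_(x in e :&: S) (t - sg x).
have BH : B \subset H.
  apply: fintype.subset_trans BS _; apply/fintype.subsetP => e; by rewrite inE => /andP[].
have BP e : e \in B -> exists u v, [/\ e = [set u; v]%SET, u \in S, v \notin S,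
    [set u; v]%SET \in H & a e = (t - sg u)%N].
  move=> eB; have [u [v [-> uS vS uvH]]] := boundaryP gH (fintype.subsetP BS _ eB).
  exists u, v; split=> //; rewrite /a.
  suff -> : [set u; v]%SET :&: S = [set u]%SET by rewrite big_set1.
  apply/finset.setP => x; rewrite !inE.
  have [->|xu] /= := eqVneq x u; first by rewrite -[RHS]uS inE.
  by have [->|//] := eqVneq x v; apply/negbTE; move: vS; rewrite inE.
set E := fun g => explore H src g t == sg.
have age : pr H q (fun g => E g && [forall e in B, (a e < g e)%N]) = q ^+ #|B| * pr H q E.
  apply: pr_age => //.
  - by move=> e /BP[u [v [_ _ _ _ ->]]]; lia.
  - move=> g e /BP[u [v [-> uS vS uvH ->]]] /eqP Eg.
    by rewrite -Eg; apply: boundary_age => //; rewrite ?bS // ltnW.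
  - move=> g e k /BP[u [v [-> uS vS uvH ->]]] /eqP Eg ak; rewrite /E.
    by rewrite explore_upd ?Eg // ?bS // ltnW.
have prE : pr H q E = pr H q (fun g => E g && [forall e in B, (a e < g e)%N]) +
    pr H q (fun g => E g && ~~ [forall e in B, (a e < g e)%N]) by exact: pr_split.
rewrite (bigID (fun g => [forall e in B, (a e < g e)%N])) /=.
have -> : \sum_(g | explore H src g t == sg) wt' g * W (ball H src g t) = pr H q E * W S.
  by rewrite /pr mulr_suml; apply: eq_bigr => g /eqP/bS ->.
apply: (@le_trans _ _ (pr H q E * (q ^+ #|B| * W S + (1 - q ^+ #|B|) * c))); last first.
  by rewrite mulrCA ler_wpM2l // pr_ge0.
rewrite mulrDr mulrA [pr H q E * _]mulrC -age mulrA mulrBr mulr1 [pr H q E * _]mulrC -age.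
rewrite [in leRHS]prE addrAC subrr add0r; apply: lerD.
  rewrite /pr mulr_suml; apply: ler_sum => g /andP[/eqP/bS <- _].
  by rewrite ler_wpM2l // W_anti // ?ball_sub // src_ball.
rewrite /pr mulr_suml; apply: ler_sum => g /andP[/eqP Eg /forall_inPn[e eB ag]].
rewrite ler_wpM2l //.
have [u [v [euv uS vS uvH ae]]] := BP e eB.
have uB : u \in ball H src g t by rewrite bS.
have vB : v \notin ball H src g t by rewrite bS.
apply: (Bc _ e) => //; first by rewrite -(bS g Eg) ball_sub.
have sub := fintype.subsetP (ball_sub H src g (leqnSn t)).
have vB' : v \in ball H src g t.+1.
  apply: (@fires_ball _ _ _ _ g t u v) => //.
  have := boundary_age (ltnW tN) uB vB uvH.
  move: ag uB; rewrite ae -leqNgt euv in_ball Eg => le1 ut le2.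
  have -> : g [set u; v]%SET = (t - sg u)%N :> nat by apply/eqP; rewrite eqn_leq le1.
  exact: subnKC.
rewrite euv; apply/fintype.subsetP => x; rewrite !inE => /orP[] /eqP ->.
  by have := sub u uB; rewrite in_ball.
by rewrite -in_ball.
Qed.

Lemma ball_supermartingale t : 0 <= rho -> (t <= N)%N ->
  \sum_g wt' g * W (ball H src g t) <= rho ^+ t * W [set src]%SET.
Proof.
move=> r0; elim: t => [|t IH] tN.
  rewrite expr0 mul1r (eq_bigr (fun g => wt' g * W [set src]%SET)); last first.
    move=> g _; congr (_ * W _); apply/finset.setP => v.
    by rewrite in_ball !inE ffunE; case: eqP.
  by rewrite -mulr_suml wt_sum1 ?mul1r //; exact: edge_law_sum1.
apply: (le_trans (ball_drift tN)); rewrite exprS -mulrA ler_wpM2l //.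
by apply: IH; exact: ltnW.
Qed.

End Supermartingale.

(** * The tail of a first passage time *)

Section FirstPassageTail.
Variables (R : realType) (V : finType) (H : {set {set V}}) (N : nat) (src tgt : V).
Variables (h eta lam : R) (K : nat) (r : nat -> R).
Implicit Types (S : {set V}).
Hypotheses (gH : is_graph H) (h_gt0 : 0 < h) (eta01 : 0 <= eta <= 1).
Hypothesis h_small : #|H|%:R * h <= eta.
Hypotheses (lam_gt0 : 0 < lam) (lam_r : forall k, (0 < k <= K)%N -> lam < r k).
Hypothesis boundary_large : forall S, src \in S -> (#|S| <= K)%N ->
  r #|S| <= #|boundary H S|%:R.
Hypothesis target_degree : forall S, src \in S -> tgt \notin S -> (K < #|S|)%N ->
  lam <= #|[set e in boundary H S | tgt \in e]|%:R.

Let w k : R := \prod_(1 <= l < k) (1 - lam / r l).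

Let factor_01 k : (0 < k <= K)%N -> 0 < 1 - lam / r k <= 1.
Proof.
move=> /lam_r lr; have r0 := lt_trans lam_gt0 lr.
by rewrite subr_gt0 gerBl ltr_pdivrMr // mul1r lr divr_ge0 ?(ltW lam_gt0) ?(ltW r0).
Qed.

Let w_gt0 k : (k <= K.+1)%N -> 0 < w k.
Proof.
move=> kK; rewrite /w big_nat_cond; apply: prodr_gt0 => l; rewrite andbT => lk.
by have [|//] := andP (factor_01 (k := l) _); lia.
Qed.

Let w_anti k k' : (0 < k)%N -> (k <= k')%N -> (k' <= K.+1)%N -> w k' <= w k.
Proof.
move=> k0; elim: k' => [|k' IH]; first by rewrite leqn0 => /eqP ->.
rewrite leq_eqVlt => /orP[/eqP ->//|]; rewrite ltnS => kk' k'K.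
apply: le_trans (IH kk' (ltnW k'K)).
have k'0 : (0 < k')%N by lia.
rewrite /w big_nat_recr //= -/(w k') ler_piMr //; first by rewrite ltW // w_gt0 // ltnW.
by have [|//] := andP (factor_01 (k := k') _); lia.
Qed.

Let q := expR (- h).

Let q01 : 0 <= q <= 1.
Proof. by rewrite expR_ge0 /q -expR0 ler_expR oppr_le0 ltW. Qed.

(** Sets with more than [K] vertices are not told apart: from then on only the
    edges between the set and the target matter. *)
Let W S : R := if tgt \in S then 0 else w (minn #|S| K.+1).

Let q_pow b : q ^+ b = expR (- (b%:R * h)).
Proof. by rewrite /q -expRM_natl mulrN. Qed.

Let transmit_ge b : (b <= #|H|)%N -> (1 - eta) * (b%:R * h) <= 1 - q ^+ b.
Proof.
move=> bH; rewrite q_pow expRN; set x := b%:R * h.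
have x0 : 0 <= x by rewrite mulr_ge0 // ltW.
have xe : x <= eta.
  by apply: le_trans h_small; rewrite ler_wpM2r ?ler_nat // ltW.
apply: (@le_trans _ _ (1 - (1 + x)^-1)); last first.
  rewrite lerD2l lerN2 lef_pV2 ?posrE ?expR_gt0 //; last by lra.
  exact: expR_ge1Dx.
have -> : 1 - (1 + x)^-1 = x / (1 + x) by field; lra.
rewrite ler_pdivlMr; last by lra.
suff: (1 - eta) * (1 + x) <= 1 by nra.
by case/andP: eta01 => e0 e1; nra.
Qed.

Let rho := expR (- ((1 - eta) * lam * h)).

Let W_anti S S' : src \in S -> S \subset S' -> W S' <= W S.
Proof.
move=> sS SS'; rewrite /W; have cSS' := subset_leq_card SS'.
have S0 : (0 < #|S|)%N by rewrite card_gt0; apply/set0Pn; exists src.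
case: ifP => [_|]; first by case: ifP => // _; rewrite ltW // w_gt0 // geq_minr.
move=> /negbT tS'; have -> : tgt \in S = false.
  by apply/negbTE; apply: contraNN tS'; exact: (fintype.subsetP SS').
apply: w_anti; rewrite ?geq_minr ?leq_min ?S0 //.
by rewrite geq_minr (leq_trans (geq_minl _ _) cSS').
Qed.

(** Passing from [l] to [l + 1] vertices takes an exponential time of rate at
    least [r l], and E exp (lam Z) = 1 / (1 - lam / r) for Z exponential of rate
    [r]. So the product of the factors [1 - lam / r l] over [l < k] is a potential
    for sets of [k] vertices that compensates the growth of exp (lam t). The
    factor [1 - eta] pays for integer time. *)
Lemma first_passage_tail t : (t <= N)%N ->
  pr H q (fun g : {ffun {set V} -> 'I_N.+1} => tgt \notin ball H src g t)
    * \prod_(1 <= l < K.+1) (1 - lam / r l)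
  <= expR (- ((1 - eta) * lam * (h * t%:R))).
Proof.
case/andP: (eta01) => e0 e1 tN; rewrite -/(w K.+1).
have rho0 : 0 <= rho by exact: expR_ge0.
have srcW : W [set src]%SET <= 1.
  rewrite /W; case: ifP => // _; rewrite cards1.
  have -> : minn 1 K.+1 = 1%N by rewrite /minn ltnS; case: K.
  by rewrite /w big_geq.
have drift S : src \in S -> exists (B : {set {set V}}) (c : R),
  [/\ B \subset boundary H S,
      forall S' (e : {set V}), S \subset S' -> e \in B -> e \subset S' -> W S' <= c
    & q ^+ #|B| * W S + (1 - q ^+ #|B|) * c <= rho * W S].
  move=> sS; have [tS|tS] := boolP (tgt \in S).
    exists finset.set0, 0; split=> [|S' e _|].
    - exact: finset.sub0set.
    - by rewrite inE.
    - by rewrite /W tS !mulr0 addr0.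
  have S0 : (0 < #|S|)%N by rewrite card_gt0; apply/set0Pn; exists src.
  have [SK|SK] := leqP #|S| K; last first.
    (* Only transmissions to the target count, and they end the exploration. *)
    exists [set e in boundary H S | tgt \in e], 0; split.
    - by apply/fintype.subsetP => e; rewrite inE => /andP[].
    - move=> S' e _; rewrite inE => /andP[_ te] /fintype.subsetP/(_ _ te) tS'.
      by rewrite /W tS'.
    rewrite mulr0 addr0 ler_wpM2r //.
      by rewrite /W (negbTE tS) ltW // w_gt0 // geq_minr.
    have := target_degree sS tS SK; set b := #|_| => lb.
    rewrite q_pow /rho ler_expR lerN2 ler_wpM2r ?(ltW h_gt0) //.
    by apply: le_trans lb; rewrite ler_piMl ?(ltW lam_gt0) //; lra.
  (* Any transmission across the boundary adds a vertex. *)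
  exists (boundary H S), (w #|S|.+1); split=> //.
    move=> S' e SS' eB eS'; rewrite /W; case: ifP => _; first by rewrite ltW // w_gt0.
    have [u [v [ee uS vS _]]] := boundaryP gH eB.
    have SpS' : S \proper S'.
      apply/properP; split=> //; exists v => //.
      by apply: (fintype.subsetP eS'); rewrite ee !inE eqxx orbT.
    by apply: w_anti; rewrite ?geq_minr // leq_min (proper_card SpS') ltnS SK.
  rewrite /W (negbTE tS) (minn_idPl (leqW SK)).
  have lr := lam_r (k := #|S|); rewrite S0 SK in lr; have {}lr := lr isT.
  have r0 := lt_trans lam_gt0 lr.
  have bl := boundary_large sS SK.
  have bH : (#|boundary H S| <= #|H|)%N.
    by apply/subset_leq_card/fintype.subsetP => e; rewrite inE => /andP[].
  have tr := transmit_ge bH.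
  have wS : w #|S|.+1 = w #|S| * (1 - lam / r #|S|) by rewrite /w big_nat_recr.
  rewrite wS; set Q := q ^+ _ in tr *; set b := #|boundary H S|%:R in bl tr.
  have -> : Q * w #|S| + (1 - Q) * (w #|S| * (1 - lam / r #|S|)) =
    (1 - (1 - Q) * (lam / r #|S|)) * w #|S| by ring.
  rewrite ler_wpM2r //; first by rewrite ltW // w_gt0 // leqW.
  apply: le_trans (expR_ge1Dx _); rewrite lerD2l lerN2.
  rewrite mulrA ler_pdivlMr //.
  apply: (@le_trans _ _ ((1 - eta) * (b * h) * lam)); last by rewrite ler_wpM2r // ltW.
  rewrite [leRHS](_ : _ = (1 - eta) * lam * h * b); last by ring.
  by rewrite ler_wpM2l // !mulr_ge0 ?(ltW h_gt0) ?(ltW lam_gt0) //; lra.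
have := ball_supermartingale gH q01 W_anti drift rho0 tN.
have -> : rho ^+ t = expR (- ((1 - eta) * lam * (h * t%:R))).
  by rewrite /rho -expRM_natl; congr expR; ring.
move=> le; apply: (@le_trans _ _ (expR (- ((1 - eta) * lam * (h * t%:R))) * W [set src]%SET)); last first.
  by rewrite ler_piMr ?expR_ge0.
apply: le_trans le; rewrite /pr mulr_suml big_mkcond; apply: ler_sum => g _.
have w0 : 0 <= wt (edge_law H q (N := N)) g by apply/wt_ge0/edge_law_ge0.
case: ifP => tb; last first.
  rewrite mulr_ge0 // /W; case: ifP => // _; by rewrite ltW // w_gt0 // geq_minr.
rewrite ler_wpM2l // /W (negbTE tb) w_anti ?geq_minr //.
have := src_ball H src g t => sb.
have : (0 < #|ball H src g t|)%N by rewrite card_gt0; apply/set0Pn; exists src.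
by rewrite leq_min => ->.
Qed.

End FirstPassageTail.

(** * Chernoff bounds above thresholds *)

Section Thresholds.
Variables (R : realType) (I : finType) (F : {set I}) (q rho : R) (N : nat).
Hypotheses (q01 : 0 <= q <= 1) (rho01 : 0 < rho <= 1) (qrho1 : q * rho < 1).
Implicit Types (g : {ffun I -> 'I_N.+1}) (e : I) (b : I -> nat).

Definition above b g : bool := [forall e in F, (b e <= g e)%N].

Let theta := (1 - q) / (1 - q * rho).

(** Markov inequality for a product of functions of single coordinates, whose
    expectation factorizes. *)
Lemma pr_le_prod (f : I -> 'I_N.+1 -> R) (c : R) (E : pred {ffun I -> 'I_N.+1}) :
  (forall e k, 0 <= f e k) -> 0 <= c ->
  (forall g, E g -> c <= \prod_e f e (g e)) ->
  c * pr F q E <= \prod_e \sum_k edge_law F q e k * f e k.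
Proof.
move=> f0 c0 Ef; rewrite -wt_prod /pr mulr_sumr big_mkcond.
apply: ler_sum => g _.
have w0 : 0 <= wt (edge_law F q (N := N)) g by apply/wt_ge0/edge_law_ge0.
case: ifP => [/Ef le|_]; first by rewrite mulrC ler_wpM2l.
by rewrite mulr_ge0 // prodr_ge0.
Qed.

Lemma pr_box (P : I -> pred 'I_N.+1) :
  pr F q (fun g => [forall e, P e (g e)]) =
  \prod_e \sum_(k | P e k) edge_law F q e k.
Proof.
transitivity (\prod_e \sum_k edge_law F q e k * (P e k)%:R); last first.
  apply: eq_bigr => e _; rewrite [RHS]big_mkcond; apply: eq_bigr => k _.
  by case: ifP; rewrite ?mulr1 ?mulr0.
rewrite -wt_prod /pr big_mkcond; apply: eq_bigr => g _.
case: ifP => [/forallP h|/negbT/forallPn[e he]].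
  by rewrite big1 ?mulr1 // => e _; rewrite h.
by rewrite (bigD1 e) //= (negbTE he) mul0r mulr0.
Qed.

Lemma pr_above b : (forall e, e \in F -> (b e <= N)%N) ->
  pr F q (above b) = q ^+ (\sum_(e in F) b e).
Proof.
move=> bN; rewrite (_ : pr _ _ _ =
    pr F q (fun g => [forall e, (e \in F) ==> (b e <= g e)%N])); last by [].
rewrite (pr_box (fun e k => (e \in F) ==> (b e <= k)%N)) expr_sum [RHS]big_mkcond.
apply: eq_bigr => e _; case: ifP => eF /=.
  by rewrite -(geo_tail q (bN e eF)); apply: eq_bigr => k _; rewrite /edge_law eF.
by rewrite -[RHS](edge_law_sum1 F q N e); apply: eq_bigl.
Qed.

Lemma pr_above_edge b e t : (forall e, e \in F -> (b e <= N)%N) -> e \in F -> (t <= N)%N ->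
  pr F q (fun g => above b g && (g e < t)%N) <= pr F q (above b) * (1 - q ^+ t).
Proof.
move=> bN eF tN; case/andP: (q01) => q0 q1; have bP := pr_above bN.
(* Complementary event: the threshold at [e] is raised to [t]. *)
pose b' x := if x == e then maxn (b e) t else b x.
have b'N x : x \in F -> (b' x <= N)%N.
  by rewrite /b'; case: eqP => [_ _|_]; [rewrite geq_max bN|exact: bN].
have := pr_split F q (above b) (fun g => (g e < t)%N).
rewrite -(_ : pr F q (above b') = pr F q (fun g => above b g && ~~ (g e < t)%N)); last first.
  apply: eq_pr => g; rewrite -leqNgt; apply/forall_inP/andP => [h|[/forall_inP h tg] x xF].
    split; first apply/forall_inP => x xF.
      by have := h x xF; rewrite /b'; case: eqP => [->|//]; rewrite geq_max => /andP[].
    by have := h e eF; rewrite /b' eqxx geq_max => /andP[].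
  by rewrite /b'; case: eqP => [->|_]; [rewrite geq_max h|exact: h].
move=> eq1; rewrite (_ : pr F q (fun g => _) = pr F q (above b) - pr F q (above b')); last first.
  by rewrite eq1 addrK.
rewrite mulrBr mulr1 lerD2l lerN2 bP pr_above // -exprD.
rewrite ler_wiXn2l //; rewrite (bigD1 e) //= [in leqRHS](bigD1 e) //= {1}/b' eqxx.
rewrite (eq_bigr b) => [|x /andP[_ /negbTE xe]]; last by rewrite /b' xe.
rewrite addnAC leq_add2r geq_max leq_addr leq_addl //.
Qed.

(** A Chernoff bound with Laplace parameter [rho]: by memorylessness,
    conditioning on [above b] only shifts each length by its threshold. *)
Lemma pr_above_sum b (s : seq I) t : (forall e, e \in F -> (b e <= N)%N) ->
  uniq s -> {subset s <= F} -> (t <= N)%N ->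
  rho ^+ t * pr F q (fun g => above b g && (\sum_(e <- s) g e < t)%N)
    <= pr F q (above b) * (theta ^+ size s * rho ^+ (\sum_(e <- s) b e)).
Proof.
move=> bN us sF tN; case/andP: (q01) => q0 q1; case/andP: (rho01) => r0 r1.
pose f e (k : 'I_N.+1) : R := ((e \in F) ==> (b e <= k)%N)%:R *
   (if e \in s then (k < N)%N%:R * rho ^+ k else 1).
have := @pr_le_prod f (rho ^+ t) (fun g => above b g && (\sum_(e <- s) g e < t)%N).
move=> /(_ _ _ _)/le_trans; apply.
- move=> e k; rewrite /f mulr_ge0 //; case: ifP => // _.
  by rewrite mulr_ge0 // exprn_ge0 // ltW.
- by rewrite exprn_ge0 // ltW.
- move=> g /andP[/forall_inP ab st].
  rewrite /f big_split /= big1 ?mul1r; last first.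
    by move=> e _; case: (boolP (e \in F)) => // eF; rewrite ab.
  rewrite -big_mkcond -big_uniq //=.
  have -> : \prod_(e <- s) ((g e < N)%N%:R * rho ^+ g e) = rho ^+ (\sum_(e <- s) g e).
    rewrite expr_sum; apply: eq_big_seq => e es.
    suff -> : (g e < N)%N by rewrite mul1r.
    apply: leq_trans tN; apply: leq_ltn_trans st.
    by rewrite (big_rem e es) /= leq_addr.
  by rewrite ler_wiXn2l ?(ltW r0) // ltnW.
rewrite pr_above // expr_sum expr_sum.
have -> : theta ^+ size s * \prod_(e <- s) rho ^+ b e =
    \prod_e (if e \in s then theta * rho ^+ b e else 1).
  rewrite -big_mkcond -big_uniq //= big_split /=; congr (_ * _).
  by rewrite big_const_seq count_predT iter_mulr_1.
rewrite [X in X * _]big_mkcond -big_split /=.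
have th0 : 0 <= theta by rewrite divr_ge0 ?subr_ge0 // ltW.
apply: ler_prod => e _; apply/andP; split.
  apply: sumr_ge0 => k _; rewrite mulr_ge0 ?edge_law_ge0 // /f mulr_ge0 //.
  by case: ifP => // _; rewrite mulr_ge0 // exprn_ge0 // ltW.
have [eF|eF] := boolP (e \in F); last first.
  have -> : (e \in s) = false by apply: contraNF eF; exact: sF.
  rewrite mulr1 -[leRHS](edge_law_sum1 F q N e); apply: ler_sum => k _.
  rewrite /f (negbTE eF) /= mul1r; case: ifP => [es|_]; last by rewrite mulr1.
  by rewrite (sF _ es) in eF.
have fE (k : 'I_N.+1) : edge_law F q e k * f e k = if (b e <= k)%N then geo q k *
   (if e \in s then (k < N)%N%:R * rho ^+ k else 1) else 0.
  by rewrite /edge_law /f eF /=; case: (b e <= k)%N; rewrite ?mul1r ?mul0r ?mulr0.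
under eq_bigr do rewrite fE.
case: ifP => es; last first.
  rewrite mulr1 -(geo_tail q (bN e eF)) [leRHS]big_mkcond.
  by apply: ler_sum => k _; case: ifP; rewrite ?mulr1.
rewrite [theta * _]mulrC; apply: le_trans (@geo_laplace R q N q01 rho (b e) _ qrho1); last first.
  by rewrite (ltW r0).
rewrite [leRHS]big_mkcond; apply: ler_sum => k _.
case: (b e <= k)%N => //=; case: (k < N)%N; rewrite ?mul1r ?mul0r ?mulr0 //.
Qed.

End Thresholds.

(** * Short paths between slow vertices *)

Section Walks.
Variables (R : realType) (V : finType) (H : {set {set V}}).
Implicit Types (i j u v : V) (p : seq V).

Definition edges u p : seq {set V} := pairmap (fun x y => [set x; y]%SET) u p.

Lemma size_edges u p : size (edges u p) = size p.
Proof. exact: size_pairmap. Qed.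

Lemma path_length_edges (len : {set V} -> R) u p :
  path_length len u p = \sum_(e <- edges u p) len e.
Proof. by elim: p u => [|v p IH] u /=; rewrite ?big_nil // big_cons IH. Qed.

Lemma edges_sub u p : path [rel x y | [set x; y]%SET \in H] u p ->
  {subset edges u p <= H}.
Proof.
elim: p u => [|v p IH] u //= /andP[uv /IH h] e.
by rewrite inE => /orP[/eqP ->|/h].
Qed.

Lemma mem_edges u p e x : e \in edges u p -> x \in e -> x \in u :: p.
Proof.
elim: p u => [|v p IH] u //=; rewrite inE => /orP[/eqP ->|/IH h /h].
  by rewrite !inE => /orP[] /eqP ->; rewrite eqxx ?orbT.
by move=> h'; rewrite inE h' orbT.
Qed.

Lemma edges_uniq u p : uniq (u :: p) -> uniq (edges u p).
Proof.
elim: p u => [|v p IH] u //= /andP[up vp]; rewrite IH // andbT.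
by apply: contraNN up => /mem_edges; apply; rewrite !inE eqxx.
Qed.

Lemma last_edges_weight (b : {set V} -> nat) u v p a :
  (forall x, a <= b [set x; last u (v :: p)]%SET)%N ->
  (a <= \sum_(e <- edges u (v :: p)) b e)%N.
Proof.
elim: p u v => [|w p IH] u v h; rewrite big_cons ?big_nil ?addn0.
  exact: h.
by rewrite (leq_trans _ (leq_addl _ _)) //; apply: (IH v w).
Qed.

(** The boolean form of [paths]. *)
Definition simple i j p : bool :=
  [&& path [rel x y | [set x; y]%SET \in H] i p, uniq (i :: p) & last i p == j].

Lemma simpleP i j p : paths H i j p <-> simple i j p.
Proof.
split; first by case=> h1 h2 h3; apply/and3P; split=> //; apply/eqP.
by case/and3P=> h1 h2 /eqP h3; split.
Qed.

Fixpoint walks j l u : seq (seq V) :=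
  if l is l'.+1 then
    flatten [seq [seq v :: p | p <- walks j l' v] | v <- enum (neighbours H u)]
  else if u == j then [:: [::]] else [::].

Lemma walks_size j l u p : p \in walks j l u -> size p = l.
Proof.
elim: l u p => [|l IH] u p /=; first by case: eqP; rewrite ?inE // => _ /eqP ->.
by case/flatten_mapP => v _ /mapP[p' /IH <- ->].
Qed.

Lemma simple_walk i j p : simple i j p -> p \in walks j (size p) i.
Proof.
case/and3P => + _; elim: p i => [|v p IH] i /=; first by move=> _ ->; rewrite inE.
case/andP=> iv vp lp; apply/flatten_mapP; exists v.
  by rewrite mem_enum inE.
by apply/mapP; exists p => //; exact: IH.
Qed.

(** The last step is forced, which gains a factor [Delta]. *)
Lemma count_walks (Delta : R) j l u :
  (forall v, #|neighbours H v|%:R <= Delta) ->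
  (size (walks j l.+1 u))%:R <= Delta ^+ l.
Proof.
move=> hD; elim: l u => [|l IH] u.
  rewrite expr0 lern1 /= size_flatten /shape -map_comp sumnE big_map.
  rewrite (eq_bigr (fun v => (v == j : nat))) => [|v _]; last by rewrite /= size_map; case: eqP.
  rewrite big_enum /= big_mkcond (bigD1 j) //= big1; last by move=> v /negbTE ->; case: ifP.
  by rewrite addn0 eqxx; case: ifP.
rewrite [walks _ _ _]/= -/(walks j l.+1) size_flatten /shape -map_comp sumnE big_map natr_sum.
apply: (@le_trans _ _ (\sum_(v <- enum (neighbours H u)) Delta ^+ l)).
  by apply: ler_sum => v _; rewrite /= size_map; exact: IH.
rewrite big_const_seq count_predT iter_addr_0 -cardE -mulr_natr mulrC exprS.
rewrite ler_wpM2r // exprn_ge0 //; exact: le_trans (hD u).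
Qed.

End Walks.

Section SlowVertices.
Variables (R : realType) (V : finType) (H : {set {set V}}) (q rho : R) (N : nat).
Hypotheses (gH : is_graph H) (q01 : 0 < q <= 1) (rho01 : 0 < rho <= 1) (qrho1 : q * rho < 1).
Implicit Types (g : {ffun {set V} -> 'I_N.+1}) (i j u v : V).

Let q01' : 0 <= q <= 1. Proof. by case/andP: q01 => /ltW -> ->. Qed.

Definition slow i a g : bool := [forall e in H, (i \in e) ==> (a <= g e)%N].

Definition slow2 i a j a' (e : {set V}) : nat :=
  maxn (if i \in e then a else 0) (if j \in e then a' else 0).

Lemma slow2P i a j a' g : above H (slow2 i a j a') g = slow i a g && slow j a' g.
Proof.
apply/forall_inP/andP => [h|[/forall_inP hi /forall_inP hj] e eH].
  by split; apply/forall_inP => e eH; have := h e eH; rewrite /slow2 geq_max;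
    case/andP=> h1 h2; apply/implyP => ie; move: h1 h2; rewrite ie.
rewrite /slow2 geq_max; have := hi e eH; have := hj e eH.
by case: (i \in e); case: (j \in e) => //= h1 h2; apply/andP.
Qed.

Definition degree i := #|[set e in H | i \in e]|.

Lemma degree_neighbours i : (degree i <= #|neighbours H i|)%N.
Proof.
apply: leq_trans (leq_imset_card (fun w => [set i; w]%SET) _).
apply/subset_leq_card/fintype.subsetP => e; rewrite inE => /andP[eH ie].
have /[!inE] /cards2P[x [y [xy exy]]] := fintype.subsetP gH e eH.
move: ie; rewrite exy !inE => /orP[] /eqP ->; apply/imsetP.
  by exists y => //; rewrite inE -exy.
by exists x; rewrite ?inE finset.setUC -?exy.
Qed.

Lemma slowE i a g : slow i a g = above H (fun e => if i \in e then a else 0%N) g.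
Proof.
by apply/forall_inP/forall_inP => h e eH; have := h e eH; case: ifP.
Qed.

Lemma pr_slow i a : (a <= N)%N -> pr H q (slow i a : pred {ffun {set V} -> 'I_N.+1}) = q ^+ (a * degree i).
Proof.
move=> aN; rewrite (eq_pr (slowE i a)) pr_above //; last by move=> e _; case: ifP.
congr (_ ^+ _); rewrite -big_mkcondr /= sum_nat_const mulnC; congr (_ * _)%N.
by apply: eq_card => e; rewrite !inE.
Qed.

(** The two events only share the edge between [i] and [j], which is counted
    twice on the right-hand side. *)
Lemma pr_slow2 i j a : (a <= N)%N -> i != j ->
  pr H q (fun g : {ffun {set V} -> 'I_N.+1} => slow i a g && slow j a g) * q ^+ a <=
  pr H q (slow i a : pred {ffun {set V} -> 'I_N.+1}) * pr H q (slow j a : pred {ffun {set V} -> 'I_N.+1}).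
Proof.
move=> aN ij; rewrite -(eq_pr (slow2P i a j a)) pr_above //; last first.
  by move=> e _; rewrite /slow2; do 2 case: ifP; rewrite ?maxnn ?max0n ?maxn0.
rewrite !pr_slow // -!exprD ler_wiXn2l //; try by case/andP: q01'.
rewrite /degree.
have S k : (a * #|[set e in H | k \in e]| = \sum_(e in H) (if k \in e then a else 0))%N.
  rewrite -big_mkcondr /= sum_nat_const mulnC; congr (_ * _)%N.
  by apply: eq_card => e; rewrite !inE.
rewrite !S -big_split /=.
have [ijH|ijH] := boolP ([set i; j]%SET \in H); last first.
  apply: leq_trans (leq_addr _ _); apply: leq_sum => e eH.
  rewrite /slow2; case: ifP => ie; case: ifP => je; rewrite ?maxnn ?maxn0 ?max0n ?addn0 //.
  suff ee : e = [set i; j]%SET by rewrite ee (negbTE ijH) in eH.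
  have /[!inE] /eqP e2 := fintype.subsetP gH e eH.
  apply/esym/eqP; rewrite eqEcard e2 cards2 ij andbT.
  by apply/fintype.subsetP => x; rewrite !inE => /orP[] /eqP ->.
rewrite (bigD1 [set i; j]%SET) //= [in leqRHS](bigD1 [set i; j]%SET) //=.
rewrite !inE !eqxx orbT [leqRHS]addnAC leq_add //.
  by rewrite /slow2 !inE !eqxx orbT maxnn.
apply: leq_sum => e /andP[eH eij].
rewrite /slow2; case: ifP => ie; case: ifP => je; rewrite ?maxnn ?maxn0 ?max0n ?addn0 //.
suff ee : e = [set i; j]%SET by rewrite ee eqxx in eij.
have /[!inE] /eqP e2 := fintype.subsetP gH e eH.
apply/esym/eqP; rewrite eqEcard e2 cards2 ij andbT.
by apply/fintype.subsetP => x; rewrite !inE => /orP[] /eqP ->.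
Qed.

Definition short i j t g : bool :=
  has (fun p => simple H i j p && (\sum_(e <- edges i p) g e < t)%N)
    (flatten [seq walks H j l i | l <- iota 0 #|V|]).

Lemma shortP i j t g p : simple H i j p -> (\sum_(e <- edges i p) g e < t)%N ->
  short i j t g.
Proof.
move=> sp lt; apply/hasP; exists p; last by rewrite sp.
apply/flattenP; exists (walks H j (size p) i); last exact: simple_walk.
apply/mapP; exists (size p) => //; rewrite mem_iota add0n /=.
case/and3P: sp => _ /card_uniqP /= <- _; exact: max_card.
Qed.

Variables (Delta kappa : R).
Hypothesis deg : forall v, #|neighbours H v|%:R <= Delta.
Hypotheses (Delta_gt0 : 0 < Delta) (kappa1 : kappa < 1).
Hypothesis Delta_theta : Delta * ((1 - q) / (1 - q * rho)) <= kappa.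

Let theta := (1 - q) / (1 - q * rho).

Let theta_ge0 : 0 <= theta.
Proof. by case/andP: q01 => q0 q1; rewrite divr_ge0 ?subr_ge0 // ltW. Qed.

(** A path of at least two edges meets the thresholds of both its endpoints, so
    that being [slow] delays it by [a + a']; a single edge meets the larger of
    them only, but is too rare to matter. *)
Lemma pr_slow_short i j a a' t : i != j -> (a <= N)%N -> (a' <= N)%N -> (t <= N)%N ->
  pr H q (fun g : {ffun {set V} -> 'I_N.+1} => [&& slow i a g, slow j a' g & short i j t g])
  <= pr H q (fun g : {ffun {set V} -> 'I_N.+1} => slow i a g && slow j a' g) *
     ((1 - q ^+ t) + rho ^+ (a + a') / rho ^+ t / (Delta * (1 - kappa))).
Proof.
move=> ij aN a'N tN; case/andP: (q01) => q0 q1; case/andP: (rho01) => r0 r1.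
set b := slow2 i a j a'.
have bN e : e \in H -> (b e <= N)%N.
  by move=> _; rewrite /b /slow2 geq_max; do 2 case: ifP; rewrite ?aN ?a'N.
rewrite -(eq_pr (slow2P i a j a')) -/b.
(* Paths of one edge are set apart from the longer ones. *)
pose single g := above H b g && (([set i; j]%SET \in H) && (g [set i; j]%SET < t)%N).
pose long p g := [&& simple H i j p, above H b g & (\sum_(e <- edges i p) g e < t)%N].
set L := flatten [seq walks H j l i | l <- iota 2 #|V|].
have Pp p : p \in L -> long p =1 xpred0 \/ [/\ (1 < size p)%N, simple H i j p
   & pr H q (long p : pred {ffun {set V} -> 'I_N.+1}) <= pr H q (above H b : pred {ffun {set V} -> 'I_N.+1}) * theta ^+ size p * (rho ^+ (a + a') / rho ^+ t)].
  move=> pL; have [sp|sp] := boolP (simple H i j p); last first.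
    by left=> g; rewrite /long (negbTE sp).
  right; have p2 : (1 < size p)%N.
    move: pL => /flatten_mapP[l]; rewrite mem_iota => /andP[l2 _] /walks_size ->; exact: l2.
  split=> //.
  have [pp up /eqP lp] := and3P sp.
  have := pr_above_sum q01' rho01 qrho1 bN (edges_uniq up) (edges_sub pp) tN.
  rewrite (eq_pr (_ : _ =1 long p)) => [le|g]; last by rewrite /long sp.
  rewrite -mulrA [theta ^+ _ * _]mulrA mulrA ler_pdivlMr ?exprn_gt0 // mulrC.
  apply: le_trans le _; rewrite ler_wpM2l ?pr_ge0 // size_edges ler_wpM2l ?exprn_ge0 //.
  rewrite ler_wiXn2l ?(ltW r0) //.
  case: p p2 lp {pL sp pp up} => [|x [|y p]] // _ lp.
  rewrite big_cons leq_add //.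
    by rewrite /b /slow2 !inE eqxx leq_maxl.
  apply: last_edges_weight => z; rewrite [last _ _]lp.
  by rewrite /b /slow2 !inE eqxx orbT leq_maxr.
have un : pr H q (fun g : {ffun {set V} -> 'I_N.+1} => [&& slow i a g, slow j a' g & short i j t g])
   <= pr H q (single : pred {ffun {set V} -> 'I_N.+1}) +
    \sum_(p <- L) pr H q (long p : pred {ffun {set V} -> 'I_N.+1}).
  have := @pr_union R _ H q N q01' _ (None :: map Some L)
    (fun o => if o is Some p then long p else single).
  move=> /(_ _ _)/le_trans; apply; last by rewrite big_cons big_map.
  move=> g; rewrite andbA -slow2P -/b => /andP[ab /hasP[p pw /andP[sp lt]]] /=.
  apply/orP; have [p1|p1] := leqP (size p) 1%N.
    left; rewrite /single ab /=.
    case/and3P: (sp) lt => pp _ /eqP lp; case: p p1 pp lp {pw sp} => [|x [|//]] _ /=.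
      by move=> _ e; rewrite e eqxx in ij.
    by rewrite andbT big_cons big_nil addn0 => xH xj; rewrite -xj xH => ->.
  right; rewrite has_map; apply/hasP; exists p; last by rewrite /= /long sp ab.
  apply/flatten_mapP; exists (size p); last exact: simple_walk.
  rewrite mem_iota p1 /=; case/and3P: sp => _ /card_uniqP /= up _.
  by rewrite (leq_trans _ (leq_addl 2 _)) // -up max_card.
apply: le_trans un _; rewrite mulrDr; apply: lerD.
  have [eH|eH] := boolP ([set i; j]%SET \in H).
    apply: le_trans (pr_above_edge q01' bN eH tN).
    by apply: pr_le => // g; rewrite /single eH.
  rewrite [X in X <= _]/pr big_pred0 => [|g]; last by rewrite /single (negbTE eH) andbF.
  by rewrite mulr_ge0 ?pr_ge0 // subr_ge0 exprn_ile1 // ltW.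
set U := pr H q (above H b : pred {ffun {set V} -> 'I_N.+1}); set c := rho ^+ _ / rho ^+ _.
have U0 : 0 <= U by exact: pr_ge0.
have c0 : 0 <= c by rewrite divr_ge0 // exprn_ge0 // ltW.
apply: (@le_trans _ _ (\sum_(p <- L) U * theta ^+ size p * c)).
  rewrite big_seq [leRHS]big_seq; apply: ler_sum => p /Pp[h|[_ _ //]].
  rewrite (eq_pr h) [X in X <= _]/pr big_pred0 //.
  by apply: mulr_ge0 => //; apply: mulr_ge0 => //; exact: exprn_ge0.
rewrite big_flatten big_map /=.
apply: (@le_trans _ _ (\sum_(l <- iota 2 #|V|) U * c / Delta * kappa ^+ l)).
  rewrite big_seq [leRHS]big_seq; apply: ler_sum => l; rewrite mem_iota => /andP[l2 _].
  rewrite big_seq (eq_bigr (fun _ => U * theta ^+ l * c)) => [|p /walks_size -> //].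
  rewrite -big_seq big_const_seq count_predT iter_addr_0 -mulr_natr.
  case: l l2 => // l _.
  apply: (@le_trans _ _ (U * theta ^+ l.+1 * c * Delta ^+ l)).
    rewrite ler_wpM2l ?count_walks //.
    by apply: mulr_ge0 => //; apply: mulr_ge0 => //; exact: exprn_ge0.
  have -> : U * theta ^+ l.+1 * c * Delta ^+ l = U * c / Delta * (Delta * theta) ^+ l.+1.
    rewrite [(Delta * theta) ^+ _]exprMn [Delta ^+ l.+1]exprS.
    by field; exact: lt0r_neq0.
  have D0 := ltW Delta_gt0.
  rewrite ler_wpM2l //; first by apply: divr_ge0 => //; exact: mulr_ge0.
  have dt0 : 0 <= Delta * theta by exact: mulr_ge0.
  by apply: lerXn2r => //; rewrite nnegrE // (le_trans dt0).
have k0 : 0 <= kappa by apply: le_trans Delta_theta; rewrite mulr_ge0 // ltW.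
have k1 : 0 < 1 - kappa by rewrite subr_gt0.
rewrite -mulr_sumr [leRHS](_ : _ = U * c / Delta * (1 - kappa)^-1); last first.
  by rewrite invfM !mulrA.
rewrite ler_wpM2l //.
  by apply: divr_ge0; [exact: mulr_ge0|exact: ltW].
rewrite -[leRHS]mul1r ler_pdivlMr //.
apply: (@le_trans _ _ ((\sum_(l < 2 + #|V|) kappa ^+ l) * (1 - kappa))).
  rewrite ler_wpM2r ?(ltW k1) // -(big_mkord xpredT (fun l => kappa ^+ l)).
  rewrite (big_cat_nat _ (n := 2)) //= addrC -[X in X <= _]addr0.
  rewrite /index_iota subn2 /= lerD // sumr_ge0 // => l _; exact: exprn_ge0.
rewrite mulrC -[1 - kappa]opprB mulNr -subrX1 opprB gerBl exprn_ge0 //.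
Qed.

End SlowVertices.

(** * The second moment of the number of slow vertices *)

Section Expectation.
Variables (R : realType) (I : finType) (F : {set I}) (q : R) (N : nat).
Hypothesis q01 : 0 <= q <= 1.
Implicit Types (f : {ffun I -> 'I_N.+1} -> R) (P : pred {ffun I -> 'I_N.+1}).

Definition expect f : R := \sum_g wt (edge_law F q (N := N)) g * f g.

Lemma pr_expect P : pr F q P = expect (fun g => (P g)%:R).
Proof.
rewrite /pr big_mkcond; apply: eq_bigr => g _.
by case: (P g); rewrite ?mulr1 ?mulr0.
Qed.

Lemma expect_sum (J : finType) (f : J -> {ffun I -> 'I_N.+1} -> R) :
  expect (fun g => \sum_j f j g) = \sum_j expect (f j).
Proof.
by rewrite exchange_big /=; apply: eq_bigr => g _; rewrite mulr_sumr.
Qed.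

Lemma pr_markov P f (c : R) : 0 <= c -> (forall g, 0 <= f g) ->
  (forall g, P g -> c <= f g) -> c * pr F q P <= expect f.
Proof.
move=> c0 f0 Pf; rewrite pr_expect /expect mulr_sumr; apply: ler_sum => g _.
have w0 : 0 <= wt (edge_law F q (N := N)) g by apply/wt_ge0/edge_law_ge0.
case: (boolP (P g)) => [/Pf le|_]; last by rewrite !mulr0 mulr_ge0.
by rewrite mulr1 mulrC ler_wpM2l.
Qed.

Lemma expect_center f (m : R) : expect f = m ->
  expect (fun g => (f g - m) ^+ 2) = expect (fun g => f g ^+ 2) - m ^+ 2.
Proof.
move=> fm; rewrite /expect.
transitivity (\sum_g (wt (edge_law F q (N := N)) g * f g ^+ 2 +
   (- (2 * m) * (wt (edge_law F q (N := N)) g * f g) + wt (edge_law F q (N := N)) g * m ^+ 2))).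
  by apply: eq_bigr => g _; ring.
rewrite big_split big_split /= -mulr_sumr -mulr_suml wt_sum1; last exact: edge_law_sum1.
by rewrite -/(expect f) fm; ring.
Qed.

End Expectation.

Section FarVertices.
Variables (R : realType) (V : finType) (H : {set {set V}}) (q rho : R) (N D : nat).
Hypotheses (gH : is_graph H) (q01 : 0 < q <= 1) (rho01 : 0 < rho <= 1) (qrho1 : q * rho < 1).
Variables (Delta kappa : R).
Hypothesis deg : forall v, #|neighbours H v|%:R <= Delta.
Hypotheses (Delta_gt0 : 0 < Delta) (kappa1 : kappa < 1).
Hypothesis Delta_theta : Delta * ((1 - q) / (1 - q * rho)) <= kappa.
Hypothesis DN : (3 * D <= N)%N.
Implicit Types (g : {ffun {set V} -> 'I_N.+1}) (i j u v : V).

Let q01' : 0 <= q <= 1. Proof. by case/andP: q01 => /ltW -> ->. Qed.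

Let B := (1 - q ^+ (3 * D)) + (rho ^+ D)^-1 / (Delta * (1 - kappa)).

Let B_ge0 : 0 <= B.
Proof.
case/andP: (q01) => q0 q1; case/andP: (rho01) => r0 r1.
rewrite addr_ge0 // ?subr_ge0 ?exprn_ile1 ?(ltW q0) // divr_ge0 ?invr_ge0 ?exprn_ge0 ?(ltW r0) //.
by rewrite mulr_ge0 ?(ltW Delta_gt0) // subr_ge0 ltW.
Qed.

Let DN1 : (D <= N)%N. Proof. by rewrite (leq_trans _ DN) // leq_pmull. Qed.

(** The bound [B] serves the three cases in which none, one or both of the
    endpoints are slow. *)
Let slow_short i j (c a a' : nat) : i != j -> (c <= 3)%N -> (a <= D)%N -> (a' <= D)%N ->
  (a + a' + D = c * D)%N ->
  pr H q (fun g => [&& slow H i a g, slow H j a' g & short H i j (c * D) g]) <=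
  pr H q (fun g => slow H i a g && slow H j a' g) * B.
Proof.
move=> ij c3 aD a'D e; case/andP: (q01) => q0 q1; case/andP: (rho01) => r0 r1.
have cD : (c * D <= 3 * D)%N by rewrite leq_mul2r c3 orbT.
apply: le_trans (pr_slow_short q01 rho01 qrho1 deg Delta_gt0 kappa1 Delta_theta ij
  (leq_trans aD DN1) (leq_trans a'D DN1) (leq_trans cD DN)) _.
rewrite ler_wpM2l ?pr_ge0 // lerD //.
  by rewrite lerD2l lerN2 ler_wiXn2l // ltW.
rewrite -e [rho ^+ (a + a' + D)]exprD invfM mulrA divff ?mul1r //.
by rewrite expf_neq0 // lt0r_neq0.
Qed.

Lemma pr_short i j : i != j ->
  pr H q (fun g => short H i j D g) <= B.
Proof.
move=> ij; have := @slow_short i j 1 0 0 ij isT (leq0n _) (leq0n _); rewrite mul1n => /(_ erefl).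
have s0 k g : slow H k 0 g by apply/forall_inP => e _; rewrite implybT.
rewrite (eq_pr (_ : _ =1 (fun g => short H i j D g))) => [/le_trans|g]; last by rewrite !s0.
by apply; rewrite ler_piMl // pr_le1.
Qed.

Let mu := \sum_v pr H q (slow H v D : pred {ffun {set V} -> 'I_N.+1}).
Hypothesis mu_gt0 : 0 < mu.

Let Z g : R := \sum_v (slow H v D g)%:R.

Let Z_ge0 g : 0 <= Z g. Proof. by apply: sumr_ge0. Qed.

Let Z_mean : expect H q Z = mu.
Proof. by rewrite expect_sum; apply: eq_bigr => v _; rewrite -pr_expect. Qed.

Let pairs : \sum_u \sum_(v | v != u) pr H q (fun g => slow H u D g && slow H v D g)
  <= mu ^+ 2 / q ^+ D.
Proof.
case/andP: (q01) => q0 q1.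
rewrite ler_pdivlMr ?exprn_gt0 // expr2 {1}/mu !mulr_suml; apply: ler_sum => u _.
rewrite mulr_suml /mu mulr_sumr big_mkcond; apply: ler_sum => v _.
case: ifP => [vu|_]; last by rewrite mulr_ge0 // pr_ge0.
by apply: pr_slow2 => //; rewrite eq_sym.
Qed.

(** Slowness is nearly independent for distinct vertices, which share at most
    one edge, so the number of slow vertices concentrates. *)
Let Z_concentrated : pr H q (fun g => Z g < mu / 2) <= 4 * (mu^-1 + (q ^+ D)^-1 - 1).
Proof.
case/andP: (q01) => q0 q1.
have second : expect H q (fun g => Z g ^+ 2) <= mu + mu ^+ 2 / q ^+ D.
  have -> : expect H q (fun g => Z g ^+ 2) =
      \sum_u \sum_v pr H q (fun g => slow H u D g && slow H v D g).
    rewrite [LHS](_ : _ = expect H q (fun g => \sum_u \sum_v (slow H u D g && slow H v D g)%:R)).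
      rewrite expect_sum; apply: eq_bigr => u _; rewrite expect_sum; apply: eq_bigr => v _.
      by rewrite -pr_expect.
    apply: eq_bigr => g _; congr (_ * _); rewrite expr2 {1}/Z mulr_suml; apply: eq_bigr => u _.
    by rewrite mulr_sumr; apply: eq_bigr => v _; rewrite -natrM mulnb.
  apply: le_trans (lerD (lexx mu) pairs).
  rewrite {1}/mu -big_split /=; apply: ler_sum => u _.
  rewrite (bigD1 u) //= lerD2r; apply: pr_le => // g; by case/andP.
have := @pr_markov _ _ H q N q01' (fun g => Z g < mu / 2) (fun g => (Z g - mu) ^+ 2)
  (mu ^+ 2 / 4) _ _ _.
rewrite (expect_center Z_mean) => /(_ _ _ _) h.
have {}h : mu ^+ 2 / 4 * pr H q (fun g => Z g < mu / 2) <= expect H q (fun g => Z g ^+ 2) - mu ^+ 2.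
  apply: h; [by rewrite divr_ge0 // sqr_ge0|by move=> g; rewrite sqr_ge0|].
  by move=> g lt; have := Z_ge0 g; have := mu_gt0; nra.
rewrite -(ler_pM2l (x := mu ^+ 2 / 4)); last by rewrite divr_gt0 // exprn_gt0.
apply: (le_trans h); apply: (le_trans (lerB second (lexx _))).
rewrite le_eqVlt; apply/orP; left; apply/eqP.
by field; rewrite expf_neq0 ?lt0r_neq0.
Qed.

(** If every slow vertex were close to [i], the slow vertices close to [i]
    would be as numerous as all slow ones, although their expected number is
    smaller by the factor [B]. *)
Lemma pr_far_from i :
  pr H q (fun g => [forall j, slow H j D g ==> short H i j (2 * D) g]) <=
  4 * (mu^-1 + (q ^+ D)^-1 - 1) + 2 * (mu^-1 + B).
Proof.
apply: le_trans (lerD Z_concentrated (lexx _)).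
rewrite (pr_split _ _ _ (fun g => Z g < mu / 2)); apply: lerD.
  by apply: pr_le => // g /andP[].
have mean : expect H q (fun g => \sum_j (slow H j D g && short H i j (2 * D) g)%:R)
    <= 1 + mu * B.
  rewrite expect_sum (bigD1 i) //= lerD //; first by rewrite -pr_expect pr_le1.
  rewrite /mu mulr_suml [leRHS](bigD1 i) //=.
  apply: ler_wpDl; first by rewrite mulr_ge0 // pr_ge0.
  apply: ler_sum => j ji; rewrite -pr_expect.
  have := @slow_short i j 2 0 D; rewrite eq_sym => /(_ ji isT (leq0n _) (leqnn _)).
  have s0 k g : slow H k 0 g by apply/forall_inP => e _; rewrite implybT.
  rewrite add0n addnn -mul2n => /(_ erefl).
  rewrite (eq_pr (_ : _ =1 (fun g => slow H j D g && short H i j (2 * D) g))) => [|g];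
    last by rewrite s0.
  by rewrite [X in _ <= X * _](eq_pr (_ : _ =1 slow H j D)) // => g; rewrite s0.
have := @pr_markov _ _ H q N q01' (fun g => [forall j, slow H j D g ==> short H i j (2 * D) g]
   && ~~ (Z g < mu / 2)) (fun g => \sum_j (slow H j D g && short H i j (2 * D) g)%:R) (mu / 2).
move=> /(_ _ _ _) h.
rewrite -(ler_pM2l (x := mu / 2)); last by rewrite divr_gt0.
apply: (@le_trans _ _ (1 + mu * B)); last first.
  rewrite le_eqVlt; apply/orP; left; apply/eqP.
  by field; rewrite lt0r_neq0.
apply: le_trans mean; apply: h; first by rewrite divr_ge0 // ltW.
  by move=> g; apply: sumr_ge0.
move=> g /andP[/forallP al]; rewrite -leNgt => /le_trans; apply.
apply: ler_sum => j _; have := al j; case: (slow H j D g) => //=.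
by move=> ->.
Qed.

(** The same comparison for pairs of slow vertices. *)
Lemma pr_far_pair :
  pr H q (fun g => [forall i, forall j, (slow H i D g && slow H j D g) ==>
                     short H i j (3 * D) g]) <=
  4 * (mu^-1 + (q ^+ D)^-1 - 1) + 4 * (mu^-1 + B / q ^+ D).
Proof.
case/andP: (q01) => q0 q1.
apply: le_trans (lerD Z_concentrated (lexx _)).
rewrite (pr_split _ _ _ (fun g => Z g < mu / 2)); apply: lerD.
  by apply: pr_le => // g /andP[].
set Y := fun g => \sum_i \sum_j [&& slow H i D g, slow H j D g & short H i j (3 * D) g]%:R : R.
have mean : expect H q Y <= mu + mu ^+ 2 / q ^+ D * B.
  apply: le_trans (lerD (lexx mu) (ler_wpM2r B_ge0 pairs)).
  rewrite /mu /Y expect_sum mulr_suml -big_split /=; apply: ler_sum => i _.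
  rewrite expect_sum (bigD1 i) //= lerD //.
    by rewrite -pr_expect; apply: pr_le => // g /andP[].
  rewrite mulr_suml; apply: ler_sum => j ji; rewrite -pr_expect.
  by apply: slow_short => //; [rewrite eq_sym|rewrite addnn -mul2n -mulSnr].
have := @pr_markov _ _ H q N q01' (fun g => [forall i, forall j, (slow H i D g && slow H j D g) ==>
                     short H i j (3 * D) g] && ~~ (Z g < mu / 2)) Y (mu ^+ 2 / 4).
move=> /(_ _ _ _) h.
rewrite -(ler_pM2l (x := mu ^+ 2 / 4)); last by rewrite divr_gt0 // exprn_gt0.
apply: (@le_trans _ _ (mu + mu ^+ 2 / q ^+ D * B)); last first.
  rewrite le_eqVlt; apply/orP; left; apply/eqP.
  by field; rewrite expf_neq0 ?lt0r_neq0.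
apply: le_trans mean; apply: h; first by rewrite divr_ge0 // sqr_ge0.
  by move=> g; apply: sumr_ge0 => i _; apply: sumr_ge0.
move=> g /andP[/forallP al]; rewrite -leNgt => Zg.
apply: (@le_trans _ _ (Z g ^+ 2)); first by have := mu_gt0; nra.
rewrite expr2 {1}/Z mulr_suml; apply: ler_sum => i _.
rewrite mulr_sumr; apply: ler_sum => j _; have /forallP/(_ j) := al i.
by case: (slow H i D g); case: (slow H j D g) => //=; rewrite ?mul0r ?mulr0 // mulr1 => ->.
Qed.

End FarVertices.

(** * Tails for uniform random subsets *)

Section RandomSubset.
Variables (R : realType) (I : finType) (U : {set I}).
Implicit Types (s Q : {set I}) (e : I) (m : nat).

Definition subsets_of_size m : {set {set I}} := [set s : {set I} | (s \subset U) && (#|s| == m)].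

Lemma card_subsets_of_size m : #|subsets_of_size m| = 'C(#|U|, m).
Proof. exact: cards_draws. Qed.

(** Both sides sum over the pairs of a subset of size [m + 1] and a
    distinguished element of it. *)
Lemma sum_add_element m (f : I -> R) :
  m.+1%:R * \sum_(s in subsets_of_size m.+1) \prod_(e in s) f e =
  \sum_(s in subsets_of_size m) (\prod_(e in s) f e) * \sum_(e in U :\: s) f e.
Proof.
transitivity (\sum_(s in subsets_of_size m.+1) \sum_(e in s) \prod_(x in s) f x).
  rewrite mulr_sumr; apply: eq_bigr => s; rewrite inE => /andP[_ /eqP sm].
  by rewrite sumr_const sm mulr_natl.
under [RHS]eq_bigr do rewrite mulr_sumr.
rewrite pair_big_dep [RHS]pair_big_dep /=.
rewrite (reindex_onto (fun p : {set I} * I => (p.2 |: p.1, p.2)) (fun p => (p.1 :\ p.2, p.2))) /=.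
  apply: eq_big => [[s e]|[s e]] /=.
    rewrite !inE eqxx /= andbT finset.subUset finset.sub1set.
    have [es|es] := boolP (e \in s).
      rewrite !andbF /=; apply/negbTE/nandP; right; apply: contraTN es => /eqP[<-].
      by rewrite !inE eqxx.
    rewrite setU1K // eqxx cardsU1 es add1n eqSS andbT.
    by case: (e \in U); case: (s \subset U); case: (#|s| == m).
  rewrite !inE eqxx /= andbT => /andP[_ /eqP[se]].
  have es : e \notin s by rewrite -se !inE eqxx.
  by rewrite big_setU1 //= mulrC.
move=> [s e] /=; rewrite !inE => /andP[_ es]; by rewrite finset.setD1K.
Qed.

(** If every partial draw leaves at most an average of [c] per remaining
    element, drawing without replacement does no better than [c] per draw. *)
Lemma sum_prod_subsets m (f : I -> R) (c : R) :
  (forall e, 0 <= f e) -> 0 <= c ->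
  (forall s, s \subset U -> (#|s| < m)%N -> \sum_(e in U :\: s) f e <= c * (#|U| - #|s|)%:R) ->
  \sum_(s in subsets_of_size m) \prod_(e in s) f e <= c ^+ m * 'C(#|U|, m)%:R.
Proof.
move=> f0 c0; elim: m => [|m IH] avg.
  rewrite (big_pred1 finset.set0) ?big_set0 ?bin0 ?mulr1 ?expr0 // => s.
  by rewrite !inE cards_eq0 andb_idl // => /eqP ->; rewrite finset.sub0set.
rewrite -(ler_pM2l (x := m.+1%:R)) ?ltr0n // sum_add_element.
apply: (@le_trans _ _ (\sum_(s in subsets_of_size m) (\prod_(e in s) f e) * (c * (#|U| - m)%:R))).
  apply: ler_sum => s; rewrite inE => /andP[sU /eqP sm].
  rewrite ler_wpM2l ?prodr_ge0 //.
  by have := avg s sU; rewrite sm => /(_ (ltnSn m)).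
rewrite -mulr_suml.
have -> : m.+1%:R * (c ^+ m.+1 * 'C(#|U|, m.+1)%:R) = c ^+ m * 'C(#|U|, m)%:R * (c * (#|U| - m)%:R) :> R.
  have : (m.+1 * 'C(#|U|, m.+1))%N%:R = ((#|U| - m) * 'C(#|U|, m))%N%:R :> R by rewrite mul_bin_left.
  by rewrite !natrM exprS mulrCA => ->; ring.
rewrite ler_wpM2r ?mulr_ge0 //; apply: IH => s sU sm.
by apply: avg => //; exact: ltnW.
Qed.

Let prod_two (a : R) Q s : \prod_(e in s) (if e \in Q then a else 1) = a ^+ #|s :&: Q|.
Proof.
rewrite -big_mkcondr /= -[RHS]prodr_const; apply: eq_bigl => e; by rewrite inE.
Qed.

Let cardD s : s \subset U -> #|U :\: s| = (#|U| - #|s|)%N.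
Proof. by move=> sU; rewrite cardsD (finset.setIidPr sU). Qed.

Let count (P : pred {set I}) m : R := #|[set s in subsets_of_size m | P s]|%:R.

Let count_markov (P : pred {set I}) m (f : I -> R) (c : R) :
  (forall e, 0 <= f e) -> (forall s, P s -> c <= \prod_(e in s) f e) ->
  c * count P m <= \sum_(s in subsets_of_size m) \prod_(e in s) f e.
Proof.
move=> f0 Pc; rewrite /count -sumr_const mulr_sumr.
rewrite (eq_bigl (fun s => (s \in subsets_of_size m) && P s)) => [|s]; last by rewrite inE.
rewrite big_mkcondr; apply: ler_sum => s _.
by case: ifP => [/Pc|_]; rewrite ?mulr1 // prodr_ge0.
Qed.

(** Weight 2 on [Q]. Whatever has been drawn, at most [|Q|] elements of [Q] and at
    least [|U| - m] elements of [U] are left, so each draw multiplies the weight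
    by [1 + |Q| / (|U| - m)] at most. *)
Lemma upper_tail m b Q : Q \subset U -> (m < #|U|)%N ->
  count (fun s => b <= #|s :&: Q|)%N m <=
  expR (m%:R * #|Q|%:R / (#|U| - m)%:R - b%:R / 2) * 'C(#|U|, m)%:R.
Proof.
move=> QU mU; have M0 : 0 < (#|U| - m)%:R :> R by rewrite ltr0n subn_gt0.
set c := 1 + #|Q|%:R / (#|U| - m)%:R : R.
have c0 : 0 <= c by rewrite addr_ge0 // divr_ge0 // ltW.
pose f e : R := if e \in Q then 2 else 1.
have f0 e : 0 <= f e by rewrite /f; case: ifP.
have := @sum_prod_subsets m f c f0 c0.
have avg s : s \subset U -> (#|s| < m)%N -> \sum_(e in U :\: s) f e <= c * (#|U| - #|s|)%:R.
  move=> sU sm.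
  have -> : \sum_(e in U :\: s) f e = (#|U| - #|s|)%:R + #|(U :\: s) :&: Q|%:R.
    rewrite -(cardD sU) -!sumr_const (eq_bigr (fun e => 1 + (if e \in Q then 1 else 0))).
      rewrite big_split /= -big_mkcondr /=; congr (_ + _); apply: eq_bigl => e; by rewrite !inE.
    by move=> e _; rewrite /f; case: ifP; rewrite ?addr0.
  rewrite /c mulrDl mul1r lerD2l mulrAC ler_pdivlMr //.
  apply: ler_pM => //; rewrite ler_nat; first by rewrite subset_leq_card // finset.subsetIr.
  by rewrite leq_sub2l // ltnW.
move=> /(_ avg) le1.
have := @count_markov (fun s => b <= #|s :&: Q|)%N m f (2 ^+ b) f0.
move=> /(_ _)/le_trans => /(_ _ _ le1) le2.
have {}le2 : 2 ^+ b * count (fun s => (b <= #|s :&: Q|)%N) m <= c ^+ m * ('C(#|U|, m))%:R.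
  apply: le2 => s bs; rewrite /f prod_two.
  by apply: ler_weXn2l; rewrite // ler1n.
have half : expR (2^-1) <= 2 :> R.
  rewrite -[leRHS]invrK -[expR _]invrK lef_pV2 ?posrE ?invr_gt0 ?expR_gt0 //.
  by rewrite -expRN; apply: le_trans (expR_ge1Dx _); lra.
have cm : c ^+ m <= expR (m%:R * #|Q|%:R / (#|U| - m)%:R).
  rewrite -mulrA expRM_natl; apply: lerXn2r; rewrite ?nnegrE ?expR_ge0 //.
  exact: expR_ge1Dx.
rewrite expRD mulrAC -ler_pdivrMr ?expR_gt0 // -expRN opprK.
apply: le_trans (ler_wpM2r (ler0n _ _) cm); apply: le_trans le2.
rewrite mulrC ler_wpM2r ?ler0n // expRM_natl.
by apply: lerXn2r; rewrite ?nnegrE ?expR_ge0.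
Qed.

(** Weight 1 / 2 on [Q]. At least [|Q| - m] elements of [Q] are left at every draw,
    each of which lowers the average weight of the remaining ones. *)
Lemma lower_tail m b Q : Q \subset U -> (m <= #|Q|)%N -> (0 < #|U|)%N ->
  count (fun s => #|s :&: Q| <= b)%N m <=
  expR (b%:R - m%:R * (#|Q| - m)%:R / (2 * #|U|%:R)) * 'C(#|U|, m)%:R.
Proof.
move=> QU mQ U0; have M0 : 0 < #|U|%:R :> R by rewrite ltr0n.
set x := (#|Q| - m)%:R / (2 * #|U|%:R) : R; set c := 1 - x.
have QMn : (#|Q| - m <= #|U|)%N by rewrite (leq_trans (leq_subr _ _)) // subset_leq_card.
have QM : (#|Q| - m)%:R <= #|U|%:R :> R by rewrite ler_nat.
have xx : x * #|U|%:R = (#|Q| - m)%:R / 2 by rewrite /x; field; exact: lt0r_neq0.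
have x0 : 0 <= x by rewrite divr_ge0 // mulr_ge0 // ltW.
have c0 : 0 <= c by rewrite subr_ge0 ler_pdivrMr ?mulr_gt0 // mul1r; lra.
pose f e : R := if e \in Q then 2^-1 else 1.
have f0 e : 0 <= f e by rewrite /f; case: ifP => // _; rewrite invr_ge0.
have := @sum_prod_subsets m f c f0 c0.
have avg s : s \subset U -> (#|s| < m)%N -> \sum_(e in U :\: s) f e <= c * (#|U| - #|s|)%:R.
  move=> sU sm.
  have e1 : \sum_(e in U :\: s) f e + #|(U :\: s) :&: Q|%:R / 2 = (#|U| - #|s|)%:R.
    rewrite -(cardD sU) -!sumr_const mulr_suml.
    rewrite [X in _ + X](eq_bigl (fun e => (e \in U :\: s) && (e \in Q))) => [|e]; last by rewrite !inE.
    rewrite [X in _ + X]big_mkcondr -big_split /=; apply: eq_bigr => e _.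
    by rewrite /f; case: ifP => _; lra.
  have : (#|Q| - m <= #|(U :\: s) :&: Q|)%N.
    have -> : (U :\: s) :&: Q = Q :\: s.
      apply/finset.setP => e; rewrite !inE; case: (boolP (e \in Q)) => eQ; rewrite ?andbF //.
      by rewrite (fintype.subsetP QU) // !andbT.
    rewrite cardsD; apply: leq_sub2l.
    by rewrite (leq_trans (subset_leq_card (finset.subsetIr _ _))) // ltnW.
  rewrite -(ler_nat R) => le.
  have sM : (#|U| - #|s|)%:R <= #|U|%:R :> R by rewrite ler_nat leq_subr.
  rewrite /c mulrBl mul1r; have := ler_wpM2l x0 sM; rewrite xx; lra.
move=> /(_ avg) le1.
have := @count_markov (fun s => #|s :&: Q| <= b)%N m f (2^-1 ^+ b) f0.
move=> /(_ _)/le_trans => /(_ _ _ le1) le2.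
have {}le2 : 2^-1 ^+ b * count (fun s => (#|s :&: Q| <= b)%N) m <= c ^+ m * ('C(#|U|, m))%:R.
  apply: le2 => s bs; rewrite /f prod_two.
  by apply: ler_wiXn2l; rewrite // ?invr_ge0 // invf_le1 // ler1n.
have two : 2 <= expR 1 :> R by apply: le_trans (expR_ge1Dx _); lra.
have cm : c ^+ m <= expR (- (m%:R * (#|Q| - m)%:R / (2 * #|U|%:R))).
  rewrite -mulrA -mulrN expRM_natl; apply: lerXn2r; rewrite ?nnegrE ?expR_ge0 //.
  by apply: le_trans (expR_ge1Dx _); rewrite /c.
rewrite addrC expRD mulrAC -ler_pdivrMr ?expR_gt0 //.
apply: le_trans (ler_wpM2r (ler0n _ _) cm); apply: le_trans le2.
rewrite mulrC ler_wpM2r ?ler0n // -[b%:R]mulr1 expRM_natl -exprVn.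
by apply: lerXn2r; rewrite ?nnegrE ?invr_ge0 ?expR_ge0 // lef_pV2 ?posrE ?expR_gt0.
Qed.

End RandomSubset.

(** * Rounding exponential lengths *)

Section ExponentialCells.
Local Open Scope classical_set_scope.
Local Open Scope ring_scope.
Variable R : realType.
Local Notation expo := (exponential_prob (1 : R)).
Implicit Types (A B : set R) (a b : R).

Let pdf_ge0 (x : R) : (0 <= (exponential_pdf 1 x)%:E)%E.
Proof. by rewrite lee_fin exponential_pdf_ge0. Qed.

Let expoU A B : measurable A -> measurable B -> [disjoint A & B] ->
  expo (A `|` B) = (expo A + expo B)%E.
Proof.
move=> mA mB dAB; rewrite /exponential_prob ge0_integral_setU //.
apply/measurable_funTS/measurableT_comp => //; exact: measurable_exponential_pdf.
Qed.

Let expo0c b : 0 <= b -> expo `[0, b] = (1 - expR (- b))%:E.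
Proof.
rewrite le_eqVlt => /orP[/eqP <-|b0].
  by rewrite set_itv1 /exponential_prob integral_set1 oppr0 expR0 subrr.
by rewrite exponential_prob_itv0c // mulN1r.
Qed.

Lemma expo_itv a b : 0 <= a -> a <= b -> expo `]a, b] = (expR (- a) - expR (- b))%:E.
Proof.
move=> a0 ab; have := expo0c (le_trans a0 ab).
rewrite (_ : `[0, b]%classic = `[0, a] `|` `]a, b]); last first.
  by rewrite -itv_bndbnd_setU // bnd_simp.
rewrite expoU //; last first.
  apply/disj_setPRL => x /=; rewrite !in_itv /= => /andP[ax _].
  by apply/negP; rewrite negb_and -!ltNge ax orbT.
rewrite expo0c //; case: (expo `]a, b]) => [r| |] //=.
by rewrite -EFinD => -[e]; congr (_%:E); lra.
Qed.

Lemma expo_ray a : 0 <= a -> expo `]a, +oo[ = (expR (- a))%:E.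
Proof.
move=> a0; have : expo setT = 1%E by rewrite /exponential_prob integral_exponential_pdf.
rewrite (_ : [set: R] = `]-oo, 0[ `|` (`[0, a] `|` `]a, +oo[)); last first.
  rewrite -itv_bndbnd_setU ?bnd_simp // -itv_bndbnd_setU ?bnd_simp //.
  by rewrite set_itvNyy.
rewrite expoU //; first last.
- apply/disj_setPRL => x /=; rewrite !in_itv /= => -[/andP[x0 _]|].
    by apply/negP; rewrite -leNgt.
  by rewrite andbT => ax; apply/negP; rewrite -leNgt; apply: ltW; apply: le_lt_trans ax.
- exact: measurableU.
rewrite expoU //; last first.
  apply/disj_setPRL => x /=; rewrite !in_itv /= andbT => ax.
  by apply/negP; rewrite negb_and -!ltNge ax orbT.
rewrite expo0c // [X in (X + _)%E](_ : _ = 0%E); last first.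
  rewrite /exponential_prob integral0_eq // => x /=; rewrite in_itv /= => x0.
  by rewrite lt0_exponential_pdf.
rewrite add0e; case: (expo `]a, +oo[) => [r| |] //=.
by rewrite -EFinD => -[e]; congr (_%:E); lra.
Qed.

Variables (h : R) (N : nat).
Hypothesis h_gt0 : 0 < h.

Definition cell (k : 'I_N.+1) : set R :=
  if (k < N)%N then `](h * k%:R), (h * k.+1%:R)]%classic else `](h * N%:R), +oo[%classic.

Lemma measurable_cell k : measurable (cell k).
Proof. by rewrite /cell; case: ifP. Qed.

Lemma cell_ge (k : 'I_N.+1) x : cell k x -> h * k%:R <= x.
Proof.
rewrite /cell; case: ifP => kN /=; rewrite in_itv /=; first by case/andP => /ltW.
rewrite andbT => /ltW; apply: le_trans; rewrite ler_wpM2l ?(ltW h_gt0) // ler_nat.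
by rewrite -ltnS ltn_ord.
Qed.

Lemma cell_le (k : 'I_N.+1) x : (k < N)%N -> cell k x -> x <= h * k.+1%:R.
Proof. by rewrite /cell => -> /=; rewrite in_itv /= => /andP[]. Qed.

Lemma cell_disjoint k l x : cell k x -> cell l x -> k = l.
Proof.
wlog kl : k l / (k <= l)%N.
  by move=> wl ck cl; case/orP: (leq_total k l) => ?; [|symmetry]; exact: wl.
move=> ck cl; apply/val_inj/eqP; rewrite eqn_leq kl /= leqNgt; apply/negP => lt.
have lN : (l <= N)%N by rewrite -ltnS ltn_ord.
have kN := leq_trans lt lN.
have xl : h * l%:R < x.
  move: cl; rewrite /cell; case: ifP => h' /=; rewrite in_itv /=; first by case/andP.
  have -> : nat_of_ord l = N by apply/eqP; rewrite eqn_leq lN leqNgt h'.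
  by rewrite andbT.
have := cell_le kN ck; rewrite leNgt => /negP; apply.
by apply: le_lt_trans xl; rewrite ler_wpM2l ?(ltW h_gt0) // ler_nat.
Qed.

Lemma expo_cell k : expo (cell k) = (geo (expR (- h)) k)%:E.
Proof.
rewrite /cell /geo; case: ifP => kN.
  rewrite expo_itv ?mulr_ge0 ?ler_wpM2l ?ler_nat ?(ltW h_gt0) //; congr (_%:E).
  rewrite -expRM_natl mulrBl mul1r -expRD; congr (expR _ - expR _); ring.
rewrite expo_ray ?mulr_ge0 ?(ltW h_gt0) //; congr (_%:E).
by rewrite -expRM_natl; congr expR; ring.
Qed.

End ExponentialCells.

Section FiniteAdditivity.
Local Open Scope classical_set_scope.
Local Open Scope ring_scope.
Variables (R : realType) (d : measure_display) (T : measurableType d) (P : probability T R).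

Lemma sum_measure_le (J : eqType) (F : J -> set T) (s : seq J) (A : set T) :
  (forall j, measurable (F j)) -> (forall j j', j != j' -> F j `&` F j' = set0) ->
  uniq s -> measurable A -> (forall j, j \in s -> F j `<=` A) ->
  (\sum_(j <- s) P (F j) <= P A)%E.
Proof.
move=> mF dF; elim: s A => [|j s IH] A; first by rewrite big_nil.
move=> /= /andP[js us] mA sub; rewrite big_cons.
have jA : F j `<=` A by apply: sub; rewrite inE eqxx.
have -> : P A = (P (F j) + P (A `\` F j))%E.
  rewrite -measureU //; last by rewrite setDE setICA setICr setI0.
    by rewrite setDUK.
  exact: measurableD.
rewrite leeD2l // IH //; first exact: measurableD.
move=> j' j's w bw; split; first by apply: sub bw; rewrite inE j's orbT.
move=> bw'; have : (F j `&` F j') w by [].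
rewrite dF //; by apply: contraNneq js => ->.
Qed.

End FiniteAdditivity.

Section Discretization.
Local Open Scope classical_set_scope.
Local Open Scope ring_scope.
Variables (R : realType) (d : measure_display) (T : measurableType d) (P : probability T R).
Variables (C : set T) (I : finType) (F : {set I}) (X : I -> {RV P >-> R}).
Hypothesis mC : measurable C.
Hypothesis iidX : iid_exp1_given C F X.
Variables (h : R) (N : nat).
Hypothesis h_gt0 : 0 < h.
Implicit Types (g : {ffun I -> 'I_N.+1}).

Let mcell g : forall e, measurable (cell h (g e)).
Proof. by move=> e; exact: measurable_cell. Qed.

Let box g : set T := \bigcap_(e in [set` F]) (X e @^-1` cell h (g e)).

(** Only one configuration is kept for each choice of the coordinates in [F], so
    that distinct configurations have disjoint boxes. *)
Let pinned_box g : set T :=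
  if [forall e, (e \notin F) ==> (g e == ord0)] then C `&` box g else set0.

Let pr_pinned_box g : P (pinned_box g) = (P C * (wt (edge_law F (expR (- h)) (N := N)) g)%:E)%E.
Proof.
rewrite /pinned_box; case: ifP => [/forallP pin|/negbT/forallPn[e]]; last first.
  rewrite negb_imply => /andP[eF ge].
  rewrite measure0 /wt (bigD1 e) //= /edge_law (negbTE eF) (negbTE ge) mul0r.
  by rewrite mule0.
rewrite (iidX (mcell g)); congr (_ * _)%E.
  rewrite (eq_bigr (fun e => (geo (expR (- h)) (g e))%:E)) => [|e _]; last exact: expo_cell.
  rewrite prodEFin; congr (_%:E); rewrite /wt big_mkcond; apply: eq_bigr => e _.
  by rewrite /edge_law; case: ifP => // eF; have := pin e; rewrite eF /= => ->.
Qed.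

Let measurable_pinned_box g : measurable (pinned_box g).
Proof.
rewrite /pinned_box; case: ifP => // _; apply: measurableI => //.
apply: fin_bigcap_measurable => // e _.
by rewrite -[X in measurable X]setTI; apply: measurable_funPT => //; exact: measurable_cell.
Qed.

Let pinned_disjoint g g' : g != g' -> pinned_box g `&` pinned_box g' = set0.
Proof.
move=> gg'; rewrite /pinned_box; case: ifP => [/forallP p1|]; last by rewrite set0I.
case: ifP => [/forallP p2|]; last by rewrite setI0.
apply/seteqP; split=> // w [[_ b1] [_ b2]] /=.
move/eqP: gg'; apply; apply/ffunP => e; have [eF|eF] := boolP (e \in F).
  by apply: (cell_disjoint h_gt0 (x := X e w)); [exact: b1|exact: b2].
by have := p1 e; have := p2 e; rewrite eF /= => /eqP -> /eqP ->.
Qed.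

(** The boxes of good configurations are disjoint subsets of [C] and [Ev], and
    their total probability is that of the good configurations. Truncated
    and negative lengths need no separate treatment: they lie in the last cell or
    in no cell at all. *)
Lemma discretize (Ev : set T) (good : pred {ffun I -> 'I_N.+1}) (beta : R) :
  measurable Ev ->
  (forall g, good g -> forall w, (forall e, e \in F -> cell h (g e) (X e w)) -> Ev w) ->
  pr F (expR (- h)) (fun g => ~~ good g) <= beta ->
  (P (C `&` ~` Ev) <= P C * beta%:E)%E.
Proof.
move=> mEv sub le.
have h1 : (P C * (pr F (expR (- h)) good)%:E <= P (C `&` Ev))%E.
  have := @sum_measure_le _ _ _ P _ _ (enum good) (C `&` Ev) measurable_pinned_box
    pinned_disjoint (enum_uniq _) (measurableI _ _ mC mEv) _.
  rewrite big_enum /=; under eq_bigr do rewrite pr_pinned_box.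
  rewrite -ge0_sume_distrr => [|g _]; last first.
    rewrite lee_fin wt_ge0 // => e k; apply: edge_law_ge0.
    by rewrite expR_ge0 -expR0 ler_expR oppr_le0 ltW.
  rewrite sumEFin; apply => g; rewrite mem_enum => gg w; rewrite /pinned_box.
  case: ifP => // _ [Cw bw]; split=> //; apply: (sub g) => // e eF; exact: bw.
have fC : P C \is a fin_num by exact: fin_num_measure.
have fE : P (C `&` Ev) \is a fin_num by apply: fin_num_measure; exact: measurableI.
have -> : P (C `&` ~` Ev) = (P C - P (C `&` Ev))%E by rewrite -setDE measureD // ltey_eq fC.
rewrite leeBlDr //; apply: le_trans (leeD2l _ h1).
rewrite -muleDr //.
rewrite -EFinD -[leLHS]mule1 lee_wpmul2l // lee_fin.
have q01 : 0 <= expR (- h) <= 1 by rewrite expR_ge0 -expR0 ler_expR oppr_le0 ltW.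
by move: le; rewrite (prC F (expR (- h)) good); lra.
Qed.

End Discretization.

Section MeasurableDistances.
Local Open Scope classical_set_scope.
Local Open Scope ring_scope.
Variables (R : realType) (d : measure_display) (T : measurableType d) (P : probability T R).
Variables (V : finType) (H : {set {set V}}) (X : {set V} -> {RV P >-> R}).

Let mdist i j : measurable_fun setT (fun w => dist H (fun e => X e w) i j).
Proof.
set L := [seq p <- flatten [seq walks H j l i | l <- iota 0 #|V|] | simple H i j p].
have -> : (fun w => dist H (fun e => X e w) i j) =
    (fun w => \big[mine/+oo%E]_(p <- L) (\sum_(e <- edges i p) X e w)%:E).
  apply/funext => w; apply/eqP; rewrite eq_le; apply/andP; split.
    rewrite big_seq; elim/big_ind: _ => [|x y hx hy|p]; first exact: leey.
      by rewrite le_min hx hy.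
    rewrite mem_filter => /andP[/simpleP sp _]; apply: ereal_inf_lbound.
    by exists p => //; rewrite path_length_edges.
  apply: le_ereal_inf_tmp => _ [p pP <-].
  have sp : simple H i j p by apply/simpleP.
  have pL : p \in L.
    rewrite mem_filter sp; apply/flattenP; exists (walks H j (size p) i); last exact: simple_walk.
    apply/mapP; exists (size p) => //; rewrite mem_iota add0n /=.
    case/and3P: sp => _ /card_uniqP /= <- _; exact: max_card.
  rewrite (big_rem p pL) /= ge_min path_length_edges lexx //.
elim: L => [|p L IH].
  by under eq_fun do rewrite big_nil; exact: measurable_cst.
under eq_fun do rewrite big_cons; apply: measurable_mine => //.
apply/measurable_EFinP; elim: (edges i p) => [|e s IHs].
  by under eq_fun do rewrite big_nil; exact: measurable_cst.
by under eq_fun do rewrite big_cons; exact: measurable_funD.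
Qed.

Let mmax (J : Type) (s : seq J) (f : J -> T -> \bar R) :
  (forall j, measurable_fun setT (f j)) ->
  measurable_fun setT (fun w => (\big[maxe/-oo]_(j <- s) f j w)%E).
Proof.
move=> mf; elim: s => [|j s IH].
  by under eq_fun do rewrite big_nil; exact: measurable_cst.
by under eq_fun do rewrite big_cons; exact: measurable_maxe.
Qed.

Lemma measurable_dist i j : measurable_fun setT (fun w => dist H (fun e => X e w) i j).
Proof. exact: mdist. Qed.

Lemma measurable_max_dist_from i : measurable_fun setT (fun w => max_dist_from H (fun e => X e w) i).
Proof. by apply: mmax => j; exact: mdist. Qed.

Lemma measurable_max_dist : measurable_fun setT (fun w => max_dist H (fun e => X e w)).
Proof. by apply: mmax => i; apply: mmax => j; exact: mdist. Qed.

End MeasurableDistances.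

(** * Upper bounds for distances in a graph with wide cuts *)

Section BoundaryCount.
Variables (V : finType) (H : {set {set V}}).
Implicit Types (S : {set V}) (u v : V).

Lemma set2_inj S u v u' v' : u \in S -> v \notin S -> u' \in S -> v' \notin S ->
  [set u; v]%SET = [set u'; v']%SET -> (u, v) = (u', v').
Proof.
move=> uS vS u'S v'S e.
have : u \in [set u'; v']%SET by rewrite -e !inE eqxx.
have : v \in [set u'; v']%SET by rewrite -e !inE eqxx orbT.
rewrite !inE => /orP[/eqP vu'|/eqP ->]; first by rewrite vu' u'S in vS.
by case/orP=> /eqP uu; [rewrite uu|rewrite -uu uS in v'S].
Qed.

Lemma card_boundary S : (\sum_(u in S) #|neighbours H u :\: S| <= #|boundary H S|)%N.
Proof.
pose A := [set p : V * V | (p.1 \in S) && (p.2 \in neighbours H p.1 :\: S)].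
have -> : (\sum_(u in S) #|neighbours H u :\: S| = #|A|)%N.
  rewrite -sum1_card; under eq_bigr do rewrite -sum1_card.
  by rewrite pair_big_dep /=; apply: eq_bigl => p; rewrite [in RHS]inE.
rewrite -(card_in_imset (f := fun p : V * V => [set p.1; p.2]%SET)).
  apply/subset_leq_card/fintype.subsetP => e /imsetP[[u v]] /[!inE] /= /and3P[uS vS uv] ->.
  have := mem_boundary uS vS uv; by rewrite inE.
move=> [u v] [u' v']; rewrite !inE /= => /and3P[uS vS _] /and3P[u'S v'S _].
exact: (set2_inj uS vS u'S v'S).
Qed.

Lemma card_boundary_at S v : v \notin S ->
  (#|neighbours H v :&: S| <= #|[set e in boundary H S | v \in e]|)%N.
Proof.
move=> vS; rewrite -(card_in_imset (f := fun u => [set u; v]%SET)).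
  apply/subset_leq_card/fintype.subsetP => e /imsetP[u]; rewrite inE => /andP[uv uS] ->.
  rewrite inE !inE eqxx orbT andbT; have := mem_boundary uS vS (H := H); rewrite inE; apply.
  by move: uv; rewrite inE finset.setUC.
move=> u u'; rewrite !inE => /andP[_ uS] /andP[_ u'S] e.
by have [] := set2_inj uS vS u'S vS e.
Qed.

(** A vertex of [S] has at most [#|S|] neighbours inside [S]. *)
Lemma boundary_degree (R : realType) (a : R) S :
  (forall v, a <= #|neighbours H v|%:R) ->
  #|S|%:R * (a - #|S|%:R) <= #|boundary H S|%:R.
Proof.
move=> ha; apply: (@le_trans _ _ (\sum_(u in S) #|neighbours H u :\: S|)%:R); last first.
  by rewrite ler_nat card_boundary.
rewrite natr_sum mulrC mulr_natr -sumr_const; apply: ler_sum => u _.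
rewrite lerBlDr; apply: (le_trans (ha u)); rewrite -natrD ler_nat.
by rewrite -(cardsID S) addnC leq_add2l subset_leq_card // finset.subsetIr.
Qed.

End BoundaryCount.

Section UpperBound.
(** Only [eta] is chosen: sets are small up to [eta * alpha * n] vertices, and
    the lower bound on wide cuts is such that crossing the intermediate sizes
    costs no more than a factor exp (eta L) in the Laplace transform. *)
Variables (R : realType) (alpha eta : R) (V : finType) (H : {set {set V}}).
Hypotheses (alpha01 : 0 < alpha < 1) (eta_gt0 : 0 < eta) (eta_le : 16 * eta <= 1).
Let n : R := #|V|%:R.
Let L : R := ln n.
Hypothesis L_gt0 : 0 < L.
Hypothesis gH : is_graph H.
Hypothesis min_degree : forall v, alpha * n <= #|neighbours H v|%:R.
Hypothesis wide_cuts : forall S : {set V},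
  eta * alpha * n <= #|S|%:R <= (1 - eta * alpha) * n ->
  2 * alpha / eta * (n ^+ 2 / L) <= #|boundary H S|%:R.

Lemma n_gt0 : 0 < n.
Proof.
rewrite /n ltr0n lt0n; apply/eqP => e; move: L_gt0.
by rewrite /L /n e ln0 // ltxx.
Qed.

Lemma expL : expR L = n.
Proof. by rewrite /L lnK // posrE n_gt0. Qed.

Lemma L_le : L <= n.
Proof. by rewrite -expL; apply: le_trans (expR_ge1Dx _); rewrite lerDr. Qed.

Let lam : R := (1 - eta) ^+ 2 * (alpha * n).
Let K : nat := Num.truncn ((1 - eta * alpha) * n).
Let r (k : nat) : R := if k%:R <= eta * alpha * n then k%:R * ((1 - eta) * (alpha * n))
  else 2 * alpha / eta * (n ^+ 2 / L).
Let y : R := eta * L / (2 * n).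

Let bounds : [/\ 0 < alpha * n, eta < 1, 0 < n, 0 < (1 - eta) * (alpha * n) & eta * alpha < 1].
Proof.
have [a0 a1] := andP alpha01; have n0 := n_gt0.
have an : 0 < alpha * n by rewrite mulr_gt0.
have e0 := eta_gt0; have e16 := eta_le.
split=> //; first by lra.
  by rewrite mulr_gt0 //; lra.
by have : eta * alpha < eta; [rewrite gtr_pMr|lra].
Qed.

Let K_le k : (k <= K)%N -> k%:R <= (1 - eta * alpha) * n.
Proof.
have [an e1 n0 _ ea] := bounds; have e0 := eta_gt0; have e16 := eta_le; move=> kK; apply: le_trans (_ : K%:R <= _).
  by rewrite ler_nat.
by rewrite /K truncn_le // mulr_ge0 // ?ltW // subr_gt0.
Qed.

Let K_gt k : (K < k)%N -> (1 - eta * alpha) * n < k%:R.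
Proof.
move=> kK; apply: lt_le_trans (truncnS_gt _) _; by rewrite ler_nat.
Qed.

Let lam_gt0 : 0 < lam.
Proof. have [an e1 n0 _ _] := bounds; by rewrite mulr_gt0 // exprn_gt0 // subr_gt0. Qed.

Let mid : alpha * n * (2 / eta) <= 2 * alpha / eta * (n ^+ 2 / L).
Proof.
have [an e1 n0 _ _] := bounds; have Ln := L_le.
have -> : 2 * alpha / eta * (n ^+ 2 / L) = alpha * n * (2 / eta) * (n / L).
  by field; rewrite !lt0r_neq0.
by rewrite ler_peMr ?ler_pdivlMr ?mul1r // mulr_ge0 ?(ltW an) // divr_ge0 // ltW.
Qed.

Let lam_le : lam <= (1 - eta) * (alpha * n).
Proof.
have [an e1 n0 b _] := bounds; have e0 := eta_gt0.
rewrite /lam expr2 -mulrA ger_pMl //; lra.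
Qed.

Let lam_r k : (0 < k <= K)%N -> lam < r k.
Proof.
have [an e1 n0 b _] := bounds; have e0 := eta_gt0; have e16 := eta_le; move=> /andP[k0 kK]; rewrite /r; case: ifP => _.
  apply: (@lt_le_trans _ _ ((1 - eta) * (alpha * n))).
    rewrite /lam expr2 -mulrA gtr_pMl //; lra.
  by rewrite ler_peMl ?ler1n // ltW.
apply: le_lt_trans lam_le _; apply: lt_le_trans mid.
rewrite mulrC ltr_pM2l // (@lt_trans _ _ 1) ?gtrBl // ltr_pdivlMr // mul1r; lra.
Qed.

Let product_ge : eta * expR (- ((1 + eta) * L)) <= \prod_(1 <= l < K.+1) (1 - lam / r l).
Proof.
have [an e1 n0 b _] := bounds; have e0 := eta_gt0; have e16 := eta_le; have [a0 a1] := andP alpha01; have Ln := L_le.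
have y0 : 0 <= y by rewrite divr_ge0 // ?mulr_ge0 // ltW.
have y2 : y <= 1 / 2.
  rewrite ler_pdivrMr ?mulr_gt0 //; have : eta * L <= 1 * n by apply: ler_pM => //; rewrite ltW.
  by lra.
have one_y : expR (- (2 * y)) <= 1 - y.
  rewrite expRN; apply: (@le_trans _ _ (1 + 2 * y)^-1).
    rewrite lef_pV2 ?posrE ?expR_gt0 //; last by lra.
    exact: expR_ge1Dx.
  rewrite -[leLHS]mul1r ler_pdivrMr; last by lra.
  by nra.
have factor l : (1 <= l <= K)%N -> (1 - (1 - eta) / l%:R) * (1 - y) <= 1 - lam / r l.
  move=> /andP[l1 lK]; have l0 : 0 < l%:R :> R by rewrite ltr0n.
  have l1' : 1 <= l%:R :> R by rewrite ler1n.
  have z0 : 0 <= (1 - eta) / l%:R by rewrite divr_ge0 //; lra.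
  have z1 : (1 - eta) / l%:R <= 1 by rewrite ler_pdivrMr // mul1r; lra.
  rewrite /r; case: ifP => _.
    have -> : lam / (l%:R * ((1 - eta) * (alpha * n))) = (1 - eta) / l%:R.
      by rewrite /lam; field; rewrite !lt0r_neq0 // subr_gt0.
    by nra.
  have : lam / (2 * alpha / eta * (n ^+ 2 / L)) <= y.
    have -> : lam / (2 * alpha / eta * (n ^+ 2 / L)) = (1 - eta) ^+ 2 * y.
      by rewrite /lam /y; field; rewrite !lt0r_neq0.
    by rewrite ler_piMl // exprn_ile1 //; lra.
  by nra.
(* Compare with the telescoping product of the [1 - 1 / l] from [l = 2] on. *)
have first k : eta / k.+1%:R <= \prod_(1 <= l < k.+2) (1 - (1 - eta) / l%:R).
  elim: k => [|k IH]; first by rewrite big_nat1 !divr1; lra.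
  rewrite big_nat_recr //=; set p := \prod_(_ <= _ < _) _ in IH *.
  have k1 : 0 < k.+1%:R :> R by rewrite ltr0n.
  have k2 : 0 < k.+2%:R :> R by rewrite ltr0n.
  have kk : k.+2%:R = k.+1%:R + 1 :> R by rewrite -natr1.
  apply: (@le_trans _ _ (eta / k.+1%:R * (1 - 1 / k.+2%:R))).
    rewrite le_eqVlt; apply/orP; left; apply/eqP.
    move: k1 k2 kk; move: (k.+1%:R : R) (k.+2%:R : R) => u v u0 + vE; rewrite vE => v0.
    by field; rewrite !lt0r_neq0.
  apply: ler_pM => //; first by rewrite divr_ge0 // ltW.
    by rewrite subr_ge0 ler_pdivrMr // mul1r ler1n.
  by rewrite lerD2l lerN2 ler_wpM2r ?invr_ge0 ?ler0n //; lra.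
have Kn : K%:R <= n by apply: le_trans (K_le (leqnn K)) _; nra.
apply: (@le_trans _ _ ((\prod_(1 <= l < K.+1) (1 - (1 - eta) / l%:R)) * \prod_(1 <= l < K.+1) (1 - y))); last first.
  rewrite -big_split /= big_nat_cond [leRHS]big_nat_cond.
  apply: ler_prod => l; rewrite andbT ltnS => lK; rewrite factor // andbT.
  have [l1 _] := andP lK.
  have l1' : 1 <= l%:R :> R by rewrite ler1n.
  rewrite mulr_ge0 //; last by lra.
  by rewrite subr_ge0 ler_pdivrMr ?(lt_le_trans ltr01) // mul1r; lra.
have -> : eta * expR (- ((1 + eta) * L)) = eta / n * expR (- (eta * L)).
  by rewrite mulrDl mul1r opprD expRD [expR (- L)]expRN expL mulrA.
apply: ler_pM; rewrite ?expR_ge0 ?divr_ge0 ?(ltW n0) ?(ltW eta_gt0) //.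
  case: K Kn => [_|k kn]; last first.
    have k0 : 0 < k.+1%:R :> R by rewrite ltr0n.
    by apply: le_trans (first k); rewrite ler_pM2l // lef_pV2 ?posrE.
  rewrite big_geq // ler_pdivrMr // mul1r; apply: (@le_trans _ _ 1); first by lra.
  by move: n0; rewrite /n ltr0n ler1n.
rewrite prodr_const_nat subn1 /=.
apply: (@le_trans _ _ (expR (- (2 * y)) ^+ K)); last by rewrite lerXn2r ?nnegrE ?expR_ge0 //; lra.
rewrite -expRM_natl ler_expR mulrN lerN2.
have -> : eta * L = n * (2 * y) by rewrite /y; field; exact: lt0r_neq0.
by rewrite ler_wpM2r // mulr_ge0.
Qed.

(** The factor n ^ (1 + eta) / eta bounds the inverse of the potential at the
    last stage ([product_ge]), and the Laplace parameter is close enough to alpha n for the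
    exponent at time [c * x] to exceed [c]. *)
Lemma not_reached (N D c : nat) (src tgt : V) :
  let x := (1 + 16 * eta) * (L / (alpha * n)) in
  (0 < D)%N -> (c * D <= N)%N -> #|H|%:R * (x / D%:R) <= eta ->
  pr H (expR (- (x / D%:R))) (fun g : {ffun {set V} -> 'I_N.+1} => tgt \notin ball H src g (c * D))
    <= eta^-1 * expR ((1 + eta) * L - c%:R * ((1 + 2 * eta) * L)).
Proof.
move=> x D0 cDN Hx; have [an e1 n0 b _] := bounds; have e0 := eta_gt0; have e16 := eta_le; have [a0 a1] := andP alpha01.
have D0' : 0 < D%:R :> R by rewrite ltr0n.
have x0 : 0 < x by rewrite mulr_gt0 ?divr_gt0 //; lra.
have h0 : 0 < x / D%:R by rewrite divr_gt0.
have e01 : 0 <= eta <= 1 by rewrite !ltW.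
have large (S : {set V}) : src \in S -> (#|S| <= K)%N -> r #|S| <= #|boundary H S|%:R.
  move=> _ SK; rewrite /r; case: ifP => [Se|/negbT]; last first.
    by rewrite -ltNge => Se; apply: wide_cuts; rewrite (ltW Se) K_le.
  apply: le_trans (boundary_degree S min_degree); rewrite ler_wpM2l //.
  by rewrite mulrBl mul1r lerD2l lerN2 mulrA.
have tdeg (S : {set V}) : src \in S -> tgt \notin S -> (K < #|S|)%N ->
    lam <= #|[set e in boundary H S | tgt \in e]|%:R.
  move=> _ tS /K_gt KS; apply: (@le_trans _ _ #|neighbours H tgt :&: S|%:R); last first.
    by rewrite ler_nat card_boundary_at.
  apply: le_trans lam_le _; rewrite mulrBl mul1r lerBlDr.
  apply: le_trans (min_degree tgt) _.
  rewrite -(cardsID S (neighbours H tgt)) natrD lerD2l.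
  apply: (@le_trans _ _ #|~: S|%:R).
    by rewrite ler_nat subset_leq_card // finset.setDE finset.subsetIr.
  have : #|S|%:R + #|~: S|%:R = n :> R by rewrite -natrD cardsC.
  by rewrite -/n; move: KS; lra.
have := first_passage_tail gH h0 e01 Hx lam_gt0 lam_r large tdeg cDN.
set p := pr _ _ _ => tail.
have p0 : 0 <= p.
  apply: pr_ge0; apply/andP; split; first exact: expR_ge0.
  by rewrite -[leRHS]expR0 ler_expR oppr_le0; exact: ltW.
have {}tail := le_trans (ler_wpM2l p0 product_ge) tail.
have -> : eta^-1 * expR ((1 + eta) * L - c%:R * ((1 + 2 * eta) * L)) =
   expR (- (c%:R * ((1 + 2 * eta) * L))) / (eta * expR (- ((1 + eta) * L))).
  by rewrite invfM -expRN opprK expRD; ring.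
rewrite ler_pdivlMr ?mulr_gt0 ?expR_gt0 //; apply: (le_trans tail).
rewrite ler_expR lerN2.
have -> : (1 - eta) * lam * (x / D%:R * (c * D)%:R) = c%:R * ((1 - eta) ^+ 3 * (1 + 16 * eta) * L).
  by rewrite /lam /x natrM; field; rewrite !lt0r_neq0.
rewrite ler_wpM2l // ler_wpM2r ?(ltW L_gt0) //.
(* The three losses of a factor [1 - eta] are absorbed by [1 + 16 * eta]. *)
apply: (@le_trans _ _ ((1 - 3 * eta) * (1 + 16 * eta))); first by nra.
rewrite ler_wpM2r //; first by lra.
by nra.
Qed.

End UpperBound.

(** * Lower bounds for distances in a nearly regular graph *)

Lemma expRN_ge (R : realType) (x : R) : 1 - x <= expR (- x).
Proof. exact: expR_ge1Dx. Qed.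

Lemma expRN_le (R : realType) (x : R) : 0 <= x -> expR (- x) <= (1 + x)^-1.
Proof.
move=> x0; rewrite expRN lef_pV2 ?posrE ?expR_gt0 //; last by lra.
exact: expR_ge1Dx.
Qed.

Section LowerBound.
Variables (R : realType) (alpha eta : R) (V : finType) (H : {set {set V}}).
Hypotheses (alpha01 : 0 < alpha < 1) (eta_gt0 : 0 < eta) (eta_le : 16 * eta <= 1).
Let n : R := #|V|%:R.
Let L : R := ln n.
Hypotheses (L_gt0 : 0 < L) (L_large : 8 / alpha <= L).
Hypothesis gH : is_graph H.
Hypothesis max_degree : forall v, #|neighbours H v|%:R <= (1 + eta) * alpha * n.

Let x : R := (1 - 16 * eta) * (L / (alpha * n)).
Let Delta : R := (1 + eta) * alpha * n.
(** Slightly more than the maximal degree, so that the sum over walks converges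
    geometrically. *)
Let lam : R := (1 + eta) * Delta.

Variables (N D : nat).
Hypotheses (D_gt0 : (0 < D)%N) (DN : (3 * D <= N)%N) (x_gt0 : 0 < x).
Hypothesis D_large : (1 + lam) * (x / D%:R) <= eta / 2.

Let h := x / D%:R.
Let q := expR (- h).
Let rho := expR (- (lam * h)).
Let kappa := (1 + eta / 2) / (1 + eta).

Let A_B : R := 12 / alpha + 2 / (alpha * eta ^+ 2).
Definition lower_const : R := 4 * (1 / eta + 8 / alpha) + 4 * (1 / eta + 2 * (12 / alpha + 2 / (alpha * eta ^+ 2))).

Let nE : expR L = n. Proof. exact: expL. Qed.
Let n_pos : 0 < n. Proof. exact: n_gt0. Qed.

Let basics : [/\ 0 < alpha, 0 < eta, 16 * eta <= 1, 0 < L & 0 < n].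
Proof. by have [a0 _] := andP alpha01. Qed.

Let D_pos : 0 < D%:R :> R. Proof. by rewrite ltr0n. Qed.
Let h_gt0 : 0 < h. Proof. by rewrite divr_gt0. Qed.
Let hD : h * D%:R = x. Proof. by rewrite /h divfK // lt0r_neq0. Qed.

Let Delta_gt0 : 0 < Delta.
Proof. by have [a0 e0 e1 L0 n0] := basics; rewrite !mulr_gt0 //; lra. Qed.

Let lam_gt0 : 0 < lam.
Proof. by have [a0 e0 e1 L0 n0] := basics; rewrite mulr_gt0 //; lra. Qed.

Let q01 : 0 < q <= 1.
Proof. by rewrite expR_gt0 /= -[leRHS]expR0 ler_expR oppr_le0; exact: ltW. Qed.

Let rho01 : 0 < rho <= 1.
Proof.
rewrite expR_gt0 /= -[leRHS]expR0 ler_expR oppr_le0; apply: mulr_ge0; exact: ltW.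
Qed.

Let qrho : q * rho = expR (- ((1 + lam) * h)).
Proof. by rewrite /q /rho -expRD; congr expR; ring. Qed.

Let lh_gt0 : 0 < (1 + lam) * h.
Proof. by rewrite mulr_gt0 // ltr_pwDl // ltW. Qed.

Let qrho1 : q * rho < 1.
Proof. by rewrite qrho -[ltRHS]expR0 ltr_expR oppr_lt0. Qed.

Let kappa1 : kappa < 1.
Proof. by have [a0 e0 e1 L0 n0] := basics; rewrite ltr_pdivrMr; lra. Qed.

Let Delta_theta : Delta * ((1 - q) / (1 - q * rho)) <= kappa.
Proof.
have [a0 e0 e1 L0 n0] := basics; have lh := lh_gt0; have Dl : (1 + lam) * h <= eta / 2 by exact: D_large.
have d0 : 0 < 1 - q * rho by rewrite subr_gt0.
have d1 : (1 + lam) * h / (1 + (1 + lam) * h) <= 1 - q * rho.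
  rewrite qrho; set z := (1 + lam) * h in lh Dl *.
  have -> : z / (1 + z) = 1 - (1 + z)^-1 by field; lra.
  by rewrite lerD2l lerN2 expRN_le // ltW.
have q1 : 1 - q <= h by rewrite lerBlDr -lerBlDl; exact: expRN_ge.
have lD : lam = (1 + eta) * Delta by [].
rewrite mulrA ler_pdivrMr //; apply: le_trans (ler_wpM2l _ d1); last first.
  by rewrite divr_ge0 //; lra.
apply: (@le_trans _ _ (Delta * h)); first by rewrite ler_pM2l.
have [dl hl] : 0 < Delta /\ 0 < h by split.
set z := (1 + lam) * h in lh Dl *.
rewrite (_ : kappa * (z / (1 + z)) = (1 + eta / 2) * z / ((1 + eta) * (1 + z))); last first.
  by rewrite /kappa; field; apply/andP; split; apply: lt0r_neq0; lra.
rewrite ler_pdivlMr; last by rewrite mulr_gt0 //; lra.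
have -> : Delta * h * ((1 + eta) * (1 + z)) = (lam * h) * (1 + z) by rewrite lD; ring.
have zE : lam * h <= z by rewrite /z; lra.
have lh0 : 0 <= lam * h by apply: mulr_ge0; exact: ltW.
apply: (@le_trans _ _ (z * (1 + z))); first by rewrite ler_wpM2r //; lra.
by rewrite mulrC ler_wpM2r //; lra.
Qed.

Let q_pow k : q ^+ (k * D) = expR (- (k%:R * x)).
Proof. by rewrite /q -expRM_natl natrM -hD; congr expR; ring. Qed.

(** From exp L = (exp (L / 2)) ^ 2; it makes all error terms of order 1 / L. *)
Let L_n : L / n <= 4 / L.
Proof.
have [a0 e0 e1 L0 n0] := basics.
rewrite ler_pdivrMr // mulrAC ler_pdivlMr //.
have -> : n = expR (L / 2) * expR (L / 2) by rewrite -expRD -nE; congr expR; lra.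
have le : 1 + L / 2 <= expR (L / 2) by exact: expR_ge1Dx.
apply: (@le_trans _ _ (4 * ((1 + L / 2) * (1 + L / 2)))); first by nra.
by rewrite ler_pM2l // ler_pM //; lra.
Qed.

Let x_le : x <= 4 / alpha / L.
Proof.
have [a0 e0 e1 L0 n0] := basics; apply: (@le_trans _ _ (L / n / alpha)).
  rewrite (_ : L / n / alpha = 1 * (L / (alpha * n))); last by field; rewrite !lt0r_neq0.
  by rewrite ler_wpM2r ?divr_ge0 ?mulr_ge0 ?(ltW L0) ?(ltW a0) ?(ltW n0) //; lra.
rewrite (_ : 4 / alpha / L = 4 / L / alpha); last by field; rewrite !lt0r_neq0.
by rewrite ler_wpM2r // invr_ge0 ltW.
Qed.

Let x_half : x <= 1 / 2.
Proof.
have [a0 e0 e1 L0 n0] := basics; apply: (le_trans x_le); rewrite ler_pdivrMr //.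
by have := L_large; lra.
Qed.

Let u_le : expR (- (2 * eta * L)) <= 1 / eta / L.
Proof.
have [a0 e0 e1 L0 n0] := basics; have eL : 0 < eta * L by rewrite mulr_gt0.
apply: (le_trans (expRN_le _)); first by rewrite -mulrA; lra.
rewrite (_ : 1 / eta / L = (eta * L)^-1); last by rewrite invfM mul1r.
by rewrite lef_pV2 ?posrE //; rewrite -mulrA; lra.
Qed.

Let B_le : (1 - q ^+ (3 * D)) + (rho ^+ D)^-1 / (Delta * (1 - kappa)) <= A_B / L.
Proof.
have [a0 e0 e1 L0 n0] := basics; rewrite /A_B mulrDl; apply: lerD.
  rewrite q_pow; have := expRN_ge (3 * x); have := x_le.
  rewrite (_ : 12 / alpha / L = 3 * (4 / alpha / L)); first by lra.
  by field; rewrite !lt0r_neq0.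
have -> : (rho ^+ D)^-1 = expR (lam * x).
  by rewrite /rho -expRM_natl -expRN -hD; congr expR; ring.
have -> : Delta * (1 - kappa) = alpha * n * eta / 2.
  by rewrite /Delta /kappa; field; lra.
have lx : expR (lam * x) <= n * expR (- (2 * eta * L)).
  rewrite -nE -expRD ler_expR.
  have -> : lam * x = (1 + eta) ^+ 2 * (1 - 16 * eta) * L.
    by rewrite /lam /Delta /x; field; rewrite !lt0r_neq0.
  rewrite (_ : L - 2 * eta * L = (1 - 2 * eta) * L); last by ring.
  rewrite ler_wpM2r ?(ltW L0) //.
  apply: (@le_trans _ _ ((1 + 3 * eta) * (1 - 16 * eta))); last by nra.
  by rewrite ler_wpM2r //; [lra|nra].
have d0 : 0 < alpha * n * eta / 2 by rewrite divr_gt0 // !mulr_gt0.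
rewrite ler_pdivrMr //; apply: (le_trans lx).
rewrite (_ : 2 / (alpha * eta ^+ 2) / L * (alpha * n * eta / 2) = n * (1 / eta / L)); last first.
  by field; rewrite !lt0r_neq0.
by rewrite ler_pM2l.
Qed.

Let A_B_ge0 : 0 <= A_B.
Proof.
have [a0 e0 e1 L0 n0] := basics.
by rewrite addr_ge0 ?divr_ge0 ?mulr_ge0 ?exprn_ge0 // ltW.
Qed.

Let mu := \sum_v pr H q (slow H v D : pred {ffun {set V} -> 'I_N.+1}).

Let mu_ge : expR (2 * eta * L) <= mu.
Proof.
have [a0 e0 e1 L0 n0] := basics.
apply: (@le_trans _ _ (\sum_(v : V) expR (- (x * Delta)))).
  have -> : \sum_(v : V) expR (- (x * Delta)) = n * expR (- (x * Delta)).
    by rewrite sumr_const mulr_natl.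
  rewrite -nE -expRD ler_expR.
  have -> : x * Delta = (1 + eta) * (1 - 16 * eta) * L.
    by rewrite /x /Delta; field; rewrite !lt0r_neq0.
  rewrite (_ : L - _ = (1 - (1 + eta) * (1 - 16 * eta)) * L); last by ring.
  by rewrite ler_wpM2r ?(ltW L0) //; nra.
apply: ler_sum => v _.
have DN1 : (D <= N)%N by rewrite (leq_trans _ DN) // leq_pmull.
have [q0 q1] := andP q01.
have q01' : 0 <= q <= 1 by rewrite (ltW q0).
rewrite (pr_slow _ _ v DN1) // mulnC q_pow ler_expR lerN2 mulrC ler_wpM2l ?(ltW x_gt0) //.
by apply: le_trans (max_degree v); rewrite ler_nat; exact: degree_neighbours.
Qed.

Let mu_gt0 : 0 < mu.
Proof. exact: lt_le_trans (expR_gt0 _) mu_ge. Qed.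

Let mu_inv : mu^-1 <= 1 / eta / L.
Proof.
apply: le_trans u_le; rewrite expRN lef_pV2 ?posrE ?expR_gt0 //.
Qed.

Let q_inv : (q ^+ D)^-1 <= 1 + 2 * x.
Proof.
have x0 := x_gt0; have x2 := x_half.
rewrite -[D]mul1n q_pow mul1r expRN invrK -[leRHS]invrK -[expR x]invrK -expRN lef_pV2 ?posrE ?expR_gt0 ?invr_gt0 //; last by lra.
apply: le_trans (expRN_ge x); rewrite -[leLHS]mul1r ler_pdivrMr; last by lra.
by nra.
Qed.

Lemma pr_short_small i j : i != j ->
  pr H q (fun g : {ffun {set V} -> 'I_N.+1} => short H i j D g) <= lower_const / L.
Proof.
have [a0 e0 e1 L0 n0] := basics => ij.
apply: le_trans (pr_short q01 rho01 qrho1 max_degree Delta_gt0 kappa1 Delta_theta DN ij) _.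
apply: (le_trans B_le); rewrite ler_wpM2r ?invr_ge0 ?(ltW L0) // /lower_const -/A_B.
have : 0 <= 1 / eta by rewrite divr_ge0 // ltW.
have : 0 <= 8 / alpha by rewrite divr_ge0 // ltW.
by have := A_B_ge0; lra.
Qed.

Let concentration : mu^-1 + (q ^+ D)^-1 - 1 <= (1 / eta + 8 / alpha) / L.
Proof.
have [a0 e0 e1 L0 n0] := basics; have xl := x_le; have qi := q_inv; have mi := mu_inv.
have -> : (1 / eta + 8 / alpha) / L = 1 / eta / L + 2 * (4 / alpha / L).
  by field; rewrite !lt0r_neq0.
by lra.
Qed.

Let lower_constE : lower_const / L =
  4 * ((1 / eta + 8 / alpha) / L) + 4 * (1 / eta / L + 2 * (A_B / L)).
Proof. by rewrite /lower_const /A_B; ring. Qed.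

Let AL_ge0 : 0 <= A_B / L.
Proof. by rewrite divr_ge0 ?A_B_ge0 // ltW. Qed.

Let eL_ge0 : 0 <= 1 / eta / L.
Proof. by have [a0 e0 e1 L0 n0] := basics; rewrite !divr_ge0 // ltW. Qed.

Lemma pr_far_from_small i :
  pr H q (fun g : {ffun {set V} -> 'I_N.+1} => [forall j, slow H j D g ==> short H i j (2 * D) g]) <=
  lower_const / L.
Proof.
apply: le_trans (pr_far_from gH q01 rho01 qrho1 max_degree Delta_gt0 kappa1 Delta_theta DN mu_gt0 i) _.
rewrite lower_constE -/mu; apply: lerD; first by rewrite ler_pM2l // concentration.
have al := AL_ge0; have el := eL_ge0.
apply: (@le_trans _ _ (2 * (1 / eta / L + A_B / L))); last by lra.
by rewrite ler_pM2l // lerD ?mu_inv.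
Qed.

Lemma pr_far_pair_small :
  pr H q (fun g : {ffun {set V} -> 'I_N.+1} => [forall i, forall j, (slow H i D g && slow H j D g) ==>
                     short H i j (3 * D) g]) <=
  lower_const / L.
Proof.
apply: le_trans (pr_far_pair gH q01 rho01 qrho1 max_degree Delta_gt0 kappa1 Delta_theta DN mu_gt0) _.
rewrite lower_constE -/mu; apply: lerD; first by rewrite ler_pM2l // concentration.
rewrite ler_pM2l //; apply: lerD; first exact: mu_inv.
have [q0 q1] := andP q01.
have q2 : (q ^+ D)^-1 <= 2 by apply: (le_trans q_inv); have := x_half; lra.
apply: (@le_trans _ _ (A_B / L * (q ^+ D)^-1)).
  by rewrite ler_wpM2r // invr_ge0 exprn_ge0 // ltW.
by rewrite mulrC ler_wpM2r.
Qed.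

End LowerBound.

(** * Concentration of distances in a fixed graph *)

Section RelativeError.
Local Open Scope classical_set_scope.
Local Open Scope ring_scope.
Variables (R : realType) (d : measure_display) (T : measurableType d) (P : probability T R).
Variables (C : set T) (Y : T -> \bar R) (b delta : R).
Hypotheses (mC : measurable C) (mY : measurable_fun setT Y) (b_gt0 : 0 < b).

Lemma measurable_relative_error :
  measurable [set w | (`|Y w * (b^-1)%:E - 1| <= delta%:E)%E].
Proof.
have mf : measurable_fun setT (fun w => `|Y w * (b^-1)%:E - 1|%E).
  apply: measurableT_comp => //; apply: emeasurable_funB; last exact: measurable_cst.
  by apply: emeasurable_funM => //; exact: measurable_cst.
by have := emeasurable_fun_infty_c measurableT mf delta%:E; rewrite setTI.
Qed.

Let relative_error (y : \bar R) : ((b * (1 - delta))%:E <= y)%E -> (y <= (b * (1 + delta))%:E)%E ->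
  (`|y * (b^-1)%:E - 1| <= delta%:E)%E.
Proof.
case: y => [r| |]; rewrite ?leye_eq ?leeNy_eq //= !lee_fin => lo up.
rewrite ler_norml; apply/andP; split.
  rewrite lerBrDr -[leLHS](mulfK (lt0r_neq0 b_gt0)) ler_pM2r ?invr_gt0 //; lra.
rewrite lerBlDr -[leRHS](mulfK (lt0r_neq0 b_gt0)) ler_pM2r ?invr_gt0 //; lra.
Qed.

Lemma relative_error_fails (be1 be2 : R) : 0 <= be1 -> 0 <= be2 ->
  (P (C `&` ~` [set w | Y w <= (b * (1 + delta))%:E]) <= P C * be1%:E)%E ->
  (P (C `&` ~` [set w | (b * (1 - delta))%:E <= Y w]) <= P C * be2%:E)%E ->
  (P (C `&` ~` [set w | `|Y w * (b^-1)%:E - 1| <= delta%:E]) <= P C * (be1 + be2)%:E)%E.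
Proof.
move=> be10 be20 up lo; rewrite EFinD ge0_muleDr ?lee_fin //.
apply: le_trans (leeD up lo).
have m1 : measurable (C `&` ~` [set w | Y w <= (b * (1 + delta))%:E]%E).
  apply: measurableI => //; apply: measurableC.
  by have := emeasurable_fun_infty_c measurableT mY (b * (1 + delta))%:E; rewrite setTI.
have m2 : measurable (C `&` ~` [set w | (b * (1 - delta))%:E <= Y w]%E).
  apply: measurableI => //; apply: measurableC.
  by have := emeasurable_fun_c_infty measurableT mY (b * (1 - delta))%:E; rewrite setTI.
apply: le_trans (measureU2 P m1 m2); apply: le_measure; rewrite ?inE.
- by apply: measurableI => //; apply: measurableC; exact: measurable_relative_error.
- exact: measurableU.
move=> w [Cw nw]; have [up'|nup] := pselect (Y w <= (b * (1 + delta))%:E)%E; last by left.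
right; split=> // lo'; apply: nw; exact: relative_error.
Qed.

End RelativeError.

Section FixedGraph.
Local Open Scope classical_set_scope.
Local Open Scope ring_scope.
Variables (R : realType) (alpha eta : R) (V : finType) (H : {set {set V}}).
Hypotheses (alpha01 : 0 < alpha < 1) (eta_gt0 : 0 < eta) (eta_lt : 16 * eta < 1).
Let n : R := #|V|%:R.
Let L : R := ln n.
Hypotheses (L_gt0 : 0 < L) (L_large : 8 / alpha <= L).
Hypothesis gH : is_graph H.
Hypothesis min_degree : forall v, alpha * n <= #|neighbours H v|%:R.
Hypothesis max_degree : forall v, #|neighbours H v|%:R <= (1 + eta) * alpha * n.
Hypothesis wide_cuts : forall S : {set V},
  eta * alpha * n <= #|S|%:R <= (1 - eta * alpha) * n ->
  2 * alpha / eta * (n ^+ 2 / L) <= #|boundary H S|%:R.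
Variables (d : measure_display) (T : measurableType d) (P : probability T R).
Variables (C : set T) (X : {set V} -> {RV P >-> R}).
Hypotheses (mC : measurable C) (iidX : iid_exp1_given C H X).

Let scale : R := L / (alpha * n).
Let D_ w i j : \bar R := dist H (fun e => X e w) i j.

Let eta_le : 16 * eta <= 1. Proof. exact: ltW. Qed.

Let n_pos : 0 < n. Proof. exact: n_gt0. Qed.

Let scale_gt0 : 0 < scale.
Proof. by have [a0 _] := andP alpha01; rewrite divr_gt0 ?mulr_gt0. Qed.

(** The mesh is chosen after the graph, hence as fine as the graph requires. *)
Let mesh (M x e : R) : 0 <= M -> 0 < x -> 0 < e -> exists2 D, (0 < D)%N & M * (x / D%:R) <= e.
Proof.
move=> M0 x0 e0; exists (Num.truncn (M * x / e)).+1 => //.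
rewrite mulrA ler_pdivrMr ?ltr0n // -ler_pdivrMl // mulrC ltW //.
exact: truncnS_gt.
Qed.

(** The list [s] has 1, n or n ^ 2 pairs for [c = 1, 2, 3]: the union bound just
    compensates the decay of [not_reached] in [c]. *)
Let upper (c : nat) (s : seq (V * V)) (Ev : set T) : (0 < c)%N ->
  (size s)%:R <= expR ((c%:R - 1) * L) -> measurable Ev ->
  (forall w, (forall p, p \in s -> (D_ w p.1 p.2 <= (c%:R * ((1 + 16 * eta) * scale))%:E)%E) -> Ev w) ->
  (P (C `&` ~` Ev) <= P C * (eta^-1 * expR (- (eta * L)))%:E)%E.
Proof.
move=> c0 sz mEv sub.
have x0 : 0 < (1 + 16 * eta) * scale by rewrite mulr_gt0 //; have := eta_gt0; lra.
have [D D0 HD] := mesh (ler0n R #|H|) x0 eta_gt0.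
set x := (1 + 16 * eta) * scale in x0 HD sub; set N := (c * D)%N.
have h0 : 0 < x / D%:R by rewrite divr_gt0 // ltr0n.
pose good (g : {ffun {set V} -> 'I_N.+1}) := all (fun p => p.2 \in ball H p.1 g (c * D)) s.
apply: (discretize mC iidX h0 mEv (good := good)).
  move=> g /allP gg w cw; apply: sub => p /gg pb.
  have -> : c%:R * x = x / D%:R * (c * D)%:R.
    by rewrite natrM; field; rewrite lt0r_neq0 // ltr0n.
  apply: (@dist_ball _ _ _ N p.1 g) => //; first exact: ltW.
  by move=> e eH gN; apply: (cell_le gN); exact: cw.
have q01 : 0 <= expR (- (x / D%:R)) <= 1.
  by rewrite expR_ge0 /= -[leRHS]expR0 ler_expR oppr_le0; exact: ltW.
apply: (@le_trans _ _ (\sum_(p <- s) eta^-1 * expR ((1 + eta) * L - c%:R * ((1 + 2 * eta) * L)))).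
  apply: le_trans (ler_sum _ (fun p _ => not_reached alpha01 eta_gt0 eta_le L_gt0 gH min_degree
     wide_cuts p.1 p.2 D0 (leqnn N) HD)).
  apply: pr_union => // g; rewrite /good -has_predC => /hasP[p ps h]; by apply/hasP; exists p.
rewrite big_const_seq count_predT iter_addr_0 -[leLHS]mulr_natl [leLHS]mulrCA ler_pM2l ?invr_gt0 //.
apply: (le_trans (ler_wpM2r (expR_ge0 _) sz)); rewrite -expRD ler_expR.
have c1 : 1 <= c%:R :> R by rewrite ler1n.
have : eta * L <= c%:R * (eta * L) by rewrite ler_peMl // mulr_ge0 // ltW.
have e0 := eta_gt0; lra.
Qed.

Let not_short N (g : {ffun {set V} -> 'I_N.+1}) (h : R) (t : nat) (w : T) i j : 0 < h ->
  (forall e, e \in H -> cell h (g e) (X e w)) -> ~~ short H i j t g ->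
  ((h * t%:R)%:E <= D_ w i j)%E.
Proof.
move=> h0 cw ns; apply: le_ereal_inf_tmp => _ [p pP <-].
have sp : simple H i j p by apply/simpleP.
rewrite lee_fin path_length_edges.
apply: (@le_trans _ _ (h * (\sum_(e <- edges i p) g e)%:R)).
  rewrite ler_wpM2l ?(ltW h0) // ler_nat leqNgt; apply: contraNN ns; exact: shortP.
rewrite natr_sum mulr_sumr big_seq [leRHS]big_seq; apply: ler_sum => e ep.
apply: (cell_ge h0); apply: cw; case/and3P: sp => pp _ _; exact: edges_sub ep.
Qed.

Let x : R := (1 - 16 * eta) * scale.

Let x_gt0 : 0 < x.
Proof. by rewrite mulr_gt0 // subr_gt0. Qed.

Let lower (Ev : set T) (good : forall D N, pred {ffun {set V} -> 'I_N.+1}) : measurable Ev ->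
  (forall D N, (0 < D)%N -> (3 * D <= N)%N ->
     (1 + (1 + eta) * ((1 + eta) * alpha * n)) * (x / D%:R) <= eta / 2 ->
     pr H (expR (- (x / D%:R))) (fun g : {ffun {set V} -> 'I_N.+1} => ~~ good D N g) <= lower_const alpha eta / L) ->
  (forall (D N : nat) (g : {ffun {set V} -> 'I_N.+1}) w,
     (forall i j c, ~~ short H i j (c * D) g -> ((c%:R * x)%:E <= D_ w i j)%E) -> good D N g -> Ev w) ->
  (P (C `&` ~` Ev) <= P C * (lower_const alpha eta / L)%:E)%E.
Proof.
move=> mEv bad sub; have [a0 _] := andP alpha01.
have M0 : 0 <= 1 + (1 + eta) * ((1 + eta) * alpha * n).
  have e1 : 0 <= 1 + eta by have := eta_gt0; lra.
  by rewrite addr_ge0 // !mulr_ge0 // ltW.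
have e2 : 0 < eta / 2 by rewrite divr_gt0.
have [D D0 HD] := mesh M0 x_gt0 e2.
have D0' : 0 < D%:R :> R by rewrite ltr0n.
have h0 : 0 < x / D%:R by rewrite divr_gt0.
apply: (discretize mC iidX h0 mEv (good := good D (3 * D)%N)); last exact: bad.
move=> g gg w cw; apply: sub gg => i j c /(not_short h0 cw).
by rewrite natrM [c%:R * D%:R]mulrC mulrA divfK ?lt0r_neq0 // mulrC.
Qed.

Definition error_bound : R := eta^-1 * expR (- (eta * L)) + lower_const alpha eta / L.

Let up_ge0 : 0 <= eta^-1 * expR (- (eta * L)).
Proof. by rewrite mulr_ge0 ?invr_ge0 ?expR_ge0 // ltW. Qed.

Let lo_ge0 : 0 <= lower_const alpha eta / L.
Proof.
have [a0 _] := andP alpha01; have e0 := eta_gt0.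
by rewrite /lower_const divr_ge0 ?(ltW L_gt0) // !(addr_ge0, mulr_ge0, invr_ge0, divr_ge0, exprn_ge0) // ?ltW.
Qed.

Lemma error_bound_ge0 : 0 <= error_bound.
Proof. exact: addr_ge0. Qed.

Let mset_le (Y : T -> \bar R) (c : \bar R) : measurable_fun setT Y -> measurable [set w | Y w <= c]%E.
Proof. by move=> mY; have := emeasurable_fun_infty_c measurableT mY c; rewrite setTI. Qed.

Let mset_ge (Y : T -> \bar R) (c : \bar R) : measurable_fun setT Y -> measurable [set w | c <= Y w]%E.
Proof. by move=> mY; have := emeasurable_fun_c_infty measurableT mY c; rewrite setTI. Qed.

Lemma dist_concentrated i j : i != j ->
  (P (C `&` ~` [set w | `|dist H (fun e => X e w) i j * (scale^-1)%:E - 1| <= (16 * eta)%:E])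
    <= P C * error_bound%:E)%E.
Proof.
move=> ij; have mY := measurable_dist H X i j.
apply: relative_error_fails => //.
  apply: (@upper 1 [:: (i, j)]) => //; first by rewrite subrr mul0r expR0.
    exact: mset_le.
  by move=> w /(_ (i, j)); rewrite inE eqxx mul1r mulrC => /(_ isT).
apply: (@lower _ (fun D N g => ~~ short H i j D g)); first exact: mset_ge.
  move=> D N D0 DN HD.
  rewrite (@eq_pr _ _ _ _ _ _ (fun g : {ffun {set V} -> 'I_N.+1} => short H i j D g)); last by move=> g; rewrite negbK.
  exact: (pr_short_small alpha01 eta_gt0 eta_le L_gt0 max_degree D0 DN x_gt0 HD ij).
move=> D N g w sh; have := sh i j 1%N; rewrite mul1n mul1r => h /h /=.
by rewrite mulrC.
Qed.

Lemma max_dist_from_concentrated i :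
  (P (C `&` ~` [set w | `|max_dist_from H (fun e => X e w) i * ((2 * scale)^-1)%:E - 1| <= (16 * eta)%:E])
    <= P C * error_bound%:E)%E.
Proof.
have mY := measurable_max_dist_from H X i.
apply: relative_error_fails => //; first by rewrite mulr_gt0.
  apply: (@upper 2 [seq (i, j) | j <- enum V]) => //.
  - by rewrite size_map -cardE (_ : 2 - 1 = 1) ?mul1r ?expL //; lra.
  - exact: mset_le.
  move=> w h; rewrite /= /max_dist_from; elim/big_ind: _ => [|y z hy hz|j _]; first exact: leNye.
    by rewrite ge_max hy hz.
  have := h (i, j); rewrite mulrCA mulrA mulrC => le; rewrite mulrC.
  apply: (le_trans (le _)); first by apply: map_f; rewrite mem_enum.
  rewrite lee_fin le_eqVlt; apply/orP; left; apply/eqP; ring.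
apply: (@lower _ (fun D N g => [exists j, slow H j D g && ~~ short H i j (2 * D) g])); first exact: mset_ge.
  move=> D N D0 DN HD.
  rewrite (@eq_pr _ _ _ _ _ _ (fun g : {ffun {set V} -> 'I_N.+1} => [forall j, slow H j D g ==> short H i j (2 * D) g])).
    exact: (pr_far_from_small alpha01 eta_gt0 eta_le L_gt0 L_large gH max_degree D0 DN x_gt0 HD).
  move=> g; rewrite negb_exists; apply: eq_forallb => j; by rewrite negb_and negbK implybE.
move=> D N g w sh /existsP[j /andP[_ /sh le]] /=.
rewrite /max_dist_from (bigD1 j) //= le_max; apply/orP; left.
rewrite (_ : 2 * scale * (1 - 16 * eta) = 2%:R * x) //; by rewrite /x; ring.
Qed.

Lemma max_dist_concentrated :
  (P (C `&` ~` [set w | `|max_dist H (fun e => X e w) * ((3 * scale)^-1)%:E - 1| <= (16 * eta)%:E])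
    <= P C * error_bound%:E)%E.
Proof.
have mY := measurable_max_dist H X.
apply: relative_error_fails => //; first by rewrite mulr_gt0.
  apply: (@upper 3 (enum {: V * V})) => //.
  - rewrite -cardE card_prod natrM (_ : (3 - 1) * L = L + L) ?expRD ?expL //; lra.
  - exact: mset_le.
  move=> w h; rewrite /= /max_dist; elim/big_ind: _ => [|y z hy hz|i _]; first exact: leNye.
    by rewrite ge_max hy hz.
  elim/big_ind: _ => [|y z hy hz|j _]; first exact: leNye.
    by rewrite ge_max hy hz.
  apply: (le_trans (h (i, j) _)); first by rewrite mem_enum.
  rewrite lee_fin le_eqVlt; apply/orP; left; apply/eqP; ring.
apply: (@lower _ (fun D N g => [exists i, exists j, (slow H i D g && slow H j D g) && ~~ short H i j (3 * D) g]));
  first exact: mset_ge.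
  move=> D N D0 DN HD.
  rewrite (@eq_pr _ _ _ _ _ _ (fun g : {ffun {set V} -> 'I_N.+1} => [forall i, forall j, (slow H i D g && slow H j D g) ==> short H i j (3 * D) g])).
    exact: (pr_far_pair_small alpha01 eta_gt0 eta_le L_gt0 L_large gH max_degree D0 DN x_gt0 HD).
  move=> g; rewrite negb_exists; apply: eq_forallb => i; rewrite negb_exists.
  by apply: eq_forallb => j; rewrite negb_and negbK implybE.
move=> D N g w sh /existsP[i /existsP[j /andP[_ /sh le]]] /=.
rewrite /max_dist (bigD1 i) //= le_max; apply/orP; left.
rewrite (bigD1 j) //= le_max; apply/orP; left.
rewrite (_ : 3 * scale * (1 - 16 * eta) = 3%:R * x) //; by rewrite /x; ring.
Qed.

End FixedGraph.

(** * Graphs all of whose cuts are wide *)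

Section Complement.
Variables (V : finType).
Implicit Types (H : {set {set V}}) (S : {set V}) (u v : V).

(** An edge meets [S] in one vertex iff it meets the complement in one. *)
Lemma boundary_setC H S : is_graph H -> boundary H (~: S) = boundary H S.
Proof.
move=> gH; apply/finset.setP => e; rewrite !inE; case: (boolP (e \in H)) => //= eH.
have /[!inE] /eqP e2 := fintype.subsetP gH e eH.
have := cardsID S e; rewrite e2 -finset.setDE => h.
by apply/eqP/eqP; move: h; case: #|_ :&: _| => [|[|[|k]]] //= ; case: #|_ :\: _| => [|[|[|l]]].
Qed.

Lemma neighbours_degree H v : is_graph H -> (#|neighbours H v| <= degree H v)%N.
Proof.
move=> gH; have vS : v \notin [set~ v]%SET by rewrite !inE eqxx.
have := card_boundary_at H vS; rewrite (finset.setIidPl _).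
  move=> /leq_trans; apply; apply/subset_leq_card/fintype.subsetP => e.
  by rewrite !inE => /andP[/andP[-> _] ->].
apply/fintype.subsetP => w; rewrite !inE => vw; apply: contraTneq vw => ->.
by apply/negP => /(fintype.subsetP gH); rewrite inE finset.setUid cards1.
Qed.

Lemma handshake H : is_graph H -> (\sum_v degree H v = 2 * #|H|)%N.
Proof.
move=> gH; transitivity (\sum_v \sum_(e in H) (v \in e : nat))%N.
  apply: eq_bigr => v _; rewrite /degree -sum1_card big_mkcond [RHS]big_mkcond /=.
  by apply: eq_bigr => e _; rewrite inE; case: (e \in H).
rewrite exchange_big /= (eq_bigr (fun _ => 2%N)) ?sum_nat_const 1?mulnC // => e eH.
have /[!inE] /eqP <- := fintype.subsetP gH e eH.
by rewrite -sum1_card [RHS]big_mkcond.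
Qed.

Lemma neighbours_setU H H' v : neighbours (H :|: H') v = neighbours H v :|: neighbours H' v.
Proof. by apply/finset.setP => w; rewrite !inE. Qed.

Lemma neighbours_complete v : neighbours (vertex_pairs V) v = [set~ v]%SET.
Proof.
by apply/finset.setP => w; rewrite !inE cards2 [v == w]eq_sym; case: (w == v).
Qed.

End Complement.

Section DenseCuts.
Variables (R : realType) (alpha eta : R) (V : finType) (H : {set {set V}}).
Hypotheses (alpha01 : 1 / 2 < alpha < 1) (eta_gt0 : 0 < eta).
Let n : R := #|V|%:R.
Let L : R := ln n.
Hypotheses (L_gt0 : 0 < L) (L_large : 2 / (eta ^+ 2 * (alpha - 1 / 2)) <= L).
Hypothesis gH : is_graph H.
Hypothesis min_degree : forall v, alpha * n <= #|neighbours H v|%:R.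

(** When degrees exceed [n / 2], every vertex of the smaller side of a cut has a
    positive fraction of all vertices as neighbours on the other side. *)
Lemma dense_wide_cuts (S : {set V}) :
  eta * alpha * n <= #|S|%:R <= (1 - eta * alpha) * n ->
  2 * alpha / eta * (n ^+ 2 / L) <= #|boundary H S|%:R.
Proof.
have [a0 a1] := andP alpha01; have e0 := eta_gt0; have n0 : 0 < n by exact: n_gt0.
have al0 : 0 < alpha by lra.
have key (S' : {set V}) : eta * alpha * n <= #|S'|%:R -> #|S'|%:R <= n / 2 ->
   2 * alpha / eta * (n ^+ 2 / L) <= #|boundary H S'|%:R.
  move=> lo hi; apply: le_trans (boundary_degree S' min_degree).
  apply: (@le_trans _ _ (eta * alpha * n * ((alpha - 1 / 2) * n))); last first.
    apply: ler_pM => //; rewrite ?mulr_ge0 ?(ltW e0) ?(ltW al0) ?(ltW n0) //; lra.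
  rewrite (_ : 2 * alpha / eta * (n ^+ 2 / L) = alpha * n ^+ 2 * (2 / eta / L)); last first.
    by field; rewrite !lt0r_neq0.
  rewrite (_ : eta * alpha * n * _ = alpha * n ^+ 2 * (eta * (alpha - 1 / 2))); last by ring.
  rewrite ler_wpM2l ?mulr_ge0 ?exprn_ge0 ?(ltW al0) ?(ltW n0) // ler_pdivrMr //.
  move: L_large; rewrite ler_pdivrMr; last by rewrite mulr_gt0 ?exprn_gt0 //; lra.
  move=> h; rewrite ler_pdivrMr //; apply: (le_trans h).
  rewrite le_eqVlt; apply/orP; left; apply/eqP; ring.
move=> /andP[lo hi]; have [half|half] := leP #|S|%:R (n / 2); first exact: key.
have cS : #|S|%:R + #|~: S|%:R = n by rewrite -natrD cardsC.
rewrite -boundary_setC //; apply: key; lra.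
Qed.

End DenseCuts.

Section RandomEdges.
Variables (R : realType) (alpha eta : R) (V : finType) (E : {set {set V}}) (m : nat).
Hypotheses (alpha01 : 0 < alpha < 1) (eta_gt0 : 0 < eta) (eta_lt : 16 * eta < 1).
Let n : R := #|V|%:R.
Let L : R := ln n.
Hypotheses (L_gt0 : 0 < L) (L_large : 8 / eta ^+ 2 <= L).
Hypothesis n_large : 2 <= (1 - alpha) * n.
Hypothesis gE : is_graph E.
Hypothesis regE : regular_of_degree (alpha * n) E.
Hypothesis m_small : m%:R <= eta * alpha * (1 - alpha) / 32 * n ^+ 2.
Hypothesis m_large : 32 / (eta ^+ 2 * alpha) * (n ^+ 2 / L) <= m%:R.

Let U : {set {set V}} := vertex_pairs V :\: E.

Let basics : [/\ 0 < alpha, alpha < 1, 0 < eta, 16 * eta < 1 & 0 < n].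
Proof. by have [a0 a1] := andP alpha01; split=> //; exact: n_gt0. Qed.

Let ea : 0 < eta * alpha /\ 16 * (eta * alpha) < 1.
Proof.
have [a0 a1 e0 e1 n0] := basics; split; first by rewrite mulr_gt0.
by apply: le_lt_trans e1; rewrite ler_pM2l // ler_piMr // ltW.
Qed.

Let gU : is_graph U. Proof. exact: finset.subsetDl. Qed.

Let EU : E :|: U = vertex_pairs V.
Proof.
rewrite /U; apply/finset.setP => e; rewrite !inE; case: (boolP (e \in E)) => //= eE.
by have := fintype.subsetP gE e eE; rewrite inE => ->.
Qed.

Let degree_le (H : {set {set V}}) v : is_graph H -> (degree H v)%:R <= n.
Proof.
move=> gH; rewrite ler_nat (leq_trans (degree_neighbours gH v)) //; exact: max_card.
Qed.

Let degU v : (1 - alpha) * n - 1 <= (degree U v)%:R.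
Proof.
apply: (@le_trans _ _ #|neighbours U v|%:R); last by rewrite ler_nat neighbours_degree.
have : (#|neighbours (vertex_pairs V) v| <= #|neighbours E v| + #|neighbours U v|)%N.
  by rewrite -EU neighbours_setU cardsU leq_subr.
rewrite -(ler_nat R) natrD regE neighbours_complete cardsC1 => h.
have n1 : (0 < #|V|)%N by have [_ _ _ _] := basics; rewrite ltr0n.
have : (#|V|.-1)%:R = n - 1 :> R by rewrite /n -{2}(prednK n1) -natr1; lra.
by move: h; lra.
Qed.

Let M_bounds : (1 - alpha) * n ^+ 2 / 4 <= #|U|%:R /\ #|U|%:R <= n ^+ 2 / 2.
Proof.
have [a0 a1 e0 e1 n0] := basics.
have : (\sum_v degree U v)%:R = 2 * #|U|%:R :> R by rewrite handshake // natrM.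
rewrite natr_sum => h; split.
  have : \sum_(v : V) ((1 - alpha) * n - 1) <= 2 * #|U|%:R.
    by rewrite -h; apply: ler_sum => v _; exact: degU.
  rewrite sumr_const -[_ *+ _]mulr_natl -/n => le.
  have : n * ((1 - alpha) * n / 2) <= n * ((1 - alpha) * n - 1).
    rewrite ler_pM2l //; have := n_large; lra.
  by lra.
have : \sum_(v : V) (degree U v)%:R <= \sum_(v : V) n by apply: ler_sum => v _; exact: degree_le.
by rewrite h sumr_const -[_ *+ _]mulr_natl -/n; lra.
Qed.

Let m_n : 32 / (eta * alpha) * n <= m%:R.
Proof.
have [a0 a1 e0 e1 n0] := basics; apply: le_trans m_large.
have nL : 1 <= n / L by rewrite ler_pdivlMr // mul1r; exact: L_le.
rewrite (_ : 32 / (eta ^+ 2 * alpha) * (n ^+ 2 / L) = 32 / (eta * alpha) * n * ((n / L) * eta^-1)); last first.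
  by field; rewrite !lt0r_neq0.
rewrite ler_peMr //; first by rewrite mulr_ge0 // ?divr_ge0 ?mulr_ge0 // ltW.
rewrite -[leLHS]mulr1; apply: ler_pM => //.
by rewrite invf_ge1 //; lra.
Qed.

Let b1 := (Num.truncn (eta * alpha * n)).+1.
Let b2 := Num.truncn (eta * alpha / 16 * m%:R).
Let star v : {set {set V}} := [set e in U | v \in e].

(** The two ways in which added edges can be bad: too many at a vertex, or too
    few across a cut that has many non-edges. *)
Let crowded (s : {set {set V}}) := [exists v, (b1 <= #|s :&: star v|)%N].
Let thin (S : {set V}) (s : {set {set V}}) :=
  (eta * alpha / 4 * n ^+ 2 <= #|boundary U S|%:R) && (#|s :&: boundary U S| <= b2)%N.
Let bad s := crowded s || [exists S, thin S s].

Let m_small' : m%:R <= eta * alpha / 32 * n ^+ 2 /\ m%:R <= (1 - alpha) * n ^+ 2 / 8.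
Proof.
have [a0 a1 e0 e1 n0] := basics; have [ea0 ea1] := ea.
have n2 : 0 <= n ^+ 2 by rewrite exprn_ge0 // ltW.
split; apply: (le_trans m_small).
  rewrite (_ : eta * alpha * (1 - alpha) / 32 * n ^+ 2 = eta * alpha / 32 * n ^+ 2 * (1 - alpha)); last by ring.
  by rewrite ler_piMr ?mulr_ge0 ?divr_ge0 ?(ltW ea0) //; lra.
rewrite (_ : eta * alpha * (1 - alpha) / 32 * n ^+ 2 = (1 - alpha) * n ^+ 2 / 8 * (eta * alpha / 4)); last by field.
by rewrite ler_piMr ?divr_ge0 ?mulr_ge0 //; lra.
Qed.

Let count (Q : pred {set {set V}}) : R := #|[set s in subsets_of_size U m | Q s]|%:R.
Let total : R := 'C(#|U|, m)%:R.

Let mM : (m < #|U|)%N /\ (1 - alpha) * n ^+ 2 / 8 <= (#|U| - m)%:R.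
Proof.
have [a0 a1 e0 e1 n0] := basics; have [lo _] := M_bounds; have [_ mb] := m_small'.
have n2 : 0 < (1 - alpha) * n ^+ 2 by rewrite mulr_gt0 ?exprn_gt0 // subr_gt0.
have lt : (m < #|U|)%N by rewrite -(ltr_nat R); lra.
split=> //; rewrite natrB ?(ltW lt) //; last exact: ltnW.
by lra.
Qed.

Let count_star v : count (fun s => (b1 <= #|s :&: star v|)%N) <= expR (- (eta * alpha / 4 * n)) * total.
Proof.
have [a0 a1 e0 e1 n0] := basics; have [ea0 ea1] := ea; have [lt Mm] := mM.
have sU : star v \subset U by apply/fintype.subsetP => e; rewrite inE => /andP[].
apply: (le_trans (upper_tail R b1 sU lt)); rewrite ler_wpM2r ?ler0n // ler_expR.
have b1l : eta * alpha * n <= b1%:R by apply/ltW/truncnS_gt.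
have M0 : 0 < (#|U| - m)%:R :> R by rewrite ltr0n subn_gt0.
suff : m%:R * #|star v|%:R / (#|U| - m)%:R <= eta * alpha / 4 * n by lra.
rewrite ler_pdivrMr //; have sn : #|star v|%:R <= n by exact: (degree_le v gU).
apply: (@le_trans _ _ (eta * alpha * (1 - alpha) / 32 * n ^+ 2 * n)); first exact: ler_pM.
rewrite (_ : _ * n = eta * alpha / 4 * n * ((1 - alpha) * n ^+ 2 / 8)); last by field.
by rewrite ler_wpM2l // mulr_ge0 ?divr_ge0 ?(ltW ea0) // ltW.
Qed.

Let count_thin S : count (thin S) <= expR (- (eta * alpha / 16 * m%:R)) * total.
Proof.
have [a0 a1 e0 e1 n0] := basics; have [ea0 ea1] := ea; have [lt Mm] := mM.
have [_ hi] := M_bounds; have [mb _] := m_small'.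
have n2 : 0 < n ^+ 2 by rewrite exprn_gt0.
have [big|small] := boolP (eta * alpha / 4 * n ^+ 2 <= #|boundary U S|%:R); last first.
  rewrite /count /thin (negbTE small) (_ : [set _ in _ | _] = finset.set0).
    by rewrite cards0 mulr_ge0 ?expR_ge0 ?ler0n.
  by apply/finset.setP => s; rewrite !inE andbF.
rewrite /count /thin big /=.
have sU : boundary U S \subset U by apply/fintype.subsetP => e; rewrite inE => /andP[].
have en : 0 < eta * alpha * n ^+ 2 by rewrite mulr_gt0.
have mQ : (m <= #|boundary U S|)%N by rewrite -(ler_nat R); lra.
have U0 : (0 < #|U|)%N by apply: leq_ltn_trans lt.
apply: (le_trans (lower_tail R b2 sU mQ U0)); rewrite ler_wpM2r ?ler0n // ler_expR.
have b2l : b2%:R <= eta * alpha / 16 * m%:R.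
  by rewrite truncn_le // mulr_ge0 ?divr_ge0 // ltW.
suff : eta * alpha / 8 * m%:R <= m%:R * (#|boundary U S| - m)%:R / (2 * #|U|%:R) by lra.
have U0' : 0 < 2 * #|U|%:R :> R by rewrite mulr_gt0 // ltr0n.
rewrite ler_pdivlMr // mulrAC mulrC ler_wpM2l // natrB //.
have : eta * alpha / 8 * (2 * #|U|%:R) <= eta * alpha / 8 * n ^+ 2.
  by rewrite ler_wpM2l ?divr_ge0 ?(ltW ea0) //; lra.
by lra.
Qed.

Let count_sum (J : finType) (Q : J -> pred {set {set V}}) :
  count (fun s => [exists j, Q j s]) <= \sum_j count (Q j).
Proof.
rewrite /count -natr_sum ler_nat.
apply: (@leq_trans #|\bigcup_j [set s in subsets_of_size U m | Q j s]|).
  apply/subset_leq_card/fintype.subsetP => s; rewrite inE => /andP[sm /existsP[j qj]].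
  by apply/finset.bigcupP; exists j => //; rewrite inE sm.
elim/big_rec2: _ => [|j k A _ le]; first by rewrite cards0.
by rewrite (leq_trans (leq_card_setU _ _)) // leq_add2l.
Qed.

Definition bad_fraction : R := (64 / (eta * alpha) ^+ 2 + 1) / n.

Let small_exp : n * expR (- (eta * alpha / 4 * n)) + expR (- n) <= bad_fraction.
Proof.
have [a0 a1 e0 e1 n0] := basics; have [ea0 ea1] := ea.
rewrite /bad_fraction mulrDl mul1r; apply: lerD; last first.
  apply: (le_trans (expRN_le (ltW n0))); rewrite lef_pV2 ?posrE //; lra.
set c := eta * alpha / 8 * n; have c0 : 0 < c by rewrite mulr_gt0 ?divr_gt0.
rewrite (_ : expR _ = expR (- c) * expR (- c)); last by rewrite -expRD /c; congr expR; field.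
have ec : expR (- c) <= c^-1.
  apply: (le_trans (expRN_le (ltW c0))); rewrite lef_pV2 ?posrE //; lra.
apply: (@le_trans _ _ (n * (c^-1 * c^-1))).
  by rewrite ler_pM2l // ler_pM ?expR_ge0.
rewrite /c le_eqVlt; apply/orP; left; apply/eqP; field.
by rewrite !lt0r_neq0.
Qed.

Let count_bad : count bad <= bad_fraction * total.
Proof.
have [a0 a1 e0 e1 n0] := basics; have [ea0 ea1] := ea.
apply: (@le_trans _ _ (count crowded + count (fun s => [exists S, thin S s]))).
  rewrite /count -natrD ler_nat; apply: leq_trans (leq_card_setU _ _).
  apply/subset_leq_card/fintype.subsetP => s; rewrite !inE /bad.
  by case/andP => -> /=.
apply: (@le_trans _ _ ((n * expR (- (eta * alpha / 4 * n)) + expR (- n)) * total)); last first.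
  by rewrite ler_wpM2r ?ler0n.
rewrite mulrDl; apply: lerD; apply: (le_trans (count_sum _)).
  apply: (le_trans (ler_sum _ (fun v _ => count_star v))).
  by rewrite sumr_const -[_ *+ _]mulr_natl -/n mulrA.
apply: (le_trans (ler_sum _ (fun S _ => count_thin S))).
rewrite sumr_const -[_ *+ _]mulr_natl mulrA ler_wpM2r ?ler0n //.
have -> : #|[eta xpredT : pred {set V}]| = (2 ^ #|V|)%N.
  transitivity #|powerset [set: V]|; first by rewrite finset.powersetT cardsT.
  by rewrite card_powerset cardsT.
have two : 2 <= expR 1 :> R by apply: le_trans (expR_ge1Dx _); lra.
have : 2 ^+ #|V| <= expR n.
  have -> : expR n = expR 1 ^+ #|V| by rewrite -expRM_natl mulr1.
  by apply: lerXn2r; rewrite ?nnegrE ?expR_ge0.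
move=> h; rewrite natrX; apply: (le_trans (ler_wpM2r (expR_ge0 _) h)).
rewrite -expRD ler_expR.
have : eta * alpha / 16 * (32 / (eta * alpha) * n) <= eta * alpha / 16 * m%:R.
  by rewrite ler_wpM2l ?m_n // divr_ge0 // ltW.
rewrite (_ : eta * alpha / 16 * (32 / (eta * alpha) * n) = 2 * n); first by lra.
by field; rewrite !lt0r_neq0.
Qed.

Definition good_graph (H : {set {set V}}) : Prop :=
  [/\ is_graph H,
      forall v, alpha * n <= #|neighbours H v|%:R,
      forall v, #|neighbours H v|%:R <= (1 + eta) * alpha * n
    & forall S : {set V}, eta * alpha * n <= #|S|%:R <= (1 - eta * alpha) * n ->
        2 * alpha / eta * (n ^+ 2 / L) <= #|boundary H S|%:R].

Let not_bad (s : {set {set V}}) : s \subset U -> ~~ bad s -> good_graph (E :|: s).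
Proof.
have [a0 a1 e0 e1 n0] := basics; have [ea0 ea1] := ea.
move=> sU; rewrite negb_or => /andP[/existsPn nc /existsPn nt].
have gs : is_graph s by apply: fintype.subset_trans sU gU.
split.
- by rewrite /is_graph finset.subUset gE.
- by move=> v; rewrite -(regE v) ler_nat neighbours_setU subset_leq_card // finset.subsetUl.
- move=> v; rewrite neighbours_setU; apply: (@le_trans _ _ (#|neighbours E v| + #|neighbours s v|)%:R).
    by rewrite ler_nat cardsU leq_subr.
  rewrite natrD regE mulrDl mul1r mulrDl lerD2l.
  have := nc v; rewrite -ltnNge ltnS => le.
  apply: (@le_trans _ _ (Num.truncn (eta * alpha * n))%:R).
    rewrite ler_nat; apply: leq_trans le.
    apply: leq_trans (neighbours_degree v gs) _; apply/subset_leq_card/fintype.subsetP => e.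
    by rewrite !inE => /andP[es ve]; have := fintype.subsetP sU e es; rewrite !inE es ve => ->.
  by rewrite truncn_le // mulr_ge0 // ltW.
- move=> S /andP[lo hi]; have := nt S; rewrite negb_and => /orP[|].
    rewrite -ltNge => small.
    (* Few non-edges across the cut: at least half of the pairs across it are in E. *)
    have vp : #|S|%:R * (n - #|S|%:R) <= #|boundary (vertex_pairs V) S|%:R.
      have : (\sum_(u in S) #|~: S| <= #|boundary (vertex_pairs V) S|)%N.
        apply: leq_trans (card_boundary _ _); apply: leq_sum => u uS.
        rewrite neighbours_complete; apply/subset_leq_card/fintype.subsetP => w.
        by rewrite !inE => wS; rewrite wS; apply: contraNneq wS => ->.
      rewrite sum_nat_const -(ler_nat R) natrM.
      have cS : #|S|%:R + #|~: S|%:R = n by rewrite -natrD cardsC.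
      by rewrite -cS addrAC subrr add0r.
    have : (#|boundary (vertex_pairs V) S| <= #|boundary E S| + #|boundary U S|)%N.
      apply: leq_trans (leq_card_setU _ _); apply/subset_leq_card/fintype.subsetP => e.
      by rewrite -EU !inE => /andP[/orP[->|->] ->]; rewrite ?orbT.
    rewrite -(ler_nat R) natrD => le.
    have sub : #|boundary E S|%:R <= #|boundary (E :|: s) S|%:R :> R.
      rewrite ler_nat; apply/subset_leq_card/fintype.subsetP => e; rewrite !inE => /andP[-> ->] //.
    apply: le_trans sub.
    have quad : eta * alpha / 2 * n ^+ 2 <= #|S|%:R * (n - #|S|%:R).
      have p : 0 <= (#|S|%:R - eta * alpha * n) * ((1 - eta * alpha) * n - #|S|%:R).
        by rewrite mulr_ge0 // subr_ge0.
      have n2 : 0 < n ^+ 2 by rewrite exprn_gt0.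
      have p2 : 0 <= (1 / 2 - eta * alpha) * (eta * alpha * n ^+ 2).
        by rewrite !mulr_ge0 ?(ltW ea0) ?(ltW n2) //; lra.
      by nra.
    apply: (@le_trans _ _ (eta * alpha / 4 * n ^+ 2)); last by lra.
    rewrite (_ : 2 * alpha / eta * (n ^+ 2 / L) = alpha * n ^+ 2 * (2 / eta / L)); last first.
      by field; rewrite !lt0r_neq0.
    rewrite (_ : eta * alpha / 4 * n ^+ 2 = alpha * n ^+ 2 * (eta / 4)); last by ring.
    rewrite ler_wpM2l ?mulr_ge0 ?exprn_ge0 ?(ltW a0) ?(ltW n0) // ler_pdivrMr //.
    move: L_large; rewrite ler_pdivrMr ?exprn_gt0 // => h.
    rewrite ler_pdivrMr //; lra.
  rewrite -ltnNge => lt.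
  apply: (@le_trans _ _ #|s :&: boundary U S|%:R); last first.
    rewrite ler_nat; apply/subset_leq_card/fintype.subsetP => e; rewrite !inE.
    by case/and3P=> -> _ ->; rewrite orbT.
  apply: (@le_trans _ _ b2.+1%:R); last by rewrite ler_nat.
  apply/ltW/(le_lt_trans _ (truncnS_gt _)).
  have := ler_wpM2l (ltW (divr_gt0 ea0 (ltr0n R 16))) m_large.
  apply: le_trans.
  rewrite (_ : eta * alpha / 16 * _ = 2 / eta * (n ^+ 2 / L)); last first.
    by field; rewrite !lt0r_neq0.
  have x0 : 0 <= 2 / eta * (n ^+ 2 / L) by rewrite !mulr_ge0 ?invr_ge0 // ltW.
  rewrite (_ : 2 * alpha / eta * _ = alpha * (2 / eta * (n ^+ 2 / L))); last first.
    by field; rewrite !lt0r_neq0.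
  by rewrite ler_piMl // ltW.
Qed.

(** At each of the [n] vertices and across each of the at most 2 ^ n cuts, the
    tail bounds for uniform subsets are exponentially small in [n] with a
    sufficient constant, since m is small against n ^ 2 and large against n. *)
Lemma most_graphs_good : exists good : {set {set {set V}}},
  [/\ good \subset subsets_of_size U m,
      forall s, s \in good -> good_graph (E :|: s),
      (m <= #|U|)%N
    & (1 - bad_fraction) * 'C(#|U|, m)%:R <= #|good|%:R].
Proof.
exists [set s in subsets_of_size U m | ~~ bad s]; split.
- by apply/fintype.subsetP => s; rewrite inE => /andP[].
- by move=> s; rewrite !inE => /andP[/andP[sU _] nb]; exact: not_bad.
- by have [/ltnW] := mM.
have := cardsID [set s | bad s] (subsets_of_size U m).
rewrite card_subsets_of_size => h.
have -> : [set s in subsets_of_size U m | ~~ bad s] = subsets_of_size U m :\: [set s | bad s].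
  by apply/finset.setP => s; rewrite !inE andbC.
have -> : #|subsets_of_size U m :\: [set s | bad s]|%:R = total - count bad.
  rewrite /total -h natrD /count (_ : [set s in _ | bad s] = subsets_of_size U m :&: [set s | bad s]).
    by rewrite addrAC subrr add0r.
  by apply/finset.setP => s; rewrite !inE.
by rewrite mulrBl mul1r lerD2l lerN2; exact: count_bad.
Qed.

End RandomEdges.

(** * Limits along a sequence of graphs *)

Local Open Scope classical_set_scope.
Local Open Scope ring_scope.

(** Smaller tolerances give smaller events, so tolerances [16 * eta]
    below 1 suffice. *)
Lemma whp_approx_intro (R : realType) (d : nat -> measure_display)
    (T : forall k, measurableType (d k)) (P : forall k, probability (T k) R)
    (Y : forall k, T k -> \bar R) (b : nat -> R) :
  (forall k, measurable_fun setT (Y k)) ->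
  (forall eta eps : R, 0 < eta -> 16 * eta < 1 -> 0 < eps -> \forall k \near \oo,
     ((1 - eps)%:E <= P k [set w | `|Y k w * ((b k)^-1)%:E - 1| <= (16 * eta)%:E])%E) ->
  whp_approx P Y b.
Proof.
move=> mY h delta d0.
have mEv k dl : measurable [set w | (`|Y k w * ((b k)^-1)%:E - 1| <= dl%:E)%E].
  exact: measurable_relative_error.
pose ev k := [set w | (`|Y k w * ((b k)^-1)%:E - 1| <= delta%:E)%E].
change (P k (ev k) @[k --> \oo] --> 1%E).
have fin k : P k (ev k) \is a fin_num by apply: fin_num_measure; exact: mEv.
have -> : (fun k => P k (ev k)) = EFin \o (fun k => fine (P k (ev k))).
  by apply/funext => k /=; rewrite fineK.
apply: cvg_EFin; first by near=> k.
apply/cvgrPdist_le => eps e0.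
pose eta := Num.min delta (1 / 2) / 16.
have m0 : 0 < Num.min delta (1 / 2) by rewrite lt_min d0 /=; lra.
have m1 : Num.min delta (1 / 2) <= 1 / 2 by rewrite ge_min lexx orbT.
have m2 : Num.min delta (1 / 2) <= delta by rewrite ge_min lexx.
have e16 : 16 * eta = Num.min delta (1 / 2) by rewrite /eta; field.
have eta0 : 0 < eta by rewrite /eta divr_gt0.
have eta1 : 16 * eta < 1 by rewrite e16; lra.
have := h eta eps eta0 eta1 e0; apply: filterS => k le.
have {}le : ((1 - eps)%:E <= P k (ev k))%E.
  apply: (le_trans le); apply: le_measure; rewrite ?inE //; try exact: mEv.
  by move=> w /= /le_trans; apply; rewrite lee_fin e16.
have : (P k (ev k) <= 1)%E by apply: probability_le1; exact: mEv.
move: le; rewrite -(fineK (fin k)) !lee_fin /= => lo hi.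
by rewrite ger0_norm ?subr_ge0 //; lra.
Unshelve. all: by end_near. Qed.

Definition measurable_functional (R : realType) (V : finType)
    (Y : {set {set V}} -> ({set V} -> R) -> \bar R) : Prop :=
  forall H d (T : measurableType d) (P : probability T R) (X : {set V} -> {RV P >-> R}),
    measurable_fun setT (fun w => Y H (fun e => X e w)).

(** The common form of the three estimates, so that randomness of the added edges
    and the limit are dealt with once. *)
Definition concentrates (R : realType) (alpha : R) (V : finType)
    (Y : {set {set V}} -> ({set V} -> R) -> \bar R) (c : R) : Prop :=
  forall (eta : R) (H : {set {set V}}), 0 < eta -> 16 * eta < 1 ->
    0 < ln #|V|%:R :> R -> 8 / alpha <= ln #|V|%:R -> good_graph alpha eta H ->
    forall d (T : measurableType d) (P : probability T R) (C : set T)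
      (X : {set V} -> {RV P >-> R}), measurable C -> iid_exp1_given C H X ->
    (P (C `&` ~` [set w | `|Y H (fun e => X e w) *
        ((c * (ln #|V|%:R / (alpha * #|V|%:R)))^-1)%:E - 1| <= (16 * eta)%:E])
      <= P C * (error_bound alpha eta V)%:E)%E.

Section Concentration.
Variables (R : realType) (alpha : R) (V : finType).
Hypothesis alpha01 : 0 < alpha < 1.

Lemma dist_concentrates (i j : V) : i != j ->
  concentrates alpha (fun H len => dist H len i j) 1.
Proof.
move=> ij eta H e0 e1 L0 LL [gH mi ma wi] d T P C X mC iX; rewrite mul1r.
exact: (dist_concentrated alpha01 e0 e1 L0 gH mi ma wi mC iX ij).
Qed.

Lemma max_dist_from_concentrates (i : V) :
  concentrates alpha (fun H len => max_dist_from H len i) 2.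
Proof.
move=> eta H e0 e1 L0 LL [gH mi ma wi] d T P C X mC iX.
exact: (max_dist_from_concentrated alpha01 e0 e1 L0 LL gH mi ma wi mC iX i).
Qed.

Lemma max_dist_concentrates : concentrates alpha (fun H len => @max_dist R V H len) 3.
Proof.
move=> eta H e0 e1 L0 LL [gH mi ma wi] d T P C X mC iX.
exact: (max_dist_concentrated alpha01 e0 e1 L0 LL gH mi ma wi mC iX).
Qed.

End Concentration.

Section RandomGraph.
Variables (R : realType) (d : measure_display) (T : measurableType d) (P : probability T R).
Variables (S : finType) (A : T -> S).
Hypothesis mA : forall s, measurable (A @^-1` [set s]).
Variable Ev : S -> set T.
Hypothesis mEv : forall s, measurable (Ev s).

Lemma measurable_mixture : measurable [set w | Ev (A w) w].
Proof.
have -> : [set w | Ev (A w) w] = \bigcup_(s in [set: S]) (A @^-1` [set s] `&` Ev s).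
  by apply/seteqP; split=> [w h|w [s _ [/= <- //]]]; exists (A w).
by apply: fin_bigcup_measurable => // s _; exact: measurableI.
Qed.

(** Averaging over the values of [A]; values outside [good] are given up. *)
Lemma mixture_ge (good : {set S}) (p err bf : R) : 0 <= err -> 0 <= p ->
  (forall s, s \in good -> P (A @^-1` [set s]) = p%:E) ->
  (forall s, s \in good -> (P (A @^-1` [set s] `&` ~` Ev s) <= P (A @^-1` [set s]) * err%:E)%E) ->
  1 - bf <= #|good|%:R * p -> 0 <= bf ->
  ((1 - (err + bf))%:E <= P [set w | Ev (A w) w])%E.
Proof.
move=> err0 p0 Pp fail big bf0.
have [e1|e1] := leP err 1; last first.
  by apply: (le_trans _ (measure_ge0 _ _)); rewrite lee_fin; lra.
have m1 s : measurable (A @^-1` [set s] `&` Ev s) by exact: measurableI.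
apply: (@le_trans _ _ (\sum_(s <- enum good) P (A @^-1` [set s] `&` Ev s))%E); last first.
  apply: sum_measure_le => //; last by move=> s _ w [/= <-].
  - by move=> s s' ss'; apply/seteqP; split=> // w [[/= e2 _] [/= e3 _]]; move/eqP: ss'; apply; rewrite -e2.
  - exact: enum_uniq.
  - exact: measurable_mixture.
rewrite big_enum /=; apply: (@le_trans _ _ (\sum_(s in good) (p * (1 - err))%:E)%E); last first.
  apply: lee_sum => s sg.
  have dE : (P (A @^-1` [set s] `&` ~` Ev s) = P (A @^-1` [set s]) - P (A @^-1` [set s] `&` Ev s))%E.
    by rewrite -setDE measureD // ltey_eq fin_num_measure.
  have fE : P (A @^-1` [set s] `&` Ev s) \is a fin_num by exact: fin_num_measure.
  have := fail s sg; rewrite dE Pp // -(fineK fE) -EFinB -EFinM !lee_fin; lra.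
rewrite sumEFin lee_fin sumr_const -mulr_natl mulrA.
have : (1 - bf) * (1 - err) <= #|good|%:R * p * (1 - err) by rewrite ler_wpM2r // subr_ge0.
have : 0 <= bf * err by rewrite mulr_ge0.
by lra.
Qed.

End RandomGraph.

Lemma error_bound_le (R : realType) (alpha eta : R) (V : finType) : 0 < eta -> 0 < ln #|V|%:R :> R ->
  error_bound alpha eta V <= ((eta ^+ 2)^-1 + lower_const alpha eta) / ln #|V|%:R.
Proof.
move=> e0 L0; rewrite /error_bound [leRHS]mulrDl lerD2r.
set L := ln _ in L0 *; have eL : 0 < eta * L by rewrite mulr_gt0.
rewrite (_ : (eta ^+ 2)^-1 / L = eta^-1 * (eta * L)^-1); last by field; rewrite !lt0r_neq0.
rewrite ler_pM2l ?invr_gt0 //; apply: (le_trans (expRN_le (ltW eL))).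
by rewrite lef_pV2 ?posrE //; lra.
Qed.

Section GraphSequences.
Variables (R : realType) (alpha : R) (n : nat -> nat).
Hypotheses (alpha01 : 0 < alpha < 1) (n_incr : {homo n : i j / (i < j)%N}).
Hypothesis n_ge2 : forall k, (1 < n k)%N.
Variable E : forall k, {set {set 'I_(n k)}}.
Hypotheses (E_graph : forall k, is_graph (E k))
  (E_regular : forall k, regular_of_degree (alpha * (n k)%:R) (E k)).
Variables (Y : forall k, {set {set 'I_(n k)}} -> ({set 'I_(n k)} -> R) -> \bar R) (c : R).
Hypothesis mY : forall k, measurable_functional (@Y k).
Hypothesis Yc : forall k, concentrates alpha (@Y k) c.

Let scale k : R := ln (n k)%:R / (alpha * (n k)%:R).

Lemma ln_unbounded (M : R) : \forall k \near \oo, M <= ln (n k)%:R.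
Proof.
have n_ge k : (k <= n k)%N by elim: k => // k IH; apply: leq_ltn_trans IH _; exact: n_incr.
exists (Num.truncn (expR M)).+1 => // k /= hk.
rewrite -[leLHS]expRK ler_ln ?posrE ?expR_gt0 //; last by rewrite ltr0n (ltn_trans _ (n_ge2 k)).
apply/ltW/(lt_le_trans (truncnS_gt _)); rewrite ler_nat; exact: leq_trans (n_ge k).
Qed.

Let n_cvg (M : R) : \forall k \near \oo, M <= (n k)%:R.
Proof.
have := ln_unbounded M; apply: filterS => k /le_trans; apply.
have n0 : 0 < (n k)%:R :> R by rewrite ltr0n (ltn_trans _ (n_ge2 k)).
by rewrite -[leRHS](lnK (_ : _ \is Num.pos)) ?posrE //; apply: le_trans (expR_ge1Dx _); rewrite lerDr.
Qed.

Let ln_gt0 : \forall k \near \oo, 0 < ln (n k)%:R :> R.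
Proof. by have := ln_unbounded 1; apply: filterS => k; exact: lt_le_trans. Qed.

Lemma error_vanishes (eta eps : R) : 0 < eta -> 0 < eps ->
  \forall k \near \oo, error_bound alpha eta 'I_(n k) <= eps.
Proof.
move=> e0 p0; near=> k.
have L0 : 0 < ln (n k)%:R :> R by near: k.
have := @error_bound_le _ alpha eta 'I_(n k) e0; rewrite card_ord => /(_ L0)/le_trans; apply.
rewrite ler_pdivrMr // mulrC -ler_pdivrMr //; near: k; exact: ln_unbounded.
Unshelve. all: by end_near. Qed.

Lemma fixed_graph_whp (d : nat -> measure_display) (T : forall k, measurableType (d k))
    (P : forall k, probability (T k) R) (X : forall k, {set 'I_(n k)} -> {RV (P k) >-> R}) :
  1 / 2 < alpha -> (forall k, iid_exp1_given setT (E k) (X k)) ->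
  whp_approx P (fun k w => @Y k (E k) (fun e => X k e w)) (fun k => c * scale k).
Proof.
move=> a12 iX; have [a0 a1] := andP alpha01.
apply: whp_approx_intro => [k|eta eps e0 e1 p0]; first exact: mY.
near=> k.
have L0 : 0 < ln #|'I_(n k)|%:R :> R by rewrite card_ord; near: k.
have L1 : 8 / alpha <= ln #|'I_(n k)|%:R by rewrite card_ord; near: k; exact: ln_unbounded.
have L2 : 2 / (eta ^+ 2 * (alpha - 1 / 2)) <= ln #|'I_(n k)|%:R.
  by rewrite card_ord; near: k; exact: ln_unbounded.
have mi v : alpha * #|'I_(n k)|%:R <= #|neighbours (E k) v|%:R by rewrite card_ord E_regular.
have gg : good_graph alpha eta (E k).
  split=> // [v|S]; last by apply: dense_wide_cuts => //; rewrite a12.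
  rewrite card_ord E_regular mulrDl mul1r mulrDl lerDl !mulr_ge0 // ltW //.
have err : error_bound alpha eta 'I_(n k) <= eps by near: k; exact: error_vanishes.
have := Yc e0 e1 L0 L1 gg measurableT (iX k).
have mEv := measurable_relative_error (c * scale k) (16 * eta) (mY (E k) (X k)).
rewrite card_ord setTI probability_setT mul1e probability_setC //.
set p := P k _; have : p \is a fin_num by exact: fin_num_measure.
by move=> /fineK <-; rewrite -EFinB !lee_fin; lra.
Unshelve. all: by end_near. Qed.

Lemma random_graph_whp (m : nat -> nat) :
  much_larger (fun k => (m k)%:R : R) (fun k => (n k)%:R ^+ 2 / ln (n k)%:R) ->
  much_larger (fun k => (n k)%:R ^+ 2 : R) (fun k => (m k)%:R) ->
  forall (d : nat -> measure_display) (T : forall k, measurableType (d k))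
      (P : forall k, probability (T k) R)
      (A : forall k, T k -> {set {set 'I_(n k)}})
      (X : forall k, {set 'I_(n k)} -> {RV (P k) >-> R}),
  (forall k, uniform_added_edges (P k) (E k) (m k) (A k)) ->
  (forall k, iid_exp1_lengths (E k) (A k) (X k)) ->
  whp_approx P (fun k w => @Y k (E k :|: A k w)%SET (fun e => X k e w)) (fun k => c * scale k).
Proof.
move=> m_large m_small d T P A X uA iX; have [a0 a1] := andP alpha01.
pose Ev eta k (s : {set {set 'I_(n k)}}) :=
  [set w | (`|@Y k (E k :|: s)%SET (fun e => X k e w) * ((c * scale k)^-1)%:E - 1| <= (16 * eta)%:E)%E].
have mEv eta k s : measurable (Ev eta k s).
  exact: (measurable_relative_error _ _ (mY (E k :|: s)%SET (X k))).
apply: whp_approx_intro => [k|eta eps e0 e1 p0].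
  have [mA _] := uA k.
  move=> _ B mB; rewrite setTI.
  have mB' s : measurable [set w | B (@Y k (E k :|: s)%SET (fun e => X k e w))].
    by have := mY (E k :|: s)%SET (X k) measurableT mB; rewrite setTI.
  exact: (measurable_mixture mA mB').
near=> k.
have L0 : 0 < ln (n k)%:R :> R by near: k.
have n0 : 0 < (n k)%:R :> R by rewrite ltr0n (ltn_trans _ (n_ge2 k)).
have ea0 : 0 < eta * alpha * (1 - alpha) by rewrite !mulr_gt0 // subr_gt0.
have L1 : 8 / alpha <= ln (n k)%:R by near: k; exact: ln_unbounded.
have L2 : 8 / eta ^+ 2 <= ln (n k)%:R by near: k; exact: ln_unbounded.
have nl : 2 <= (1 - alpha) * (n k)%:R.
  by rewrite mulrC -ler_pdivrMr ?subr_gt0 //; near: k; exact: n_cvg.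
have ms : (m k)%:R <= eta * alpha * (1 - alpha) / 32 * (n k)%:R ^+ 2.
  have : 32 / (eta * alpha * (1 - alpha)) <= (n k)%:R ^+ 2 / (m k)%:R.
    by near: k; move/cvgryPge: m_small; apply.
  have [->|m0] := posnP (m k); first by rewrite mulr_ge0 ?exprn_ge0 // divr_ge0 // ltW.
  have m0' : 0 < (m k)%:R :> R by rewrite ltr0n.
  rewrite ler_pdivlMr // => h.
  rewrite (_ : (m k)%:R = eta * alpha * (1 - alpha) / 32 * (32 / (eta * alpha * (1 - alpha)) * (m k)%:R)).
    by rewrite ler_pM2l // divr_gt0.
  by field; rewrite !lt0r_neq0 // subr_gt0.
have ml : 32 / (eta ^+ 2 * alpha) * ((n k)%:R ^+ 2 / ln (n k)%:R) <= (m k)%:R.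
  have : 32 / (eta ^+ 2 * alpha) <= (m k)%:R / ((n k)%:R ^+ 2 / ln (n k)%:R).
    by near: k; move/cvgryPge: m_large; apply.
  by rewrite ler_pdivlMr // divr_gt0 // exprn_gt0.
have err : error_bound alpha eta 'I_(n k) <= eps / 2.
  by near: k; apply: error_vanishes => //; rewrite divr_gt0.
have bf : bad_fraction alpha eta 'I_(n k) <= eps / 2.
  rewrite /bad_fraction card_ord ler_pdivrMr // -ler_pdivrMl ?divr_gt0 //.
  near: k; exact: n_cvg.
have [] := @most_graphs_good R alpha eta 'I_(n k) (E k) (m k) alpha01 e0 e1;
  rewrite ?card_ord //.
move=> good [goodU gg mM big].
have [mA uniA] := uA k.
have err0 : 0 <= error_bound alpha eta 'I_(n k).
  by apply: error_bound_ge0; rewrite ?card_ord.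
have C0 : 0 < 'C(#|(vertex_pairs 'I_(n k) :\: E k)%SET|, m k)%:R :> R by rewrite ltr0n bin_gt0.
apply: le_trans (@mixture_ge R (d k) (T k) (P k) _ (A k) mA (Ev eta k) (mEv eta k) good
   ('C(#|(vertex_pairs 'I_(n k) :\: E k)%SET|, m k)%:R^-1) _ (bad_fraction alpha eta 'I_(n k)) err0 _ _ _ _ _).
- by rewrite lee_fin lerD2l lerN2 [eps in leRHS]splitr lerD.
- by rewrite invr_ge0 ltW.
- move=> s sg; apply: uniA; have := fintype.subsetP goodU s sg; rewrite inE; case/andP => // _ /eqP //.
- move=> s sg; have := Yc e0 e1 _ _ (gg s sg) (mA s) (iX k s).
  by rewrite card_ord => /(_ L0 L1).
- by rewrite ler_pdivlMr.
- by rewrite divr_ge0 ?addr_ge0 // divr_ge0 // sqr_ge0.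
Unshelve. all: by end_near. Qed.

End GraphSequences.

Theorem theorem2 (R : realType) (alpha : R) (alpha01 : 0 < alpha < 1)
    (n : nat -> nat) (n_incr : {homo n : i j / (i < j)%N})
    (n_ge2 : forall k, (1 < n k)%N)
    (E : forall k, {set {set 'I_(n k)}}) (E_graph : forall k, is_graph (E k))
    (E_regular : forall k, regular_of_degree (alpha * (n k)%:R) (E k)) :
  let v1 k : 'I_(n k) := Ordinal (ltnW (n_ge2 k)) in
  let v2 k : 'I_(n k) := Ordinal (n_ge2 k) in
  let scale k : R := ln (n k)%:R / (alpha * (n k)%:R) in
  (forall (m : nat -> nat)
      (m_large : much_larger (fun k => (m k)%:R : R)
                   (fun k => (n k)%:R ^+ 2 / ln (n k)%:R))
      (m_small : much_larger (fun k => (n k)%:R ^+ 2 : R) (fun k => (m k)%:R))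
      (d : nat -> measure_display) (T : forall k, measurableType (d k))
      (P : forall k, probability (T k) R)
      (A : forall k, T k -> {set {set 'I_(n k)}})
      (X : forall k, {set 'I_(n k)} -> {RV (P k) >-> R})
      (A_uniform : forall k, uniform_added_edges (P k) (E k) (m k) (A k))
      (X_exp : forall k, iid_exp1_lengths (E k) (A k) (X k)),
    let G k (w : T k) := (E k :|: A k w)%SET in
    let len k (w : T k) := fun e => X k e w in
    [/\ whp_approx P (fun k w => dist (G k w) (len k w) (v1 k) (v2 k)) scale,
        whp_approx P (fun k w => max_dist_from (G k w) (len k w) (v1 k))
          (fun k => 2 * scale k)
      & whp_approx P (fun k w => max_dist (G k w) (len k w))
          (fun k => 3 * scale k)])
  /\
  (1 / 2 < alpha ->
    forall (d : nat -> measure_display) (T : forall k, measurableType (d k))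
      (P : forall k, probability (T k) R)
      (X : forall k, {set 'I_(n k)} -> {RV (P k) >-> R})
      (X_exp : forall k, iid_exp1_given setT (E k) (X k)),
    let len k (w : T k) := fun e => X k e w in
    [/\ whp_approx P (fun k w => dist (E k) (len k w) (v1 k) (v2 k)) scale,
        whp_approx P (fun k w => max_dist_from (E k) (len k w) (v1 k))
          (fun k => 2 * scale k)
      & whp_approx P (fun k w => max_dist (E k) (len k w))
          (fun k => 3 * scale k)]).
Proof.
move=> v1 v2 scale.
have v12 k : v1 k != v2 k by [].
have m1 k : @measurable_functional R 'I_(n k) (fun H len => dist H len (v1 k) (v2 k)).
  by move=> H d T P X; exact: measurable_dist.
have m2 k : @measurable_functional R 'I_(n k) (fun H len => max_dist_from H len (v1 k)).
  by move=> H d T P X; exact: measurable_max_dist_from.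
have m3 k : @measurable_functional R 'I_(n k) (fun H len => max_dist H len).
  by move=> H d T P X; exact: measurable_max_dist.
have c1 k := dist_concentrates alpha01 (v12 k).
have c2 k := max_dist_from_concentrates alpha01 (v1 k).
have c3 k := @max_dist_concentrates R alpha 'I_(n k) alpha01.
have s1 : scale = (fun k => 1 * scale k) by apply/funext => k; rewrite mul1r.
split=> [m m_large m_small d T P A X A_uniform X_exp G len|half d T P X X_exp len].
  split.
  - rewrite s1; exact: (random_graph_whp alpha01 n_incr n_ge2 E_graph E_regular m1 c1
      m_large m_small A_uniform X_exp).
  - exact: (random_graph_whp alpha01 n_incr n_ge2 E_graph E_regular m2 c2
      m_large m_small A_uniform X_exp).
  - exact: (random_graph_whp alpha01 n_incr n_ge2 E_graph E_regular m3 c3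
      m_large m_small A_uniform X_exp).
split.
- rewrite s1; exact: (fixed_graph_whp alpha01 n_incr n_ge2 E_graph E_regular m1 c1 half X_exp).
- exact: (fixed_graph_whp alpha01 n_incr n_ge2 E_graph E_regular m2 c2 half X_exp).
- exact: (fixed_graph_whp alpha01 n_incr n_ge2 E_graph E_regular m3 c3 half X_exp).
Qed.
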